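(* For every integer $r\geq 4$ there exists a number $f(r)$ such that every $4$-edge-connected graph $G$ with $|V(G)|\geq f(r)$ contains $C_{2,r}$ as an immersion.
   Context: All graphs are finite and loopless but may have parallel edges. Lifting a pair of adjacent edges $uv,vw$ means deleting them and adding a new edge $uw$ (parallel to any existing $uw$ edges; if $u=w$ the resulting loop is deleted). A graph $H$ is an immersion of $G$ ($G$ contains $H$ as an immersion) if a graph isomorphic to $H$ can be obtained from a subgraph of $G$ by repeatedly lifting pairs of edges; equivalently, there is an injective map from $V(H)$ into $V(G)$ and an assignment to each edge of $H$ of a path in $G$ joining the images of its ends, such that these paths are pairwise edge-disjoint. The images of the vertices of $H$ are called the terminals of the immersion. For integers $t\geq 1$, $r\geq 2$, $C_{t,r}$ denotes the graph obtained from a cycle on $r$ vertices by replacing each edge by $t$ parallel edges. *)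

(* Defs.v *)
(* Finite loopless multigraphs are given by a vertex finType V,
   an edge finType E and an endpoint map ends : E -> V * V (edge identities
   allow parallel edges). *)
From mathcomp Require Import all_boot.
Set Implicit Arguments. Unset Strict Implicit. Unset Printing Implicit Defensive.

Section MultiGraph.
Variables (V E : finType) (ends : E -> V * V).

Definition loopless : Prop := forall e : E, (ends e).1 != (ends e).2.

Definition joins (e : E) (x y : V) : bool :=
  (ends e == (x, y)) || (ends e == (y, x)).

Fixpoint is_walk (x : V) (p : seq (E * V)) (y : V) : bool :=
  match p with
  | [::] => x == y
  | (e, v) :: p' => joins e x v && is_walk v p' y
  end.

Definition is_path (x : V) (p : seq (E * V)) (y : V) : bool :=
  is_walk x p y && uniq (x :: map snd p).

Definition edge_cut (S : {set V}) : {set E} :=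
  [set e | ((ends e).1 \in S) != ((ends e).2 \in S)].

Definition k_edge_connected (k : nat) : Prop :=
  forall S : {set V}, S != set0 -> S != setT -> k <= #|edge_cut S|.

Definition immersion (VH EH : finType) (endsH : EH -> VH * VH) : Prop :=
  exists (phi : VH -> V) (P : EH -> seq (E * V)),
    [/\ injective phi,
        forall f : EH, is_path (phi (endsH f).1) (P f) (phi (endsH f).2)
      & forall f g : EH, f != g ->
          [disjoint [seq q.1 | q <- P f] & [seq q.1 | q <- P g]]].

End MultiGraph.

(* C_{t,r}: cycle on vertices 'I_r, each edge i -- i+1 (mod r) replaced by t
   parallel edges; the edge (i, j) is the j-th copy of the edge i -- i+1. *)
Definition Cends (t r : nat) (f : 'I_r * 'I_t) : 'I_r * 'I_r :=
  (f.1, ordS f.1).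
Arguments Cends t r f : clear implicits.

(* Main.v *)
(* Splitting off reduces to maximum degree five, so there are vertices s and t at large
   distance. A second round of splitting (Mader's method) gives an s-t path P whose removal
   leaves all cuts of size at least two, and at least three between s and t; its vertices
   are the marks. In the graph without P, where one edge eps from s to t stands for P,
   unmarked vertices of degree four are split off and redundant edges deleted until every
   edge lies in a 2-cut or in a tight 4-cut separating s from t. In this reduced graph there
   are an s-t trail Q and a closed trail K through s, edge-disjoint, such that K meets many
   marks: otherwise a system of trails maximising first the marks and then the edges has its
   cuts determined by the few marks visited, so that K is short, although it may be required
   to pass through a vertex far from s. Finally the closed trails P + Q and K share many
   vertices; by Erdos-Szekeres, r of them occur in the same cyclic order on both, up to
   reversal, and consecutive ones are joined by a segment of each. *)

Require Import Defs.
From mathcomp Require Import all_boot.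
From mathcomp Require Import zify.
Set Implicit Arguments. Unset Strict Implicit. Unset Printing Implicit Defensive.

(** Splitting off controls cut sizes and their parities, so trails are carried as edge sets
    described by cuts, and vertex sequences are recovered from them only when an order is needed.
    The bound five has two uses: it keeps balls small, and once degree four is eliminated it makes
    every unmarked vertex of the reduced graph have degree exactly five, while trails use an even
    number of edges there. The obstacle is that a mark must never be split off, since it may become
    a terminal. After the removal of P only two kinds of cut are sure to have four edges: those with
    all marks on one side, which P does not cross, and those separating s from t, where [eps] adds
    one to three. All other cuts are only known to have two edges, hence the 2-cuts. The four edges
    of an s-t cut pay for [eps] and three strands; one strand becomes Q and the rest leaves room for
    K. That K is long is enforced by distance: if few marks were met, K would be shorter than the
    way to a vertex it has to visit. *)

Ltac nlia := intros; repeat match goal with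
  | H : is_true (leq _ _) |- _ => revert H
  | H : @eq nat _ _ |- _ => revert H end; clear; intros; lia.

(** * Cut sizes and uncrossing identities *)

Section Cuts.
Variables (V E : finType).
Implicit Types (g : E -> V * V) (A B : {set E}) (X Y Z : {set V}).

Definition cr g (e : E) X : bool := ((g e).1 \in X) (+) ((g e).2 \in X).
Definition dg g B X : nat := \sum_(e in B) cr g e X.
Definition btw g (e : E) X Y : bool :=
  ((g e).1 \in X) && ((g e).2 \in Y) || ((g e).1 \in Y) && ((g e).2 \in X).
Definition nb g B X Y : nat := \sum_(e in B) btw g e X Y.

Lemma edge_cutE g S : #|edge_cut g S| = dg g setT S.
Proof.
rewrite -sum1_card /dg big_mkcond [RHS]big_mkcond /=; apply: eq_bigr => e _.
by rewrite !inE /cr; case: (_ \in S); case: (_ \in S).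
Qed.

Lemma crC g e X : cr g e (~: X) = cr g e X.
Proof. by rewrite /cr !inE; case: (_ \in X); case: (_ \in X). Qed.

Lemma dgC g B X : dg g B (~: X) = dg g B X.
Proof. by apply: eq_bigr => e _; rewrite crC. Qed.

Lemma dg_set0 g X : dg g set0 X = 0.
Proof. by rewrite /dg big1 // => e; rewrite inE. Qed.

Lemma dg_set1 g e X : dg g [set e] X = cr g e X.
Proof. by rewrite /dg big_set1. Qed.

Lemma dgD1 g B e X : e \in B -> dg g B X = cr g e X + dg g (B :\ e) X.
Proof. by move=> eB; rewrite /dg (big_setD1 e). Qed.

Lemma dgU1 g B e X : e \notin B -> dg g (e |: B) X = cr g e X + dg g B X.
Proof. by move=> eB; rewrite /dg big_setU1. Qed.

Lemma dgDS g A B X : B \subset A -> dg g A X = dg g B X + dg g (A :\: B) X.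
Proof. by move=> sBA; rewrite /dg (big_setID B) /= (setIidPr sBA). Qed.

Lemma dgS g A B X : B \subset A -> dg g B X <= dg g A X.
Proof. by move=> /dgDS->; apply: leq_addr. Qed.

Lemma dgU g A B X : [disjoint A & B] -> dg g (A :|: B) X = dg g A X + dg g B X.
Proof.
move=> dAB; rewrite (@dgDS g (A :|: B) A) ?subsetUl //; congr (_ + dg _ _ _).
by rewrite setDUl setDv set0U; apply/setDidPl; rewrite disjoint_sym.
Qed.

Lemma dg_gt0P g B X : reflect (exists2 e, e \in B & cr g e X) (0 < dg g B X).
Proof.
apply: (iffP idP) => [|[e eB ce]]; last by rewrite (dgD1 _ _ eB) ce.
rewrite lt0n => nz; have /exists_inP[e eB ce] : [exists e in B, cr g e X]; last by exists e.
apply: contraNT nz => /exists_inPn H; rewrite /dg big1 // => e eB.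
by rewrite (negbTE (H e eB)).
Qed.

Lemma dg_eq0 g B X e : dg g B X = 0 -> e \in B -> cr g e X = false.
Proof. by move=> d0 eB; apply: contra_eqF d0 => ce; rewrite -lt0n; apply/dg_gt0P; exists e. Qed.

Lemma dg_eq_cr g g' B X Y : (forall e, e \in B -> cr g e X = cr g' e Y) -> dg g B X = dg g' B Y.
Proof. by move=> H; apply: eq_bigr => e /H->. Qed.

Ltac edgewise := rewrite /cr /btw !inE; do ![case: (_ \in _) => //=].

(** This identity and the next two keep the diagonal term [nb]: later arguments need the case of
    equality or a parity, which the inequalities would lose. *)
Lemma dg_submodE g B X Y :
  dg g B X + dg g B Y = dg g B (X :&: Y) + dg g B (X :|: Y) + (nb g B (X :\: Y) (Y :\: X)).*2.
Proof.
rewrite -addnn /dg /nb -!big_split /=; apply: eq_bigr => e _.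
edgewise.
Qed.

Lemma dg_posimodE g B X Y :
  dg g B X + dg g B Y = dg g B (X :\: Y) + dg g B (Y :\: X) + (nb g B (X :&: Y) (~: (X :|: Y))).*2.
Proof.
rewrite -addnn /dg /nb -!big_split /=; apply: eq_bigr => e _.
edgewise.
Qed.

Lemma dg_splitE g B X Y :
  dg g B X + (nb g B (X :&: Y) (X :\: Y)).*2 = dg g B (X :&: Y) + dg g B (X :\: Y).
Proof.
rewrite -addnn /dg /nb -!big_split /=; apply: eq_bigr => e _.
edgewise.
Qed.

Lemma dg_submod g B X Y : dg g B (X :&: Y) + dg g B (X :|: Y) <= dg g B X + dg g B Y.
Proof. by have := dg_submodE g B X Y; lia. Qed.

Lemma dg_posimod g B X Y : dg g B (X :\: Y) + dg g B (Y :\: X) <= dg g B X + dg g B Y.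
Proof. by have := dg_posimodE g B X Y; lia. Qed.

Lemma nb_gt0 g B X Y e : e \in B -> btw g e X Y -> 0 < nb g B X Y.
Proof. by move=> eB be; rewrite /nb (big_setD1 e) //= be. Qed.

(* Loops count on neither side. *)
Lemma sum_dg1 g B X :
  \sum_(x in X) dg g B [set x] =
  dg g B X + (\sum_(e in B) [&& (g e).1 \in X, (g e).2 \in X & (g e).1 != (g e).2]).*2.
Proof.
rewrite /dg exchange_big /= -addnn -!big_split /=; apply: eq_bigr => e _.
rewrite /cr; under eq_bigr do rewrite !inE.
case: (eqVneq (g e).1 (g e).2) => [->|ne].
  by rewrite big1 => [|x _]; rewrite !addbb ?andbF.
rewrite andbT (eq_bigr (fun x => ((g e).1 == x) + ((g e).2 == x)%N)); last first.
  by move=> x _; case: eqVneq => [<-|//]; rewrite eq_sym (negbTE ne).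
rewrite big_split /=.
have S y : \sum_(x in X) (y == x) = (y \in X).
  case: (boolP (y \in X)) => yX; last first.
    by rewrite big1 // => x xX; case: eqVneq xX yX => // -> ->.
  by rewrite (bigD1 y) //= eqxx big1 // => x /andP[_ /negPf]; rewrite eq_sym => ->.
by rewrite !S; do 2!case: (_ \in X).
Qed.

Definition vts g B : {set V} := [set x | 0 < dg g B [set x]].

Lemma in_vts g B x : (x \in vts g B) = (0 < dg g B [set x]).
Proof. by rewrite inE. Qed.

Lemma vtsS g A B : B \subset A -> vts g B \subset vts g A.
Proof. by move=> /dgS H; apply/subsetP => x; rewrite !inE => /leq_trans; apply. Qed.

Lemma vtsU g A B : vts g (A :|: B) = vts g A :|: vts g B.
Proof.
apply/eqP; rewrite eqEsubset subUset !vtsS ?subsetUl ?subsetUr // !andbT.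
apply/subsetP => x; rewrite !inE => /dg_gt0P[e]; rewrite inE => /orP[] eB ce.
  by apply/orP; left; apply/dg_gt0P; exists e.
by apply/orP; right; apply/dg_gt0P; exists e.
Qed.

Lemma vts_edge g B e : e \in B -> (g e).1 != (g e).2 ->
  ((g e).1 \in vts g B) && ((g e).2 \in vts g B).
Proof.
move=> eB ne; rewrite !inE; apply/andP; split; apply/dg_gt0P; exists e => //.
  by rewrite /cr !inE eqxx eq_sym (negbTE ne).
by rewrite /cr !inE eqxx (negbTE ne).
Qed.

Lemma cr_vts g B e X : e \in B -> cr g e X ->
  exists x y, [/\ joins g e x y, x \in X, y \notin X, x \in vts g B & y \in vts g B].
Proof.
move=> eB ce; have ne : (g e).1 != (g e).2.
  by apply: contraTneq ce => q; rewrite /cr q addbb.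
have /andP[v1 v2] := vts_edge eB ne.
move: ce; rewrite /cr; case: (boolP ((g e).1 \in X)) => [x1 /= x2|x1 /= x2].
  by exists (g e).1, (g e).2; split=> //; rewrite /joins -surjective_pairing eqxx.
exists (g e).2, (g e).1; split=> //.
by rewrite /joins; apply/orP; right; apply/eqP; case: (g e).
Qed.

Lemma dg_even_cut g B X : (forall x, x \in X -> ~~ odd (dg g B [set x])) -> ~~ odd (dg g B X).
Proof.
move=> H; have : ~~ odd (\sum_(x in X) dg g B [set x]).
  by elim/big_ind: _ => // a b; rewrite oddD => /negPf-> /negPf->.
by rewrite sum_dg1 oddD odd_double addbF.
Qed.

Lemma dg_parity g B X : odd (dg g B X) = odd (\sum_(x in X) dg g B [set x]).
Proof. by rewrite sum_dg1 oddD odd_double addbF. Qed.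

(** ** Connectivity *)

Definition adj g B : rel V := fun x y => [exists e in B, joins g e x y].
Definition conn g B : rel V := connect (adj g B).

Lemma joins_sym g e x y : joins g e x y = joins g e y x.
Proof. by rewrite /joins orbC. Qed.

Lemma joins_cr g e x y X : joins g e x y -> cr g e X = (x \in X) (+) (y \in X).
Proof. by case/orP=> /eqP q; rewrite /cr q //= addbC. Qed.

Lemma joins_self g e : joins g e (g e).1 (g e).2.
Proof. by rewrite /joins -surjective_pairing eqxx. Qed.

Lemma adj_sym g B : symmetric (adj g B).
Proof.
move=> x y; rewrite /adj; apply/exists_inP/exists_inP => -[e eB j]; exists e => //; by rewrite joins_sym.
Qed.

Lemma conn_refl g B x : conn g B x x. Proof. exact: connect0. Qed.
Lemma conn_sym g B : symmetric (conn g B).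
Proof. exact/sym_connect_sym/adj_sym. Qed.
Lemma conn_trans g B : transitive (conn g B). Proof. exact: connect_trans. Qed.

Lemma conn_edge g B e x y : e \in B -> joins g e x y -> conn g B x y.
Proof. by move=> eB j; apply: connect1; apply/exists_inP; exists e. Qed.

Lemma conn_mono g A B x y : B \subset A -> conn g B x y -> conn g A x y.
Proof.
move=> /subsetP sBA; apply: connect_sub => u v /exists_inP[e eB j].
exact: conn_edge (sBA _ eB) j.
Qed.

Lemma conn_cut g B x y X : conn g B x y -> dg g B X = 0 -> (x \in X) = (y \in X).
Proof.
move=> c d0; apply: (closed_connect _ c) => u v /exists_inP[e eB j].
by have := dg_eq0 d0 eB; rewrite (joins_cr _ j); do 2!case: (_ \in X).
Qed.

Definition component g B x : {set V} := [set y | conn g B x y].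

Lemma component_cut g B x : dg g B (component g B x) = 0.
Proof.
apply/eqP; rewrite -leqn0 leqNgt; apply/negP => /dg_gt0P[e eB].
have j := joins_self g e; rewrite (joins_cr _ j) !inE.
have c := conn_edge eB j.
have -> : conn g B x (g e).1 = conn g B x (g e).2.
  apply/idP/idP => h; first exact: conn_trans h c.
  by apply: conn_trans h _; rewrite conn_sym.
by rewrite addbb.
Qed.

Lemma conn_cutP g B x y :
  (forall X, x \in X -> y \notin X -> 0 < dg g B X) -> conn g B x y.
Proof.
move=> H; apply: contraT => nc.
by have := H (component g B x); rewrite component_cut !inE conn_refl nc => /(_ isT isT).
Qed.

Lemma conn_vts g B x y : conn g B x y -> x != y -> y \in vts g B.
Proof.
move=> c ne; rewrite in_vts lt0n; apply: contra ne => /eqP d0.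
by have := conn_cut c d0; rewrite !inE eqxx => ->.
Qed.

(** ** Trails and paths *)

Implicit Types (p q : seq (E * V)).
Definition eset p : {set E} := [set e | e \in map fst p].

Lemma in_eset p e : (e \in eset p) = (e \in map fst p). Proof. by rewrite inE. Qed.

Lemma eset_cons e v p : eset ((e, v) :: p) = e |: eset p.
Proof. by apply/setP => f; rewrite !inE. Qed.

Lemma eset_cat p q : eset (p ++ q) = eset p :|: eset q.
Proof. by apply/setP => f; rewrite !inE map_cat mem_cat. Qed.

Lemma walk_cat g x p q z :
  is_walk g x (p ++ q) z = is_walk g x p (last x (map snd p)) && is_walk g (last x (map snd p)) q z.
Proof.
elim: p x => [|[e v] p IH] x /=; first by rewrite eqxx.
by rewrite IH andbA.
Qed.

Lemma walk_last g x p y : is_walk g x p y -> y = last x (map snd p).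
Proof. by elim: p x => [|[e v] p IH] x /= => [/eqP//|/andP[_ /IH]]. Qed.

Lemma walk_conn g B x p y : is_walk g x p y -> eset p \subset B -> conn g B x y.
Proof.
elim: p x => [|[e v] p IH] x /= => [/eqP-> _|/andP[j w]]; first exact: conn_refl.
rewrite eset_cons subUset sub1set => /andP[eB sB].
exact: conn_trans (conn_edge eB j) (IH _ w sB).
Qed.

Lemma path_walk g B x (s : seq V) : path (adj g B) x s ->
  exists p, [/\ is_walk g x p (last x s), map snd p = s & eset p \subset B].
Proof.
elim: s x => [|v s IH] x /=.
  by move=> _; exists [::]; rewrite /= eqxx; split=> //; apply/subsetP => e; rewrite !inE.
case/andP=> /exists_inP[e eB j] /IH[p [w m sB]].
by exists ((e, v) :: p); rewrite /= j w m eset_cons subUset sub1set eB.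
Qed.

Lemma conn_path g B x y : conn g B x y ->
  exists p, is_path g x p y /\ eset p \subset B.
Proof.
case/connectP=> s s1 ->; case/shortenP: s1 => s' s1 u _.
by have [p [w m sB]] := path_walk s1; exists p; rewrite /is_path w m.
Qed.

Lemma walk_edge_vts g x p y e : is_walk g x p y -> e \in map fst p ->
  ((g e).1 \in x :: map snd p) && ((g e).2 \in x :: map snd p).
Proof.
elim: p x => [|[f v] p IH] x //= /andP[j w]; rewrite inE => /predU1P[->|ep]; last first.
  by have /andP[a b] := IH _ w ep; rewrite inE a orbT inE b orbT.
by case/orP: j => /eqP->; rewrite /= !inE !eqxx ?orbT.
Qed.

Lemma path_uniq_edges g x p y : is_path g x p y -> uniq (map fst p).
Proof.
case/andP; elim: p x => [|[e v] p IH] x //= /andP[j w] /andP[xn u].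
rewrite (IH v) ?andbT //; apply/negP => /(walk_edge_vts w) /andP[a b].
by case/orP: j => /eqP q; move: a b xn; rewrite q /= => a b; rewrite ?a ?b.
Qed.

Definition is_trail g x p y := is_walk g x p y && uniq (map fst p).

Lemma path_trail g x p y : is_path g x p y -> is_trail g x p y.
Proof. by move=> h; rewrite /is_trail (path_uniq_edges h) andbT; case/andP: h. Qed.

(** ** Edge sets of trails *)

Definition parity g B x y := forall v, odd (dg g B [set v]) = (v == x) (+) (v == y).
(** Connectedness of [B] together with x, phrased through cuts: a set containing x that no edge of
    [B] leaves must contain all of [B]. *)
Definition anchored g B x := forall X, x \in X -> dg g B X = 0 -> vts g B \subset X.
(** The Eulerian criterion for the edge set of a trail from x to y. Stated through cut sizes it
    passes through lifting, where a vertex sequence would have to be rebuilt. *)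
Definition trail_set g B x y := parity g B x y /\ anchored g B x.

Lemma joins_cr1 g e x y v : joins g e x y -> cr g e [set v] = (v == x) (+) (v == y).
Proof. by move=> j; rewrite (joins_cr _ j) !inE eq_sym (eq_sym y). Qed.

Lemma dg_anchored g B x X : anchored g B x -> x \notin X -> dg g B X = 0 ->
  [disjoint vts g B & X].
Proof.
move=> a xX d0; have := a (~: X); rewrite inE xX dgC => /(_ isT d0).
by rewrite disjoints_subset.
Qed.

Lemma parity_cut g B x y X : parity g B x y ->
  odd (dg g B X) = (x \in X) (+) (y \in X).
Proof.
move=> par; rewrite dg_parity.
have S z : odd (\sum_(v in X) (v == z)) = (z \in X).
  case: (boolP (z \in X)) => zX; last first.
    by rewrite big1 // => v vX; case: eqVneq vX zX => // -> ->.
  by rewrite (bigD1 z) //= eqxx big1 // => v /andP[_ /negPf->].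
rewrite -!S -oddD -big_split /=.
elim/big_ind2: _ => // [a b c d|v vX]; first by rewrite !oddD => -> ->.
by rewrite par oddD; do 2!case: (v == _).
Qed.

Lemma trail_set_sym g B x y : trail_set g B x y -> trail_set g B y x.
Proof.
case=> par anc; split=> [v|X yX d0]; first by rewrite par addbC.
apply: anc => //; have := parity_cut X par.
by rewrite d0 yX; case: (x \in X).
Qed.

Lemma trail_set_cat g A B x y z : [disjoint A & B] ->
  trail_set g A x y -> trail_set g B y z -> trail_set g (A :|: B) x z.
Proof.
move=> dAB [pA aA] [pB aB]; split=> [v|X xX].
  by rewrite dgU // oddD pA pB addbA addbK.
rewrite dgU // => /eqP; rewrite addn_eq0 => /andP[/eqP dA /eqP dB].
rewrite vtsU subUset aA //= aB //; have := parity_cut X pA.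
by rewrite dA xX; case: (y \in X).
Qed.

Lemma trail_set0 g x : trail_set g set0 x x.
Proof.
split=> [v|X _ _]; first by rewrite dg_set0 addbb.
by apply/subsetP => v; rewrite inE dg_set0.
Qed.

Lemma trail_set1 g e x y : joins g e x y -> trail_set g [set e] x y.
Proof.
move=> j; split=> [v|X xX d0]; first by rewrite dg_set1 oddb (joins_cr1 v j).
apply/subsetP => v; rewrite inE dg_set1 (joins_cr1 v j).
move: d0; rewrite dg_set1 (joins_cr _ j) xX.
case: (boolP (y \in X)) => // yX _.
by have [->//|_] := eqVneq v x; have [->|] := eqVneq v y.
Qed.

Lemma trail_trail_set g x p y : is_trail g x p y -> trail_set g (eset p) x y.
Proof.
case/andP; elim: p x => [|[e v] p IH] x /=.
  move=> /eqP-> _; have -> : eset [::] = set0 by apply/setP => e; rewrite !inE.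
  exact: trail_set0.
case/andP=> j w /andP[ep u]; rewrite eset_cons.
apply: trail_set_cat (IH _ w u); last exact: trail_set1.
by rewrite disjoints1 in_eset.
Qed.

Lemma trail_set_conn g B x y : trail_set g B x y -> conn g B x y.
Proof.
case=> par _; apply: conn_cutP => X xX yX; rewrite lt0n; apply/eqP => d0.
by have := parity_cut X par; rewrite d0 xX (negbTE yX).
Qed.

Lemma anchored_conn g B x v : anchored g B x -> v \in vts g B -> conn g B x v.
Proof.
move=> a vB; apply: conn_cutP => X xX vX; rewrite lt0n; apply: contra vX => /eqP d0.
exact: (subsetP (a _ xX d0)).
Qed.

(** Needed at a split-off vertex of degree four: a path through it leaves at least two of its
    edges. *)
Lemma path_deg_le2 g x p y v : is_path g x p y -> dg g (eset p) [set v] <= 2.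
Proof.
case/andP=> w u; have: is_trail g x p y by apply: path_trail; rewrite /is_path w u.
case/andP=> _; elim: p x w u => [|[e z] p IH] x /=.
  by move=> _ _ _; rewrite /dg big1 // => f; rewrite in_eset.
case/andP=> j w /andP[xn u] /andP[ep ue].
rewrite eset_cons dgU1 ?in_eset //.
have [->|vx] := eqVneq v x; last first.
  rewrite (joins_cr1 v j) (negbTE vx) /=; have [vz|vz] := eqVneq v z; last first.
    by rewrite add0n; exact: IH w u ue.
  subst z; case: p w u xn ep ue {IH} => [|[f t] p] /=.
    move=> _ _ _ _ _; have -> : dg g (eset [::]) [set v] = 0.
      by rewrite /dg big1 // => f; rewrite in_eset.
    by case: (v == v).
  move=> /andP[j2 w2] /andP[vn u2] _ _ /andP[fp _].
  rewrite eset_cons dgU1 ?in_eset // addnA.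
  have -> : dg g (eset p) [set v] = 0.
    rewrite /dg big1 // => h; rewrite in_eset => /(walk_edge_vts w2) /andP[a b].
    by rewrite /cr !inE; move: a b vn; case: eqVneq => [->->//|_ _]; case: eqVneq => [->->|].
  by rewrite addn0; case: cr; case: (v == v).
have -> : dg g (eset p) [set x] = 0; last by case: cr.
rewrite /dg big1 // => h; rewrite in_eset => /(walk_edge_vts w) /andP[a b].
by rewrite /cr !inE; move: a b xn; case: eqVneq => [->->//|_ _]; case: eqVneq => [->->|].
Qed.

Lemma trail_vts g x p y : is_trail g x p y -> vts g (eset p) \subset x :: map snd p.
Proof.
case/andP=> w _; apply/subsetP => v; rewrite in_vts => /dg_gt0P[e]; rewrite in_eset => ep.
have /andP[a b] := walk_edge_vts w ep.
by rewrite /cr !inE; case: eqVneq => [<- _|_ /=]; [|case: eqVneq => // <- _].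
Qed.

End Cuts.

(** ** Splitting off pairs of edges *)

Section Split.
Variables (V E : finType).
Implicit Types (g : E -> V * V) (A B : {set E}) (X Y Z : {set V}).

(** [L] replaces edges of the split graph by the original edges they stand for. The clauses are what
    is needed to carry connections and trail sets back; the last one prevents the middle vertices of
    lifted pairs from forming a separate piece. *)
Definition lift_map g A g' A' (L : {set E} -> {set E}) : Prop :=
  [/\ forall B, B \subset A' -> (L B \subset A) /\ (B \subset L B),
      forall B C : {set E}, B \subset A' -> C \subset A' -> [disjoint B & C] -> [disjoint L B & L C],
      forall B X, B \subset A' ->
        dg g' B X <= dg g (L B) X /\ odd (dg g (L B) X) = odd (dg g' B X)
    & forall B X, B \subset A' -> dg g (L B) X = 0 -> vts g' B \subset X ->
        vts g (L B) \subset X].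

Definition lifts g A g' A' := exists L, lift_map g A g' A' L.

Lemma lifts_sub g A A' : A' \subset A -> lifts g A g A'.
Proof.
by move=> sA; exists id; split=> // B sB; split=> //; apply: subset_trans sB sA.
Qed.

Lemma lifts_trans g A g' A' g'' A'' : lifts g A g' A' -> lifts g' A' g'' A'' -> lifts g A g'' A''.
Proof.
move=> [L [a1 a2 a3 a4]] [M [b1 b2 b3 b4]]; exists (L \o M); split=> /=.
- move=> B sB; have [m1 m2] := b1 _ sB; have [l1 l2] := a1 _ m1.
  by split=> //; apply: subset_trans l2.
- by move=> B C sB sC dBC; apply: a2 (b1 _ sB).1 (b1 _ sC).1 _; apply: b2.
- move=> B X sB; have [m1 _] := b1 _ sB.
  have [p1 p2] := b3 B X sB; have [q1 q2] := a3 _ X m1.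
  by split; [apply: leq_trans q1 | rewrite q2].
- move=> B X sB d0 sX; have [m1 _] := b1 _ sB.
  apply: a4 => //; apply: b4 => //; apply/eqP; rewrite -leqn0 -d0.
  by case: (a3 _ X m1).
Qed.

Section Lifted.
Variables (g g' : E -> V * V) (A A' : {set E}) (L : {set E} -> {set E}).
Hypothesis lL : lift_map g A g' A' L.

Lemma lift_conn B x y : B \subset A' -> conn g' B x y -> conn g (L B) x y.
Proof.
case: lL => _ _ l3 _ sB c; apply: conn_cutP => X xX yX.
apply: leq_trans (l3 B X sB).1; rewrite lt0n; apply: contraNneq yX => d0.
by rewrite -(conn_cut c d0).
Qed.

Lemma lift_vts B : B \subset A' -> vts g' B \subset vts g (L B).
Proof.
case: lL => _ _ l3 _ sB; apply/subsetP => x; rewrite !in_vts => h.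
exact: leq_trans h (l3 B _ sB).1.
Qed.

Lemma lift_trail_set B x y : B \subset A' -> trail_set g' B x y -> trail_set g (L B) x y.
Proof.
case: lL => _ _ l3 l4 sB [par anc]; split=> [v|X xX d0].
  by rewrite (l3 B _ sB).2.
by apply: l4 => //; apply: anc => //; apply/eqP; rewrite -leqn0 -d0; case: (l3 B X sB).
Qed.

End Lifted.

Section Pair.
Variables (g : E -> V * V) (A : {set E}) (f1 f2 : E) (v u w : V).
Hypotheses (f1A : f1 \in A) (f2A : f2 \in A) (f12 : f1 != f2).
Hypotheses (j1 : joins g f1 v u) (j2 : joins g f2 v w).

(** The edge [f1] is recycled as the lifted edge and [f2] is dropped, so the edge type never
    changes; if u = w the lifted edge would be a loop and both disappear. *)
Definition splitg : E -> V * V := fun e => if e == f1 then (u, w) else g e.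
Definition splitA : {set E} := if u == w then A :\ f1 :\ f2 else A :\ f2.
Definition splitc X : bool :=
  [&& u \in X, w \in X & v \notin X] || [&& u \notin X, w \notin X & v \in X].

Lemma split_dg X : dg g A X = dg splitg splitA X + (splitc X).*2.
Proof.
rewrite (dgD1 _ _ f1A) (dgD1 _ _ (_ : f2 \in A :\ f1)) ?inE 1?eq_sym ?f12 //.
have E0 : dg g (A :\ f1 :\ f2) X = dg splitg (A :\ f1 :\ f2) X.
  by apply: dg_eq_cr => e; rewrite !inE /cr /splitg => /and3P[_ /negPf-> _].
rewrite (joins_cr X j1) (joins_cr X j2) E0 /splitA /splitc; case: eqVneq => [->|uw].
  by do 2!case: (_ \in X); lia.
rewrite (dgD1 _ X (_ : f1 \in A :\ f2)) ?inE ?f12 // /cr {2 3}/splitg eqxx /=.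
have -> : A :\ f2 :\ f1 = A :\ f1 :\ f2 by apply/setP => e; rewrite !inE andbCA.
by do 3!case: (_ \in X) => /=; lia.
Qed.

Lemma splitA_sub : splitA \subset A.
Proof.
rewrite /splitA; apply/subsetP => e; case: ifP => _; rewrite !inE => /andP[_] //.
by case/andP.
Qed.

Lemma splitA_card : #|splitA| < #|A|.
Proof.
apply: proper_card; rewrite properE splitA_sub /=; apply/subsetPn; exists f2 => //.
by rewrite /splitA; case: ifP; rewrite !inE eqxx.
Qed.

Lemma split_loopless : (forall e, e \in A -> (g e).1 != (g e).2) ->
  forall e, e \in splitA -> (splitg e).1 != (splitg e).2.
Proof.
move=> ll e eA; rewrite /splitg; case: (eqVneq e f1) => [ef|_]; last by apply: ll; apply: (subsetP splitA_sub).
by move: eA; rewrite ef /splitA /=; case: (eqVneq u w) => [_|//]; rewrite !inE eqxx andbF.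
Qed.

Definition split_lift B := if f1 \in B then f2 |: B else B.

Lemma split_liftP : lift_map g A splitg splitA split_lift.
Proof.
have f2N : f2 \notin splitA by rewrite /splitA; case: ifP; rewrite !inE eqxx.
have f2B B : B \subset splitA -> f2 \notin B by move=> /subsetP s; apply: contra f2N => /s.
have f1B B : B \subset splitA -> f1 \in B -> u != w.
  by move=> /subsetP s /s; rewrite /splitA; case: eqVneq; rewrite ?inE ?eqxx ?andbF.
have D B X : B \subset splitA ->
    dg g (split_lift B) X = dg splitg B X + (if f1 \in B then (splitc X).*2 else 0).
  move=> sB; rewrite /split_lift; case: ifP => f1b; last first.
    rewrite addn0; apply: dg_eq_cr => e eB; rewrite /cr /splitg.
    by case: eqVneq eB f1b => // -> ->.
  rewrite dgU1 ?f2B // (dgD1 g X f1b) (dgD1 splitg X f1b) (joins_cr X j2) (joins_cr X j1).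
  have -> : cr splitg f1 X = (u \in X) (+) (w \in X) by rewrite /cr /splitg eqxx.
  have -> : dg splitg (B :\ f1) X = dg g (B :\ f1) X.
    by apply: dg_eq_cr => e; rewrite !inE /cr /splitg => /andP[/negPf-> _].
  rewrite /splitc.
  by do 3!case: (_ \in X) => /=; lia.
split.
- move=> B sB; split; rewrite /split_lift; case: ifP => // _; rewrite ?subsetUr //.
    by rewrite subUset sub1set f2A (subset_trans sB splitA_sub).
  exact: subset_trans sB splitA_sub.
- move=> B C sB sC dBC; rewrite /split_lift.
  have H b (D1 D2 : {set E}) : D1 \subset splitA -> D2 \subset splitA ->
     [disjoint D1 & D2] -> [disjoint (if b then f2 |: D1 else D1) & D2].
    move=> s1 s2 d12; case: b => //; rewrite -setI_eq0 setIUl setU_eq0 !setI_eq0 d12 andbT.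
    by rewrite disjoints1 f2B.
  case: ifP => f1b; case: ifP => f1c; try exact: (H true).
  + by move/pred0P: dBC => /(_ f1); rewrite /= f1b f1c.
  + by rewrite disjoint_sym; apply: (H true) => //; rewrite disjoint_sym.
  + exact: dBC.
- move=> B X sB; rewrite D //; split; first exact: leq_addr.
  by case: ifP => _; rewrite oddD ?odd_double addbF.
- move=> B X sB; rewrite D // => /eqP; rewrite addn_eq0 => /andP[/eqP d0 c0] sX.
  apply/subsetP => z; rewrite in_vts D // addn_gt0 => /orP[h|].
    by apply: (subsetP sX); rewrite in_vts.
  case: ifP c0 => // f1b; rewrite !double_gt0 double_eq0 eqb0 lt0b /splitc.
  have uw := f1B _ sB f1b.
  (* The lifted edge is not a loop, so u and w both lie in [X]; as the lifted set does not cross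
     [X], the middle vertex v lies there too. *)
  have : ((splitg f1).1 \in vts splitg B) && ((splitg f1).2 \in vts splitg B).
    by apply: vts_edge => //; rewrite /splitg eqxx.
  rewrite /splitg eqxx /= => /andP[/(subsetP sX) -> /(subsetP sX) ->] /=; rewrite orbF negbK => vX.
  rewrite !inE; have [q|uz] := eqVneq u z; first by rewrite -q in uw *; rewrite eq_sym (negbTE uw).
  by case/and3P=> _ _ /eqP <-.
Qed.

End Pair.

End Split.

(** ** Tight separating cuts and Menger's theorem *)

Section Layer.
Variables (V E : finType) (g : E -> V * V) (A : {set E}) (s t : V) (k : nat).
Implicit Types (X Y Z : {set V}).
Hypothesis hk : forall X, s \in X -> t \notin X -> k <= dg g A X.

Definition tight X := [&& s \in X, t \notin X & dg g A X == k].

Lemma tightI X Y : tight X -> tight Y -> tight (X :&: Y).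
Proof.
case/and3P=> sX tX /eqP dX /and3P[sY tY /eqP dY].
have sI : s \in X :&: Y by rewrite inE sX.
have tI : t \notin X :&: Y by rewrite inE (negbTE tX).
rewrite /tight sI tI /= eqn_leq hk // andbT.
have := dg_submod g A X Y; have := @hk (X :|: Y); rewrite !inE sX (negbTE tX) (negbTE tY) => /(_ isT isT).
lia.
Qed.

Lemma tightU X Y : tight X -> tight Y -> tight (X :|: Y).
Proof.
case/and3P=> sX tX /eqP dX /and3P[sY tY /eqP dY].
have sI : s \in X :|: Y by rewrite inE sX.
have tI : t \notin X :|: Y by rewrite inE (negbTE tX) (negbTE tY).
rewrite /tight sI tI /= eqn_leq hk // andbT.
have := dg_submod g A X Y; have := @hk (X :&: Y); rewrite !inE sX sY (negbTE tX) => /(_ isT isT).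
lia.
Qed.

Lemma tight_nb X Y : tight X -> tight Y -> nb g A (X :\: Y) (Y :\: X) = 0.
Proof.
move=> tX tY; have := dg_submodE g A X Y.
case/and3P: (tightI tX tY) => _ _ /eqP->; case/and3P: (tightU tX tY) => _ _ /eqP->.
case/and3P: tX => _ _ /eqP->; case/and3P: tY => _ _ /eqP->; lia.
Qed.

Variable v : V.
Hypotheses (vs : v != s) (vt : v != t).
Hypothesis tight_at : forall e, e \in A -> cr g e [set v] -> exists2 X, tight X & cr g e X.

(* The tight cuts form a lattice; every edge at v leaves the largest one avoiding v
   or the smallest one containing v, and moving v across both balances the two kinds. *)
Lemma layer_parity : 0 < dg g A [set v] ->
  exists P Q f1 f2 u w,
  [/\ [/\ f1 \in A, f2 \in A & f1 != f2], joins g f1 v u /\ joins g f2 v w,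
      u \in P :&: Q /\ w \notin P :|: Q,
      [/\ forall X, tight X -> v \notin X -> X \subset P &
          forall X, tight X -> v \in X -> Q \subset X] & ~~ odd (dg g A [set v])].
Proof.
move=> dv0; have /dg_gt0P[e0 e0A ce0] := dv0.
have [[Pex|Pno] [Qex|Qno]] : ((exists X, tight X && (v \notin X)) \/ (forall X, tight X -> v \in X)) /\
   ((exists X, tight X && (v \in X)) \/ (forall X, tight X -> v \notin X)).
- split.
  + case: (boolP [exists X : {set V}, tight X && (v \notin X)]) => [/existsP|/existsPn H]; first by left.
    by right=> X tX; have := H X; rewrite tX negbK.
  + case: (boolP [exists X : {set V}, tight X && (v \in X)]) => [/existsP|/existsPn H]; first by left.
    by right=> X tX; have := H X; rewrite tX.
- have [P /andP[tP vP] Pmax] : exists2 P, tight P && (v \notin P) &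
     forall X, tight X -> v \notin X -> X \subset P.
    case: Pex => X0 h0; case: (@arg_maxnP _ X0 (fun X : {set V} => tight X && (v \notin X)) (fun X : {set V} => #|X|) h0) => P hP mP; exists P => // X tX vX.
    case/andP: hP => tP vP; have := mP (X :|: P).
    rewrite tightU // inE (negbTE vX) (negbTE vP) => /(_ isT) le.
    by have /eqP-> : P == X :|: P; [rewrite eqEcard subsetUr | apply: subsetUl].
  have [Q /andP[tQ vQ] Qmin] : exists2 Q, tight Q && (v \in Q) &
     forall X, tight X -> v \in X -> Q \subset X.
    case: Qex => X0 h0; case: (@arg_minnP _ X0 (fun X : {set V} => tight X && (v \in X)) (fun X : {set V} => #|X|) h0) => Q hQ mQ; exists Q => // X tX vX.
    case/andP: hQ => tQ vQ; have := mQ (X :&: Q).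
    rewrite tightI // inE vX vQ => /(_ isT) le.
    by have /eqP<- : X :&: Q == Q; [rewrite eqEcard subsetIr | apply: subsetIl].
  have nb0 := tight_nb tP tQ.
  have side e y : e \in A -> joins g e v y -> y != v -> (y \in P :&: Q) || (y \notin P :|: Q).
    move=> eA j yv; have ce : cr g e [set v] by rewrite (joins_cr _ j) !inE eqxx (negbTE yv).
    have nPQ : ~~ ((y \in P) && (y \notin Q)).
      apply/negP => /andP[yP yQ]; have : 0 < nb g A (P :\: Q) (Q :\: P); last by rewrite nb0.
      apply: (nb_gt0 eA); case/orP: j => /eqP q; rewrite /btw q /= !inE yP yQ vQ vP //=.
    have [X tX] := tight_at eA ce; rewrite (joins_cr _ j) !inE.
    case: (boolP (v \in X)) => vX /= yX.
      have yQ : y \notin Q by apply: contra yX => /(subsetP (Qmin X tX vX)).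
      by rewrite (negbTE yQ) orbF; move: nPQ; rewrite yQ andbT => ->; rewrite orbT.
    have yP : y \in P := subsetP (Pmax X tX vX) _ yX.
    by move: nPQ; rewrite yP /= negbK => ->.
  (* Every edge at v ends in both P and Q or in neither; p and q count the two kinds. Adding v to P
     gives p <= q, removing v from Q gives q <= p. *)
  set p := nb g A [set v] (P :&: Q); set q := nb g A [set v] (~: (P :|: Q)).
  have Dv : dg g A [set v] = p + q.
    rewrite /dg /p /q /nb -big_split /=; apply: eq_bigr => e eA.
    have HH y : joins g e v y -> y != v -> cr g e [set v] =
      ((y \in P :&: Q) + (y \in ~: (P :|: Q)))%N :> nat.
      move=> j yv; rewrite (joins_cr _ j) !inE eqxx (negbTE yv).
      by have := side e y eA j yv; rewrite !inE; case: (y \in P); case: (y \in Q).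
    have j0 := joins_self g e; rewrite /btw.
    have [e1v|e1v] := eqVneq (g e).1 v; have [e2v|e2v] := eqVneq (g e).2 v.
    - by rewrite /cr e1v e2v !inE eqxx (negbTE vP) vQ.
    - move: j0; rewrite e1v => j0; rewrite (HH _ j0 e2v) !inE eqxx (negbTE e2v) (negbTE vP) vQ /=.
      by rewrite ?andbF ?orbF.
    - move: j0; rewrite e2v joins_sym => j0; rewrite (HH _ j0 e1v) !inE eqxx (negbTE e1v) (negbTE vP) vQ /=.
      by rewrite ?andbT ?andbF ?orbF.
    - by rewrite /cr !inE (negbTE e1v) (negbTE e2v) /= ?andbF.
  have DP : dg g A (v |: P) + p.*2 = k + dg g A [set v].
    have := dg_splitE g A (v |: P) P.
    have -> : (v |: P) :&: P = P by apply/setP => z; rewrite !inE; case: (z \in P); rewrite ?orbT ?andbF.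
    have -> : (v |: P) :\: P = [set v].
      by apply/setP => z; rewrite !inE; case: eqVneq => [->|_]; rewrite ?vP // orFb andNb.
    case/and3P: tP => _ _ /eqP->.
    have -> // : nb g A P [set v] = p.
    apply: eq_bigr => e eA; rewrite /btw; congr (nat_of_bool _).
    have HH y : joins g e v y -> y != v -> (y \in P) = (y \in P :&: Q).
      by move=> j yv; have := side e y eA j yv; rewrite !inE; case: (y \in P); case: (y \in Q).
    have j0 := joins_self g e.
    have [e1v|e1v] := eqVneq (g e).1 v; have [e2v|e2v] := eqVneq (g e).2 v.
    - by rewrite e1v e2v !inE eqxx (negbTE vP).
    - move: j0 (HH (g e).2); rewrite e1v => j0 /(_ j0 e2v); rewrite !inE eqxx (negbTE e2v) (negbTE vP) ?vQ ?andbF /=.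
      by case: (_ \in P); case: (_ \in Q).
    - move: j0 (HH (g e).1); rewrite e2v joins_sym => j0 /(_ j0 e1v); rewrite !inE eqxx (negbTE e1v) (negbTE vP) ?vQ ?andbF /=.
      by case: (_ \in P); case: (_ \in Q).
    - by rewrite !inE (negbTE e1v) (negbTE e2v) ?andbF.
  have DQ : k + p.*2 = dg g A (Q :\ v) + dg g A [set v].
    have := dg_splitE g A Q (~: [set v]).
    have -> : Q :&: ~: [set v] = Q :\ v by apply/setP => z; rewrite !inE andbC.
    have -> : Q :\: ~: [set v] = [set v].
      by apply/setP => z; rewrite !inE negbK; case: eqVneq => [->|_]; rewrite ?vQ.
    case/and3P: tQ => _ _ /eqP->.
    have -> // : nb g A (Q :\ v) [set v] = p.
    apply: eq_bigr => e eA; rewrite /btw; congr (nat_of_bool _).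
    have HH y : joins g e v y -> y != v -> (y \in Q) = (y \in P :&: Q).
      by move=> j yv; have := side e y eA j yv; rewrite !inE; case: (y \in P); case: (y \in Q).
    have j0 := joins_self g e.
    have [e1v|e1v] := eqVneq (g e).1 v; have [e2v|e2v] := eqVneq (g e).2 v.
    - by rewrite e1v e2v !inE eqxx (negbTE vP).
    - move: j0 (HH (g e).2); rewrite e1v => j0 /(_ j0 e2v); rewrite !inE eqxx (negbTE e2v) (negbTE vP) ?vQ ?andbF /=.
      by case: (_ \in P); case: (_ \in Q).
    - move: j0 (HH (g e).1); rewrite e2v joins_sym => j0 /(_ j0 e1v); rewrite !inE eqxx (negbTE e1v) (negbTE vP) ?vQ ?andbF /=.
      by case: (_ \in P); case: (_ \in Q).
    - by rewrite !inE (negbTE e1v) (negbTE e2v) ?andbF.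
  have k1 : k <= dg g A (v |: P).
    by case/and3P: tP => sP tP _; apply: hk; rewrite !inE ?sP ?orbT // (negbTE tP) orbF eq_sym.
  have k2 : k <= dg g A (Q :\ v).
    by case/and3P: tQ => sQ tQ' _; apply: hk; rewrite !inE ?sQ ?andbT 1?eq_sym // (negbTE tQ') andbF.
  have [pq p0] : p = q /\ 0 < p by lia.
  have q0 : 0 < q by rewrite -pq.
  have wit (S : {set V}) : v \notin S -> 0 < nb g A [set v] S -> exists e y, [/\ e \in A, joins g e v y & y \in S].
    move=> vS; rewrite lt0n => nz.
    have /exists_inP[e eA be] : [exists e in A, btw g e [set v] S].
      apply: contraNT nz => /exists_inPn H; rewrite /nb big1 // => e eA.
      by rewrite (negbTE (H e eA)).
    have j0 := joins_self g e.
    case/orP: be; rewrite inE => /andP[].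
      by move=> /eqP e1 e2; exists e, (g e).2; split=> //; rewrite -e1.
    move=> e1 /eqP e2; exists e, (g e).1; split=> //; by rewrite joins_sym -e2.
  have [] := wit (P :&: Q) _ p0; first by rewrite inE (negbTE vP).
  move=> f1 [u [f1A j1 uPQ]].
  have [] := wit (~: (P :|: Q)) _ q0; first by rewrite !inE vQ orbT.
  move=> f2 [w [f2A j2 wPQ]].
  exists P, Q, f1, f2, u, w; split=> //; last by rewrite Dv pq addnn odd_double.
    split=> //; apply: contraTneq uPQ => f12; subst f2.
    have : w = u.
      case/orP: j1 j2 => /eqP q1 /orP[] /eqP q2; move: q2; rewrite q1 => -[]; congruence.
    by move=> <-; move: wPQ; rewrite !inE; case: (w \in P); case: (w \in Q).
  by split=> //; move: wPQ; rewrite inE.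
(* No tight set contains v: all edges at v end in the largest tight set, and adding v to it would
   give an s-t cut below k. *)
- case: Pex => X0 h0.
  case: (@arg_maxnP _ X0 (fun X : {set V} => tight X && (v \notin X)) (fun X : {set V} => #|X|) h0).
  move=> P /andP[tP vP] mP; have Pmax X : tight X -> X \subset P.
    move=> tX; have := mP (X :|: P).
    rewrite tightU // inE (negbTE (Qno X tX)) (negbTE vP) => /(_ isT) le.
    by have /eqP-> : P == X :|: P; [rewrite eqEcard subsetUr | apply: subsetUl].
  have := dg_splitE g A (v |: P) P.
  have -> : (v |: P) :&: P = P by apply/setP => z; rewrite !inE; case: (z \in P); rewrite ?orbT ?andbF.
  have -> : (v |: P) :\: P = [set v].
    by apply/setP => z; rewrite !inE; case: eqVneq => [->|_]; rewrite ?vP // orFb andNb.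
  have -> : nb g A P [set v] = dg g A [set v].
    apply: eq_bigr => e eA; congr (nat_of_bool _).
    have [ce|/negbTE ce] := boolP (cr g e [set v]); last first.
      move: ce; rewrite /cr /btw !inE.
      by case: eqVneq => [->|_]; case: eqVneq => [->|_] //= _; rewrite ?(negbTE vP) ?andbF.
    have [X tX] := tight_at eA ce; move: ce; rewrite /cr /btw !inE.
    have vX := negbTE (Qno X tX); have /subsetP sX := Pmax X tX.
    case: eqVneq => [->|_]; case: eqVneq => [->|_] //= _; rewrite vX /= ?addbF => /sX->; by rewrite ?orbT.
  have k1 : k <= dg g A (v |: P).
    by case/and3P: tP => sP tP _; apply: hk; rewrite !inE ?sP ?orbT // (negbTE tP) orbF eq_sym.
  by case/and3P: tP => _ _ /eqP->; lia.
(* Every tight set contains v: no edge at v ends in the smallest one, and removing v from it would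
   give an s-t cut below k. *)
- case: Qex => X0 h0.
  case: (@arg_minnP _ X0 (fun X : {set V} => tight X && (v \in X)) (fun X : {set V} => #|X|) h0).
  move=> Q /andP[tQ vQ] mQ; have Qmin X : tight X -> Q \subset X.
    move=> tX; have := mQ (X :&: Q).
    rewrite tightI // inE (Pno X tX) vQ => /(_ isT) le.
    by have /eqP<- : X :&: Q == Q; [rewrite eqEcard subsetIr | apply: subsetIl].
  have := dg_splitE g A Q (~: [set v]).
  have -> : Q :&: ~: [set v] = Q :\ v by apply/setP => z; rewrite !inE andbC.
  have -> : Q :\: ~: [set v] = [set v].
    by apply/setP => z; rewrite !inE negbK; case: eqVneq => [->|_]; rewrite ?vQ.
  have -> : nb g A (Q :\ v) [set v] = 0.
    rewrite /nb big1 // => e eA; apply/eqP; rewrite eqb0; apply/negP => be.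
    have ce : cr g e [set v].
      move: be; rewrite /btw /cr !inE.
      by case: eqVneq => _; case: eqVneq => _; rewrite ?andbF.
    have [X tX] := tight_at eA ce; move: be; rewrite /cr /btw !inE.
    have vX := Pno X tX; have /subsetP sX := Qmin X tX.
    case/orP=> [/andP[/andP[_ /sX->] /eqP->]|/andP[/eqP-> /andP[_ /sX->]]]; by rewrite vX.
  have k2 : k <= dg g A (Q :\ v).
    by case/and3P: tQ => sQ tQ' _; apply: hk; rewrite !inE ?sQ ?andbT 1?eq_sym // (negbTE tQ') andbF.
  by case/and3P: tQ => _ _ /eqP->; lia.
- have [X tX _] := tight_at e0A ce0.
  by have := Pno X tX; rewrite (negbTE (Qno X tX)).
Qed.

End Layer.

(** A cut of the right parity that is not tight exceeds k by at least two, so a splitting, which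
    costs two, leaves at least k. *)
Lemma parity_gap k a : odd k = odd a -> a.+2 != k -> k <= a.+2 -> k <= a.
Proof.
move=> op ne le; rewrite leqNgt; apply/negP => lt; have ek : k = a.+1 by lia.
by move: op; rewrite ek /=; case: (odd a).
Qed.

(** * Menger's theorem by splitting off *)

Section Menger.
Variables (V E : finType).
Implicit Types (g : E -> V * V) (A B : {set E}) (X Y Z T : {set V}).

Lemma cr1_joins g e x : cr g e [set x] -> exists2 y, joins g e x y & y != x.
Proof.
rewrite /cr !inE; case: eqVneq => [q|ne] /= q2.
  by exists (g e).2 => //; rewrite -q joins_self.
by exists (g e).1 => //; rewrite -(eqP q2) joins_sym joins_self.
Qed.

(** Induction on the edges. Without redundant edges every edge crosses a tight set, and
    [layer_parity] yields at any inner vertex with edges a pair that can be split off. When no such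
    vertex is left, the edges at s are parallel s-t edges. Paths are brought back by the lift as
    connections inside disjoint edge sets. *)
Lemma menger g A s t k : s != t ->
  (forall X, s \in X -> t \notin X -> k <= dg g A X) ->
  exists f : 'I_k -> {set E}, [/\ forall i, f i \subset A,
    forall i j, i != j -> [disjoint f i & f j] & forall i, conn g (f i) s t].
Proof.
move=> st; have [n] := ubnP #|A|; elim: n => // n IH in g A *; rewrite ltnS => cA hk.
have [/exists_inP[e eA /forallP del]|nodel] := boolP [exists e in A, forall X : {set V},
   (s \in X) && (t \notin X) ==> (k <= dg g (A :\ e) X)].
  have [||f [f1 f2 f3]] := IH g (A :\ e).
  - by move: cA; rewrite (cardsD1 e) eA.
  - by move=> X sX tX; have := del X; rewrite sX tX.
  - by exists f; split=> // i; apply: subset_trans (f1 i) (subsetDl _ _).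
have tt e : e \in A -> exists2 X, tight g A s t k X & cr g e X.
  move=> eA; have := exists_inPn nodel e eA; rewrite negb_forall => /existsP[X].
  rewrite negb_imply -ltnNge => /andP[/andP[sX tX] lt].
  have := hk X sX tX; move: lt; rewrite (dgD1 g X eA) => lt le.
  exists X; last by case: cr le lt => // le lt; lia.
  by rewrite /tight sX tX /= (dgD1 g X eA); case: cr le lt => le lt; apply/eqP; lia.
have [/existsP[v /and3P[vs vt dv]]|none] := boolP [exists v, [&& v != s, v != t & 0 < dg g A [set v]]].
  have even_deg z : z != s -> z != t -> ~~ odd (dg g A [set z]).
    move=> zs zt; have [->//|] := posnP (dg g A [set z]).
    by case/(layer_parity hk zs zt (fun e eA _ => tt e eA)) => ? [? [? [? [? [? []]]]]].
  (* Inner degrees are even, so all s-t cuts share the parity of the tight ones. *)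
  have par X : s \in X -> t \notin X -> odd (dg g A X) = odd (dg g A [set s]).
    move=> sX tX; rewrite dg_parity (bigD1 s) //= oddD.
    suff /negPf-> : ~~ odd (\sum_(z in X | z != s) dg g A [set z]) by rewrite addbF.
    elim/big_ind: _ => // [a b|z /andP[zX zs]]; first by rewrite oddD => /negPf-> /negPf->.
    by apply: even_deg => //; apply: contraNneq tX => <-.
  have [P [Q [f1 [f2 [u [w [[f1A f2A f12] [j1 j2] [uPQ wPQ] [hP hQ] _]]]]]]] :=
    layer_parity hk vs vt (fun e eA _ => tt e eA) dv.
  pose g' := splitg g f1 u w; pose A' := splitA A f1 f2 u w.
  have cA' : #|A'| < n by apply: leq_trans (splitA_card f1 u w f2A) _.
  have hk' X : s \in X -> t \notin X -> k <= dg g' A' X.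
    move=> sX tX; have := hk X sX tX; rewrite (split_dg f1A f2A f12 j1 j2 X).
    have [sc|_] := boolP (splitc v u w X); last by rewrite addn0.
    have [/eqP op|] := boolP (odd k == odd (dg g A X)); last first.
      have [X0 tX0 _] := tt _ f1A; case/and3P: tX0 => sX0 tX0 /eqP <-.
      by rewrite !par // eqxx.
    rewrite -/g' -/A'.
    (* A set that loses edges has u and w on one side and v on the other. A tight one would lie in P
       and contain w, or contain Q and miss u. *)
    have ntX : ~~ tight g A s t k X.
      apply/negP => tXX; move: sc; rewrite /splitc; case/orP=> /and3P[uX wX vX].
        by move: wPQ; rewrite inE (subsetP (hP X tXX vX) _ wX).
      by move: uX; rewrite (subsetP (hQ X tXX vX)) //; move: uPQ; rewrite inE => /andP[].
    move: op ntX; rewrite /tight sX tX /= (split_dg f1A f2A f12 j1 j2 X) sc -/g' -/A' /=.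
    by rewrite oddD addbF addn2 => op ne le; apply: parity_gap op ne le.
  have [f [h1 h2 h3]] := IH g' A' cA' hk'.
  have L := split_liftP f1A f2A f12 j1 j2.
  exists (fun i => split_lift f1 f2 (f i)); case: (L) => l1 l2 l3 l4; split=> [i|i j ij|i].
  - by case: (l1 _ (h1 i)).
  - exact: l2 (h1 i) (h1 j) (h2 i j ij).
  - by have := lift_conn L (h1 i) (h3 i).
pose A0 := [set e in A | cr g e [set s]].
have cA0 : k <= #|A0|.
  apply: leq_trans (hk [set s] _ _) _; rewrite ?inE // 1?eq_sym // -sum1_card /dg big_mkcond [leqRHS]big_mkcond /=.
  by apply: leq_sum => e _; rewrite inE; case: (e \in A) => //=; case: cr.
have st_edge e : e \in A0 -> joins g e s t.
  rewrite inE => /andP[eA /cr1_joins[y j ys]].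
  have [<-//|yt] := eqVneq y t; have := existsPn none y.
  rewrite ys yt /= -eqn0Ngt => /eqP /dg_eq0 /(_ eA).
  by rewrite (joins_cr1 _ j) eqxx (negbTE ys).
(* [e0] only serves as a default for [nth]; if there is no edge, k is 0 and no path is asked for. *)
have [e0 e0A|noE] := pickP (mem A0); last first.
  have k0 : k = 0 by apply/eqP; rewrite -leqn0 (leq_trans cA0) // leqn0 cards_eq0; apply/eqP/setP => e; rewrite in_set0; apply: noE.
  have no (i : 'I_k) : False by case: i => m; rewrite k0.
  by exists (fun=> set0); split=> i; case: (no i).
exists (fun i => [set nth e0 (enum A0) i]).
have inA0 (i : 'I_k) : nth e0 (enum A0) i \in A0.
  by rewrite -mem_enum mem_nth // -cardE (leq_trans (ltn_ord i)).
split=> [i|i j ij|i].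
- by rewrite sub1set; have := inA0 i; rewrite inE => /andP[].
- by rewrite disjoints1 inE nth_uniq ?enum_uniq // -cardE (leq_trans (ltn_ord _)).
- by apply: conn_edge (st_edge _ (inA0 i)); rewrite inE.
Qed.

(** The target [T] is contracted to one of its vertices. A path reaches the contracted vertex only
    at its end, so its preimage meets [T] only in the last vertex, as rerouting inside a cut
    requires. *)
Lemma menger_set g A s T k : s \notin T -> T != set0 ->
  (forall X, s \in X -> [disjoint X & T] -> k <= dg g A X) ->
  exists (y : 'I_k -> V) (p : 'I_k -> seq (E * V)),
  [/\ forall i, is_path g s (p i) (y i) && (y i \in T), forall i, eset (p i) \subset A,
      forall i j, i != j -> [disjoint eset (p i) & eset (p j)] &
      forall i v, v \in s :: map snd (p i) -> v \in T -> v = y i].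
Proof.
move=> sT /set0Pn[t0 t0T] hk.
pose c x := if x \in T then t0 else x; pose g' e := (c (g e).1, c (g e).2).
have ct0 x : (c x == t0) = (x \in T).
  by rewrite /c; case: (boolP (x \in T)) => [_|xT]; rewrite ?eqxx //; apply: contraNF xT => /eqP->.
have st0 : s != t0 by apply: contraNneq sT => ->.
have jc e x y : joins g' e x y -> x \notin T ->
    exists y', [/\ joins g e x y', c y' = y & (y = t0) \/ (y \notin T /\ y' = y)].
  have cc z x' : c z = x' -> x' \notin T -> z = x'.
    by rewrite /c; case: ifP => // zT <-; rewrite t0T.
  have fin z : (c z = t0) \/ (c z \notin T /\ z = c z).
    by rewrite /c; case: ifP => [|/negbT]; [left | right].
  rewrite /joins /g'; case/orP=> /eqP [] q1 q2 xT.
    have e1 := cc _ _ q1 xT; exists (g e).2; rewrite -{1}e1 -surjective_pairing eqxx q2; split=> //.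
    by rewrite -q2.
  have e1 := cc _ _ q2 xT; exists (g e).1; rewrite -{2}e1 -surjective_pairing eqxx orbT q1; split=> //.
  by rewrite -q1.
have [|f [f1 f2 f3]] := @menger g' A s t0 k st0.
  move=> X sX tX; apply: leq_trans (hk (X :\: T) _ _) _.
  - by rewrite inE sT.
  - by rewrite -setI_eq0 setIDAC -setIDA setDv setI0.
  - apply: eq_leq; apply: dg_eq_cr => e _; rewrite /cr /g' /c !inE.
    by case: (boolP ((g e).1 \in T)); case: (boolP ((g e).2 \in T)); rewrite /= ?(negbTE tX).
have conv D : conn g' D s t0 -> exists yp : V * seq (E * V),
    [/\ is_path g s yp.2 yp.1 && (yp.1 \in T), eset yp.2 \subset D &
        forall v, v \in s :: map snd yp.2 -> v \in T -> v = yp.1].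
  case/conn_path=> p [/andP[w u] sD].
  suff H x : x \notin T -> is_walk g' x p t0 -> uniq (x :: map snd p) ->
     exists y q, [/\ is_walk g x q y && (y \in T), map fst q = map fst p,
       {subset map snd q <= y :: map snd p}, (forall v, v \in map snd q -> v \in T -> v = y) & uniq (map snd q)].
    have [y [q [/andP[wq yT] e1 e2 e3 e4]]] := H s sT w u.
    exists (y, q); rewrite /= yT andbT; split.
    - rewrite /is_path wq /= e4 andbT; apply/negP => /e2; rewrite inE => /predU1P[q1|].
        by rewrite q1 yT in sT.
      by case/andP: u => /negPf->.
    - by apply/subsetP => e; rewrite in_eset e1 -in_eset; apply: (subsetP sD).
    - by move=> v; rewrite inE => /predU1P[->|/e3//]; rewrite (negbTE sT).
  elim: p x {w u sD} => [|[e v] p IH] x xT /=; first by move=> /eqP q; rewrite q t0T in xT.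
  case/andP=> j w /and3P[]; rewrite inE => xp vp up.
  have [y' [j' cy' [vt0|[vT yv]]]] := jc _ _ _ j xT.
    have y'T : y' \in T by rewrite -ct0 cy' vt0.
    have p0 : p = [::].
      case: p w vp {IH xp up} => // [[e2 v2] p] w; rewrite -(vt0) in w.
      by have := walk_last w; rewrite /= => {1}->; rewrite mem_last.
    exists y', [:: (e, y')]; rewrite p0 /= j' eqxx y'T; split=> // z; rewrite !inE.
      by move=> ->.
    by move=> /eqP.
  subst y'; have [|y [q [/andP[wq yT] e1 e2 e3 e4]]] := IH v vT w; first by rewrite /= vp.
  exists y, ((e, v) :: q); rewrite /= j' wq yT e1; split=> //.
  - move=> z; rewrite !inE => /orP[->|/e2]; first by rewrite orbT.
    by rewrite inE => /orP[->//|->]; rewrite !orbT.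
  - by move=> z; rewrite inE => /predU1P[->|/e3//]; rewrite (negbTE vT).
  - rewrite e4 andbT; apply/negP => /e2; rewrite inE => /predU1P[q1|]; last by rewrite (negbTE vp).
    by rewrite q1 yT in vT.
have /fin_all_exists [h hh] : forall i : 'I_k, exists yp : V * seq (E * V),
    [/\ is_path g s yp.2 yp.1 && (yp.1 \in T), eset yp.2 \subset f i &
        forall v, v \in s :: map snd yp.2 -> v \in T -> v = yp.1].
  by move=> i; apply: conv (f3 i).
exists (fun i => (h i).1), (fun i => (h i).2); split=> [i|i|i j ij|i].
- by case: (hh i).
- by case: (hh i) => _ s1 _; apply: subset_trans s1 (f1 i).
- case: (hh i) => _ si _; case: (hh j) => _ sj _.
  exact: disjointWl si (disjointWr sj (f2 i j ij)).
- by case: (hh i).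
Qed.

End Menger.

(** ** Splitting that preserves edge-connectivity *)

Section Preserve.
Variables (V E : finType).
Implicit Types (g : E -> V * V) (A B : {set E}) (U M X Y Z T : {set V}).

Lemma lt4_add2 a : a < 4 -> a + true.*2 <= 5. Proof. by move=> h /=; lia. Qed.

Definition loopfree g A := forall e, e \in A -> (g e).1 != (g e).2.
Definition supported g A U := forall e, e \in A -> ((g e).1 \in U) && ((g e).2 \in U).

Lemma dgI_supp g A U X : supported g A U -> dg g A X = dg g A (X :&: U).
Proof. by move=> sp; apply: dg_eq_cr => e /sp /andP[a b]; rewrite /cr !inE a b !andbT. Qed.

Lemma dgCs g A U X : supported g A U -> dg g A (U :\: X) = dg g A X.
Proof. by move=> sp; rewrite -(dgC g A X) (dgI_supp (~: X) sp); congr dg; apply/setP => z; rewrite !inE andbC. Qed.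

(** Pairing a fixed edge [e0] with another edge at v fails only through a dangerous set: at most
    five crossing edges, with both far ends inside and v outside, up to complement. Dangerous sets
    are closed under union, so if every pairing failed, the largest one would contain all neighbours
    of v and be crossed by more than five edges. *)
Lemma split_off_large g A v : loopfree g A ->
  (forall X, X != set0 -> X != setT -> 4 <= dg g A X) -> 5 < dg g A [set v] ->
  exists f1 f2 u w, [/\ [/\ f1 \in A, f2 \in A & f1 != f2], joins g f1 v u, joins g f2 v w &
    forall X, X != set0 -> X != setT -> 4 <= dg (splitg g f1 u w) (splitA A f1 f2 u w) X].
Proof.
move=> lf h4 dv.
have /dg_gt0P[e0 e0A ce0] : 0 < dg g A [set v] by nlia.
have [u0 j0 u0v] := cr1_joins ce0.
pose dang X := [&& u0 \in X, v \notin X & dg g A X <= 5].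
have nT X z : z \notin X -> X != setT by apply: contraNneq => ->; rewrite inE.
have n0 X z : z \in X -> X != set0 by move=> zX; apply/set0Pn; exists z.
have dangU X Y : dang X -> dang Y -> dang (X :|: Y).
  case/and3P=> uX vX dX /and3P[uY vY dY].
  rewrite /dang inE uX inE (negbTE vX) (negbTE vY) /= leqNgt; apply/negP => dU.
  (* With six edges at the union, uncrossing would force five edges at X and four at both its
     intersection with Y and its difference; [dg_splitE] excludes this by parity. The edge [e0]
     makes the diagonal term of posimodularity positive. *)
  have dI : 4 <= dg g A (X :&: Y).
    by apply: h4; [apply: (n0 _ u0); rewrite inE uX | apply: (nT _ v); rewrite inE (negbTE vX)].
  have s1 := dg_submodE g A X Y; have s2 := dg_posimodE g A X Y; have s3 := dg_splitE g A X Y.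
  have nbp : 0 < nb g A (X :&: Y) (~: (X :|: Y)).
    apply: (nb_gt0 e0A); case/orP: j0 => /eqP q; rewrite /btw q /= !inE uX uY (negbTE vX) (negbTE vY) //.
  have dXY : 4 <= dg g A (X :\: Y).
    apply: h4; last by apply: (nT _ v); rewrite inE (negbTE vX) andbF.
    apply: contraTneq dU => /eqP; rewrite setD_eq0 => sXY.
    by rewrite (setUidPr sXY) -leqNgt.
  have dYX : 4 <= dg g A (Y :\: X).
    apply: h4; last by apply: (nT _ v); rewrite inE (negbTE vY) andbF.
    apply: contraTneq dU => /eqP; rewrite setD_eq0 => sXY.
    by rewrite (setUidPl sXY) -leqNgt.
  nlia.
case: (boolP [exists X, dang X]) => [/existsP[X0 dX0]|/existsPn nod].
  have [D dD mD] := @arg_maxnP _ X0 dang (fun X => #|X|) dX0.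
  have Dmax X : dang X -> X \subset D.
    move=> dX; have le := mD _ (dangU _ _ dX dD).
    by have /eqP-> : D == X :|: D; [rewrite eqEcard subsetUr | apply: subsetUl].
  case/and3P: (dD) => uD vD d5.
  have [/exists_inP[e eA /and3P[ce ee0 /existsP[y /and3P[j yv yD]]]]|allD] := boolP [exists e in A,
     [&& cr g e [set v], e != e0 & [exists y, [&& joins g e v y, y != v & y \notin D]]]].
    exists e0, e, u0, y; split=> // [|X X0' XT]; first by rewrite eq_sym.
    have := h4 X X0' XT; rewrite (split_dg e0A eA _ j0 j X) 1?eq_sym //.
    case sc: (splitc v u0 y X); last by rewrite addn0.
    rewrite leqNgt => dX; rewrite leqNgt; apply/negP => d'.
    have dX5 : dg g A X <= 5 by rewrite (split_dg e0A eA _ j0 j X) 1?eq_sym // sc; apply: lt4_add2.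
    case/orP: sc => /and3P[a b c].
      by move: yD; rewrite (subsetP (Dmax X _)) // /dang a c.
    have dX' : dang (~: X) by rewrite /dang !inE a c dgC.
    by move: yD; rewrite (subsetP (Dmax _ dX')) // inE.
  suff : dg g A [set v] <= dg g A D by nlia.
  apply: leq_sum => e eA; have [ce|//] := boolP (cr g e [set v]).
  have [y j yv] := cr1_joins ce; rewrite (joins_cr _ j) (negbTE vD) /=.
  have [ee|ee0] := eqVneq e e0.
    have : y = u0; last by move=> ->; rewrite uD.
    subst e; case/orP: j j0 => /eqP q1 /orP[] /eqP; rewrite q1 => -[]; congruence.
  apply: contraNT allD; rewrite lt0b => yD; apply/exists_inP; exists e => //.
  by rewrite ce ee0; apply/existsP; exists y; rewrite j yv.
have [e eA] : exists2 e, e \in A :\ e0 & cr g e [set v].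
  by apply/dg_gt0P; move: dv; rewrite (dgD1 g _ e0A) ce0; nlia.
move: eA; rewrite !inE => /andP[ee0 eA] ce; have [y j yv] := cr1_joins ce.
exists e0, e, u0, y; split=> // [|X X0' XT]; first by rewrite eq_sym.
have := h4 X X0' XT; rewrite (split_dg e0A eA _ j0 j X) 1?eq_sym //.
case sc: (splitc v u0 y X); last by rewrite addn0.
move=> dX; rewrite leqNgt; apply/negP => d'.
have dX5 : dg g A X <= 5 by rewrite (split_dg e0A eA _ j0 j X) 1?eq_sym // sc; apply: lt4_add2.
case/orP: sc => /and3P[a b c].
  by have := nod X; rewrite /dang a c dX5.
by have := nod (~: X); rewrite /dang !inE a c dgC dX5.
Qed.

(* The marks, collected in M, are the vertices that are never split off. Cuts satisfying
   [four] have to keep at least four edges, all others at least two. *)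
Definition four M (s t : V) X := [|| [disjoint X & M], M \subset X | (s \in X) (+) (t \in X)].
Definition feasible g A U M s t := forall X, X \subset U -> X != set0 -> X != U ->
  (if four M s t X then 4 else 2) <= dg g A X.

Lemma four_setI M s t X Y : s \in M -> t \in M -> X :&: M = Y :&: M ->
  four M s t X = four M s t Y.
Proof.
move=> sM tM q; rewrite /four; congr [|| _, _ | _].
- by rewrite -!setI_eq0 q.
- by apply/setIidPr/setIidPr; rewrite q.
- have h z : z \in M -> (z \in X) = (z \in Y).
    by move=> zM; have := congr1 (fun S : {set V} => z \in S) q; rewrite !inE zM !andbT.
  by rewrite !h.
Qed.

Lemma four_setD U M s t X : s \in M -> t \in M -> M \subset U ->
  four M s t (U :\: X) = four M s t X.
Proof.
move=> sM tM MU; rewrite (four_setI (Y := ~: X)) //; last first.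
  apply/setP => z; rewrite !inE; case: (boolP (z \in M)) => [/(subsetP MU)->|]; rewrite ?andbF ?andbT //.
rewrite /four !inE addbN addNb negbK disjoints_subset setCS disjoint_sym disjoints_subset.
exact: orbCA.
Qed.

(** * Complete splitting at an unmarked vertex of degree four *)

Section Four.
Variables (g : E -> V * V) (A : {set E}) (U M : {set V}) (s t v : V).
Hypotheses (lf : loopfree g A) (sp : supported g A U).
Hypotheses (sM : s \in M) (tM : t \in M) (MU : M \subset U) (vU : v \in U) (vM : v \notin M).
Hypotheses (fe : feasible g A U M s t) (dv : dg g A [set v] = 4).

Definition fsplit f1 f2 f3 f4 y1 y2 y3 y4 (g' : E -> V * V) A' :=
  [/\ lifts g A g' A', #|A'| < #|A|, loopfree g' A' /\ supported g' A' (U :\ v),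
     forall X, dg g A X = dg g' A' X + (splitc v y1 y2 X).*2 + (splitc v y3 y4 X).*2 &
     forall e, e \in A -> e \notin [:: f1; f2; f3; f4] -> e \in A' /\ g' e = g e].

Lemma four_split f1 f2 f3 f4 y1 y2 y3 y4 :
  [/\ f1 \in A, f2 \in A, f3 \in A & f4 \in A] -> uniq [:: f1; f2; f3; f4] ->
  [/\ joins g f1 v y1, joins g f2 v y2, joins g f3 v y3 & joins g f4 v y4] ->
  exists g' A', fsplit f1 f2 f3 f4 y1 y2 y3 y4 g' A'.
Proof.
move=> [a1 a2 a3 a4] u4 [j1 j2 j3 j4].
have /and5P[] := u4; rewrite !inE !negb_or => /and3P[n12 n13 n14] /andP[n23 n24] n34 _ _.
pose g1 := splitg g f1 y1 y2; pose A1 := splitA A f1 f2 y1 y2.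
have g1E e : e != f1 -> g1 e = g e by rewrite /g1 /splitg => /negPf->.
have A1E e : e \in A -> e != f1 -> e != f2 -> e \in A1.
  by rewrite /A1 /splitA => eA e1 e2; case: ifP; rewrite !inE ?e1 e2 eA.
have [n31 n41] : f3 != f1 /\ f4 != f1 by rewrite ![_ == f1]eq_sym.
have [n32 n42] : f3 != f2 /\ f4 != f2 by rewrite ![_ == f2]eq_sym.
have j3' : joins g1 f3 v y3 by rewrite /joins (g1E _ n31).
have j4' : joins g1 f4 v y4 by rewrite /joins (g1E _ n41).
have a3' : f3 \in A1 by apply: A1E.
have a4' : f4 \in A1 by apply: A1E.
pose g2 := splitg g1 f3 y3 y4; pose A2 := splitA A1 f3 f4 y3 y4.
have D X : dg g A X = dg g2 A2 X + (splitc v y1 y2 X).*2 + (splitc v y3 y4 X).*2.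
  rewrite (split_dg a1 a2 n12 j1 j2) -/g1 -/A1 (split_dg a3' a4' n34 j3' j4') -/g2 -/A2.
  exact: addnAC.
have lf1 : loopfree g1 A1 by apply: split_loopless lf.
have lf2 : loopfree g2 A2 by apply: split_loopless lf1.
have yU f y : f \in A -> joins g f v y -> y \in U.
  by move=> /sp /andP[b c] /orP[] /eqP q; move: b c; rewrite q.
have yv f y : f \in A -> joins g f v y -> y != v.
  by move=> /lf b /orP[] /eqP q; move: b; rewrite q // eq_sym.
exists g2, A2; split=> //.
- apply: lifts_trans (ex_intro _ _ (split_liftP a3' a4' n34 j3' j4')).
  exact: ex_intro _ _ (split_liftP a1 a2 n12 j1 j2).
- apply: leq_ltn_trans (splitA_card f1 y1 y2 a2).
  by apply: subset_leq_card; apply: splitA_sub.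
- split=> // e eA2.
  have d0 : dg g2 A2 [set v] = 0.
    have := D [set v]; rewrite dv /splitc !inE eqxx /=.
    by rewrite (negbTE (yv _ _ a1 j1)) (negbTE (yv _ _ a2 j2)) (negbTE (yv _ _ a3 j3)) (negbTE (yv _ _ a4 j4)) /=; nlia.
  have := dg_eq0 d0 eA2; rewrite /cr !inE.
  have inU : ((g2 e).1 \in U) && ((g2 e).2 \in U).
    rewrite /g2 /splitg; case: ifP => _; first by rewrite (yU _ _ a3 j3) (yU _ _ a4 j4).
    rewrite /g1 /splitg; case: ifP => _; first by rewrite (yU _ _ a1 j1) (yU _ _ a2 j2).
    by apply: sp; apply: (subsetP (splitA_sub A f1 f2 y1 y2)); apply: (subsetP (splitA_sub A1 f3 f4 y3 y4)).
  case/andP: inU => -> ->; have := lf2 _ eA2.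
  by case: (eqVneq (g2 e).1 v) => [->|_]; case: (eqVneq (g2 e).2 v) => [_|_].
- move=> e eA; rewrite !inE !negb_or => /and4P[e1 e2 e3 e4]; split.
    by rewrite /A2 /splitA; case: ifP; rewrite !inE ?e3 e4 A1E.
  by rewrite /g2 /splitg (negbTE e3) g1E.
Qed.

Lemma four_addv X : v \notin X -> four M s t (v |: X) = four M s t X.
Proof.
move=> vX; rewrite /four; congr [|| _, _ | _].
- by rewrite -!setI_eq0 setIUl setU_eq0 !setI_eq0 disjoints1 vM.
- apply/idP/idP => sX; last by apply: subset_trans sX (subsetUr _ _).
  apply/subsetP => z zM; have := subsetP sX _ zM; rewrite !inE => /orP[/eqP zv|//].
  by rewrite zv (negbTE vM) in zM.
- by rewrite !inE; congr (_ (+) _); case: eqVneq => [q|//]; move: vM; rewrite -q ?sM ?tM.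
Qed.

Lemma four_compl X : four M s t (U :\ v :\: X) = four M s t X.
Proof.
apply: four_setD => //; apply/subsetP => z zM; rewrite !inE (subsetP MU) // andbT.
by apply: contraNneq vM => <-.
Qed.

Section Bad.
Variables (f1 f2 f3 f4 : E) (y1 y2 y3 y4 : V).
Hypotheses (fA : [/\ f1 \in A, f2 \in A, f3 \in A & f4 \in A]) (u4 : uniq [:: f1; f2; f3; f4]).
Hypotheses (js : [/\ joins g f1 v y1, joins g f2 v y2, joins g f3 v y3 & joins g f4 v y4]).

Definition nv X := ((y1 \in X) + (y2 \in X) + (y3 \in X) + (y4 \in X))%N.

(** The count is read off from a split graph, where v is isolated and adding it to [Z] does not
    change the cut. *)
Lemma dg_addv Z : v \notin Z -> dg g A (v |: Z) + (nv Z).*2 = dg g A Z + 4.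
Proof.
move=> vZ; have [g' [A' [_ _ [lf' sp'] D _]]] := four_split fA u4 js.
have E0 : dg g' A' (v |: Z) = dg g' A' Z.
  by apply: dg_eq_cr => e /sp'; rewrite /cr !inE => /andP[/andP[/negPf-> _] /andP[/negPf-> _]].
have yv f y : f \in A -> joins g f v y -> y != v.
  by move=> /lf b /orP[] /eqP q; move: b; rewrite q // eq_sym.
case: fA js => a1 a2 a3 a4 [j1 j2 j3 j4].
rewrite !D E0 /splitc /nv !inE eqxx (negbTE vZ) (negbTE (yv _ _ a1 j1)) (negbTE (yv _ _ a2 j2)) (negbTE (yv _ _ a3 j3)) (negbTE (yv _ _ a4 j4)) /=.
by case: (y1 \in Z); case: (y2 \in Z); case: (y3 \in Z); case: (y4 \in Z) => /=; nlia.
Qed.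

Lemma ys_ok : (y1 \in U :\ v) && (y2 \in U :\ v) && (y3 \in U :\ v) && (y4 \in U :\ v).
Proof.
have yU f y : f \in A -> joins g f v y -> y \in U :\ v.
  move=> fA'; have /andP[b c] := sp fA'; have d := lf fA'.
  by case/orP=> /eqP q; move: b c d; rewrite q !inE /= => b c d; rewrite ?b ?c andbT // eq_sym.
by case: fA js => a1 a2 a3 a4 [j1 j2 j3 j4]; rewrite (yU _ _ a1 j1) (yU _ _ a2 j2) (yU _ _ a3 j3) (yU _ _ a4 j4).
Qed.

(* A set certifying that the pairing is not admissible, normalised to contain s. *)
Definition bad (b1 b2 b3 b4 : bool) X :=
  [&& X \subset U :\ v, s \in X, dg g A X <= (if four M s t X then 4 else 2).+1 &
      [&& (y1 \in X) == b1, (y2 \in X) == b2, (y3 \in X) == b3 & (y4 \in X) == b4]].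

(** If [X] contains three or four of the ends, its new cut equals the old cut at X with v added;
    with at most one end, or one of each pair, the cut is unchanged. So only a set with exactly the
    ends of one pair can fail. For such a set the complement without v has the same cut, which
    allows the choice of the side of s. *)
Lemma pairing_bad g' A' : fsplit f1 f2 f3 f4 y1 y2 y3 y4 g' A' ->
  ~ (exists X, bad true true false false X || bad false false true true X) ->
  feasible g' A' (U :\ v) M s t.
Proof.
move=> [_ _ [lf' sp'] D _] nobad X sX X0 XU.
have vX : v \notin X by apply: contraTN sX => ?; apply/subsetPn; exists v; rewrite // !inE eqxx.
have sX' : X \subset U by apply: subset_trans sX (subsetDl _ _).
have hX := fe sX' X0 (_ : X != U).
have {}hX : (if four M s t X then 4 else 2) <= dg g A X.
  by apply: hX; apply: contraTneq vU => <-.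
have hvX : (if four M s t X then 4 else 2) <= dg g A (v |: X).
  rewrite -(four_addv vX); apply: fe.
  - by rewrite subUset sub1set vU.
  - by apply/set0Pn; exists v; rewrite !inE eqxx.
  - apply: contraNneq XU => q; rewrite eqEsubset sX -q; apply/subsetP => z.
    by rewrite !inE => /andP[/negPf->].
have av := dg_addv vX; have Dx := D X.
have [q|] := boolP ((y1 \in X) && (y2 \in X) && (y3 \notin X) && (y4 \notin X) ||
   (y1 \notin X) && (y2 \notin X) && (y3 \in X) && (y4 \in X)); last first.
  move: av Dx; rewrite /splitc /nv (negbTE vX) !andbT !andbF !orbF.
  by case: (y1 \in X); case: (y2 \in X); case: (y3 \in X); case: (y4 \in X) => //=; nlia.
rewrite leqNgt; apply/negP => lt; apply: nobad.
have c1 : (splitc v y1 y2 X + splitc v y3 y4 X = 1)%N.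
  move: q; rewrite /splitc (negbTE vX) !andbT !andbF !orbF.
  by case: (y1 \in X); case: (y2 \in X); case: (y3 \in X); case: (y4 \in X).
have dX : dg g A X <= (if four M s t X then 4 else 2).+1.
  by rewrite Dx -addnA -doubleD c1; move: lt; case: ifP => _; nlia.
have [sX1|sX1] := boolP (s \in X).
  exists X; rewrite /bad sX sX1 dX /=.
  by move: q; case: (y1 \in X); case: (y2 \in X); case: (y3 \in X); case: (y4 \in X).
exists (U :\ v :\: X); rewrite /bad subsetDl four_compl /=.
have -> : dg g A (U :\ v :\: X) = dg g A X.
  have -> : U :\ v :\: X = U :\: (v |: X) by apply/setP => z; rewrite !inE; case: (z == v); case: (z \in X); case: (z \in U).
  rewrite (dgCs _ sp); move: av; rewrite /nv.
  by move: q; case: (y1 \in X); case: (y2 \in X); case: (y3 \in X); case: (y4 \in X) => //= _; nlia.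
rewrite dX /=; have sUv : s \in U :\ v.
  by rewrite !inE (subsetP MU) // andbT; apply: contraNneq vM => <-.
have := ys_ok; rewrite !(in_setD (U :\ v) X) sX1 sUv => /andP[/andP[/andP[-> ->] ->] ->] /=.
by move: q; rewrite !andbT; case: (y1 \in X); case: (y2 \in X); case: (y3 \in X); case: (y4 \in X).
Qed.

Lemma corner_count (b1 b2 b3 b4 c1 c2 c3 c4 : bool) :
  (b1 + b2 + b3 + b4 = 2)%N -> (c1 + c2 + c3 + c4 = 2)%N ->
  (b1 && c1 + b2 && c2 + b3 && c3 + b4 && c4 = 1)%N ->
  [/\ (b1 || c1) + (b2 || c2) + (b3 || c3) + (b4 || c4) = 3,
      ~~ c1 && b1 + ~~ c2 && b2 + ~~ c3 && b3 + ~~ c4 && b4 = 1 &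
      ~~ b1 && c1 + ~~ b2 && c2 + ~~ b3 && c3 + ~~ b4 && c4 = 1]%N.
Proof. by case: b1; case: b2; case: b3; case: b4; case: c1; case: c2; case: c3; case: c4. Qed.

(** The numerical part of [bad_pair]: [m1], [m2] stand for all marks lying in X, in Y, and [t1],
    [t2] for t lying there; [d1] to [d6] are the cuts at X, Y, the intersection, the union and the
    two differences, and [d7] is the cut at the union with v added. *)
Lemma corner_arith (m1 m2 t1 t2 q1 q2 q3 : bool) d1 d2 d3 d4 d5 d6 d7 n1 n2 n3 n4 :
  (m2 -> q1 && q3) -> (m1 -> q2 && q3) -> (m1 -> t1) -> (m2 -> t2) ->
  d1 + d2 = d3 + d4 + n1.*2 -> d1 + d2 = d5 + d6 + n2.*2 -> d1 + n3.*2 = d3 + d5 ->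
  d2 + n4.*2 = d3 + d6 -> 0 < n2 -> d7 + 6 = d4 + 4 ->
  d1 <= (if m1 || ~~ t1 then 4 else 2).+1 -> d2 <= (if m2 || ~~ t2 then 4 else 2).+1 ->
  (if m1 && m2 || ~~ (t1 && t2) then 4 else 2) <= d3 ->
  (if q1 || (~~ t2 && t1) then 4 else 2) <= d5 ->
  (if q2 || (~~ t1 && t2) then 4 else 2) <= d6 ->
  (if q3 || ~~ (t1 || t2) then 4 else 2) <= d7 ->
  [/\ ~~ (t1 || t2), d3 = 4 & d7 = 4].
Proof.
case: t1; case: t2; case: m1; case: m2; case: q1; case: q2; case: q3 => /= i1 i2 i3 i4;
  try (by have := i1 isT); try (by have := i2 isT); try (by have := i3 isT); try (by have := i4 isT).
all: clear i1 i2 i3 i4; move=> *; try (split=> //; nlia).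
all: exfalso; nlia.
Qed.

(* The four corners of two bad sets each contain one neighbour; parity of the cut sizes
   excludes every position of t except the corner opposite to s. *)
Lemma bad_pair (b1 b2 b3 b4 c1 c2 c3 c4 : bool) X Y :
  (b1 + b2 + b3 + b4 = 2)%N -> (c1 + c2 + c3 + c4 = 2)%N ->
  (b1 && c1 + b2 && c2 + b3 && c3 + b4 && c4 = 1)%N ->
  bad b1 b2 b3 b4 X -> bad c1 c2 c3 c4 Y ->
  [/\ t \notin X :|: Y, dg g A (X :&: Y) = 4 & dg g A (v |: (X :|: Y)) = 4].
Proof.
move=> hb hc hbc /and4P[sXU sX dX /and4P[/eqP x1 /eqP x2 /eqP x3 /eqP x4]].
move=> /and4P[sYU sY dY /and4P[/eqP z1 /eqP z2 /eqP z3 /eqP z4]].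
have vX : v \notin X by apply: contraTN sXU => ?; apply/subsetPn; exists v; rewrite // !inE eqxx.
have vY : v \notin Y by apply: contraTN sYU => ?; apply/subsetPn; exists v; rewrite // !inE eqxx.
have vXY : v \notin X :|: Y by rewrite inE (negbTE vX) (negbTE vY).
have avU := dg_addv vXY.
have [c3' c1' c2'] := corner_count hb hc hbc.
have nU : nv (X :|: Y) = 3 by rewrite /nv !inE x1 x2 x3 x4 z1 z2 z3 z4.
rewrite nU in avU.
have req Z : v \notin Z -> Z \subset U -> nv Z > 0 -> (if four M s t Z then 4 else 2) <= dg g A Z.
  move=> vZ sZ nz; apply: fe => //; last by apply: contraNneq vZ => ->.
  by apply: contraTneq nz => ->; rewrite /nv !inE.
have sU z : z \in X -> z \in U by move=> /(subsetP sXU); rewrite !inE => /andP[].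
have sU' z : z \in Y -> z \in U by move=> /(subsetP sYU); rewrite !inE => /andP[].
have n1 : nv (X :&: Y) = 1 by rewrite /nv !inE x1 x2 x3 x4 z1 z2 z3 z4.
have n2 : nv (X :\: Y) = 1 by rewrite /nv !inE x1 x2 x3 x4 z1 z2 z3 z4.
have n3 : nv (Y :\: X) = 1 by rewrite /nv !inE x1 x2 x3 x4 z1 z2 z3 z4.
have r1 := req (X :&: Y); have r2 := req (X :\: Y); have r3 := req (Y :\: X).
move: r1 r2 r3; rewrite n1 n2 n3 !inE (negbTE vX) (negbTE vY) ?andbF.
have s1 : X :&: Y \subset U by apply/subsetP => z; rewrite inE => /andP[/sU].
have s2 : X :\: Y \subset U by apply/subsetP => z; rewrite inE => /andP[_ /sU].
have s3 : Y :\: X \subset U by apply/subsetP => z; rewrite inE => /andP[_ /sU'].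
move=> /(_ isT s1 isT) r1 /(_ isT s2 isT) r2 /(_ isT s3 isT) r3.
have r4 : (if four M s t (v |: (X :|: Y)) then 4 else 2) <= dg g A (v |: (X :|: Y)).
  apply: fe; first by apply/subsetP => z; rewrite !inE => /or3P[/eqP->|/sU|/sU'].
    by apply/set0Pn; exists v; rewrite !inE eqxx.
  apply/negP => /eqP q.
  have sXY z : z \in U :\ v -> z \in X :|: Y.
    by rewrite -q in_setD1 in_setU1 => /andP[/negPf-> ].
  have := ys_ok; move: nU; rewrite /nv => nU /andP[/andP[/andP[/sXY h1 /sXY h2] /sXY h3] /sXY h4].
  by rewrite h1 h2 h3 h4 in nU.
rewrite four_addv // in r4.
have e1 := dg_submodE g A X Y; have e2 := dg_posimodE g A X Y.
have e3 := dg_splitE g A X Y; have e4 := dg_splitE g A Y X; rewrite setIC in e4.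
have dM Z : s \in Z -> [disjoint Z & M] = false.
  by move=> sZ; apply/negP => /pred0P /(_ s); rewrite /= sZ sM.
have nM Z : s \notin Z -> (M \subset Z) = false.
  by move=> sZ; apply/negP => /subsetP /(_ s sM); rewrite (negbTE sZ).
have F1 : four M s t X = (M \subset X) || (t \notin X) by rewrite /four dM // sX.
have F2 : four M s t Y = (M \subset Y) || (t \notin Y) by rewrite /four dM // sY.
have F3 : four M s t (X :&: Y) = (M \subset X) && (M \subset Y) || (t \notin X :&: Y).
  by have sXY : s \in X :&: Y; [rewrite inE sX | rewrite /four dM // sXY subsetI].
have F4 : four M s t (X :|: Y) = (M \subset X :|: Y) || (t \notin X :|: Y).
  by have sXY : s \in X :|: Y; [rewrite inE sX | rewrite /four dM // sXY].
have F5 : four M s t (X :\: Y) = [disjoint X :\: Y & M] || (t \in X :\: Y).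
  by have sXY : s \notin X :\: Y; [rewrite inE sY | rewrite /four nM // (negbTE sXY)].
have F6 : four M s t (Y :\: X) = [disjoint Y :\: X & M] || (t \in Y :\: X).
  by have sXY : s \notin Y :\: X; [rewrite inE sX | rewrite /four nM // (negbTE sXY)].
have i1 : M \subset X -> [disjoint Y :\: X & M] && (M \subset X :|: Y).
  move=> sMX; rewrite (subset_trans sMX (subsetUl _ _)) andbT -setI_eq0; apply/eqP/setP => z.
  by rewrite !inE; case: (boolP (z \in M)) => [/(subsetP sMX)->|]; rewrite ?andbF.
have i2 : M \subset Y -> [disjoint X :\: Y & M] && (M \subset X :|: Y).
  move=> sMX; rewrite (subset_trans sMX (subsetUr _ _)) andbT -setI_eq0; apply/eqP/setP => z.
  by rewrite !inE; case: (boolP (z \in M)) => [/(subsetP sMX)->|]; rewrite ?andbF.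
have i3 : M \subset X -> t \in X by move=> /subsetP; apply.
have i4 : M \subset Y -> t \in Y by move=> /subsetP; apply.
move: dX dY r1 r2 r3 r4; rewrite F1 F2 F3 F4 F5 F6 !inE.
move=> h1 h2 h3 h4 h5 h6.
have np : 0 < nb g A (X :&: Y) (~: (X :|: Y)).
  have aux f y : f \in A -> joins g f v y -> y \in X -> y \in Y -> 0 < nb g A (X :&: Y) (~: (X :|: Y)).
    move=> fA' j yX yY; apply: (nb_gt0 fA'); case/orP: j => /eqP q; rewrite /btw q /= !inE yX yY (negbTE vX) (negbTE vY) //.
  case: fA js n1 => a1 a2 a3 a4 [j1 j2 j3 j4]; rewrite /nv !inE.
  have [/andP[aX aY] _|_] := boolP ((y1 \in X) && (y1 \in Y)); first exact: aux j1 aX aY.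
  have [/andP[aX aY] _|_] := boolP ((y2 \in X) && (y2 \in Y)); first exact: aux j2 aX aY.
  have [/andP[aX aY] _|_] := boolP ((y3 \in X) && (y3 \in Y)); first exact: aux j3 aX aY.
  have [/andP[aX aY] _|_] := boolP ((y4 \in X) && (y4 \in Y)); first exact: aux j4 aX aY.
  by [].
exact: (corner_arith i2 i1 i3 i4 e1 e2 e3 e4 np avU h1 h2 h3 h4 h5 h6).
Qed.
End Bad.

Lemma separates_ge4 X : s \in X -> t \notin X -> 4 <= dg g A X.
Proof.
move=> sX tX; rewrite (dgI_supp X sp).
have sU := subsetP MU _ sM; have tU := subsetP MU _ tM.
have := fe (subsetIr X U) (_ : X :&: U != set0) (_ : X :&: U != U).
rewrite /four !inE sX (negbTE tX) sU /= !orbT; apply.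
  by apply/set0Pn; exists s; rewrite inE sX.
by apply: contraNneq tX => q; move: tU; rewrite -q inE => /andP[].
Qed.

Lemma split_off_four : exists g' A', [/\ lifts g A g' A', #|A'| < #|A|,
  loopfree g' A' /\ supported g' A' (U :\ v), feasible g' A' (U :\ v) M s t /\
  (forall X, dg g' A' X <= dg g A X) &
  forall e, e \in A -> ~~ cr g e [set v] -> e \in A' /\ g' e = g e].
Proof.
pose D := [set e in A | cr g e [set v]].
have : size (enum D) = 4.
  rewrite -cardE -dv /dg -sum1_card [RHS]big_mkcond [LHS]big_mkcond /=.
  by apply: eq_bigr => e _; rewrite inE; case: (e \in A).
have : uniq (enum D) by apply: enum_uniq.
have : forall e, (e \in enum D) = (e \in A) && cr g e [set v] by move=> e; rewrite mem_enum inE.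
case: (enum D) => [//|f1 [//|f2 [//|f3 [//|f4 [|//]]]]] memD u4 _.
have /andP[a1 /cr1_joins[y1 j1 _]] : (f1 \in A) && cr g f1 [set v] by rewrite -memD !inE eqxx.
have /andP[a2 /cr1_joins[y2 j2 _]] : (f2 \in A) && cr g f2 [set v] by rewrite -memD !inE eqxx !orbT.
have /andP[a3 /cr1_joins[y3 j3 _]] : (f3 \in A) && cr g f3 [set v] by rewrite -memD !inE eqxx !orbT.
have /andP[a4 /cr1_joins[y4 j4 _]] : (f4 \in A) && cr g f4 [set v] by rewrite -memD !inE eqxx !orbT.
have finish e1 e2 e3 e4 z1 z2 z3 z4 : perm_eq [:: e1; e2; e3; e4] [:: f1; f2; f3; f4] ->
  [/\ e1 \in A, e2 \in A, e3 \in A & e4 \in A] ->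
  [/\ joins g e1 v z1, joins g e2 v z2, joins g e3 v z3 & joins g e4 v z4] ->
  ~~ [exists X, bad z1 z2 z3 z4 true true false false X || bad z1 z2 z3 z4 false false true true X] ->
  exists g' A', [/\ lifts g A g' A', #|A'| < #|A|,
    loopfree g' A' /\ supported g' A' (U :\ v), feasible g' A' (U :\ v) M s t /\
    (forall X, dg g' A' X <= dg g A X) &
    forall e, e \in A -> ~~ cr g e [set v] -> e \in A' /\ g' e = g e].
  move=> pe eA ej nob; have ue : uniq [:: e1; e2; e3; e4] by rewrite (perm_uniq pe).
  have [g' [A' h]] := four_split eA ue ej; exists g', A'; case: (h) => h1 h2 h3 h4 h5; split=> //.
    split; last by move=> X; rewrite h4 -addnA leq_addr.
    apply: (pairing_bad eA ue ej h) => -[X hX].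
    by case/negP: nob; apply/existsP; exists X.
  move=> e eA' ce; apply: h5 => //; rewrite (perm_mem pe) memD; by rewrite negb_and ce orbT.
have fA : [/\ f1 \in A, f2 \in A, f3 \in A & f4 \in A] by [].
have js : [/\ joins g f1 v y1, joins g f2 v y2, joins g f3 v y3 & joins g f4 v y4] by [].
have [/existsP[X bX]|] := boolP [exists X, bad y1 y2 y3 y4 true true false false X || bad y1 y2 y3 y4 false false true true X]; last exact: finish (perm_refl _) _ _.
have [/existsP[Y bY]|] := boolP [exists X, bad y1 y3 y2 y4 true true false false X || bad y1 y3 y2 y4 false false true true X]; last first.
  apply: (finish f1 f3 f2 f4) => //.
  by apply/permP => p /=; rewrite !addnA (addnAC (p f1)).
have [/existsP[Z bZ]|] := boolP [exists X, bad y1 y4 y2 y3 true true false false X || bad y1 y4 y2 y3 false false true true X]; last first.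
  apply: (finish f1 f4 f2 f3) => //.
  by apply/permP => p /=; nlia.
have {}bX : exists b, bad y1 y2 y3 y4 b b (~~ b) (~~ b) X.
  by case/orP: bX => h; [exists true | exists false].
have {}bY : exists b, bad y1 y2 y3 y4 b (~~ b) b (~~ b) Y.
  by case/orP: bY => /and4P[? ? ? /and4P[h1 h2 h3 h4]]; [exists true | exists false]; apply/and4P; split=> //; rewrite /= h1 h2 h3 h4.
have {}bZ : exists b, bad y1 y2 y3 y4 b (~~ b) (~~ b) b Z.
  by case/orP: bZ => /and4P[? ? ? /and4P[h1 h2 h3 h4]]; [exists true | exists false]; apply/and4P; split=> //; rewrite /= h1 h2 h3 h4.
case: bX bY bZ => bx bX [by' bY] [bz bZ].
have [tXY iXY uXY] : [/\ t \notin X :|: Y, dg g A (X :&: Y) = 4 & dg g A (v |: (X :|: Y)) = 4].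
  by apply: (bad_pair fA u4 js _ _ _ bX bY); case: (bx); case: (by').
have [tXZ iXZ uXZ] : [/\ t \notin X :|: Z, dg g A (X :&: Z) = 4 & dg g A (v |: (X :|: Z)) = 4].
  by apply: (bad_pair fA u4 js _ _ _ bX bZ); case: (bx); case: (bz).
have [tYZ iYZ uYZ] : [/\ t \notin Y :|: Z, dg g A (Y :&: Z) = 4 & dg g A (v |: (Y :|: Z)) = 4].
  by apply: (bad_pair fA u4 js _ _ _ bY bZ); case: (by'); case: (bz).
move: bX bY bZ => /and4P[sXU sX _ /and4P[/eqP x1 /eqP x2 /eqP x3 /eqP x4]].
move=> /and4P[sYU sY _ /and4P[/eqP z1 /eqP z2 /eqP z3 /eqP z4]].
move=> /and4P[sZU sZ _ /and4P[/eqP w1 /eqP w2 /eqP w3 /eqP w4]].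
move: tXY tYZ; rewrite !inE !negb_or => /andP[tX tY] /andP[_ tZ].
have vt : t != v by apply: contraNneq vM => <-.
(* Suppose all three pairings fail. The majority set T is a union of tight sets, and T with v added
   is an intersection of tight sets, so both are tight. By [dg_addv] T would contain exactly two of
   the four ends, but the patterns of X, Y and Z put one or three there. *)
pose T := (X :&: Y) :|: (X :&: Z) :|: (Y :&: Z).
have tT : tight g A s t 4 T.
  by do ?[apply: (tightU separates_ge4)]; rewrite /tight !inE ?sX ?sY ?sZ ?(negbTE tX) ?(negbTE tY) ?iXY ?iXZ ?iYZ.
have tO : tight g A s t 4 (v |: T).
  have -> : v |: T = (v |: (X :|: Y)) :&: (v |: (X :|: Z)) :&: (v |: (Y :|: Z)).
    by apply/setP => z; rewrite !inE; case: (z == v); case: (z \in X); case: (z \in Y); case: (z \in Z).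
  by do ?[apply: (tightI separates_ge4)]; rewrite /tight !inE ?sX ?sY ?orbT ?(negbTE vt) ?(negbTE tX) ?(negbTE tY) ?(negbTE tZ) ?uXY ?uXZ ?uYZ.
have vT : v \notin T.
  have vn (W : {set V}) : W \subset U :\ v -> v \notin W by move=> /subsetP h; apply/negP => /h; rewrite !inE eqxx.
  by rewrite !inE (negbTE (vn _ sXU)) (negbTE (vn _ sYU)) (negbTE (vn _ sZU)).
have := dg_addv fA u4 js vT.
case/and3P: tT => _ _ /eqP ->; case/and3P: tO => _ _ /eqP ->; rewrite /nv !inE x1 x2 x3 x4 z1 z2 z3 z4 w1 w2 w3 w4.
by case: (bx); case: (by'); case: (bz).
Qed.
End Four.
End Preserve.

(** ** Reduced graphs *)

Section Reduced.
Variables (V E : finType) (g : E -> V * V) (A prot : {set E}) (U M : {set V}) (s t : V).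
Implicit Types (X Y Z T : {set V}).
Hypotheses (lf : loopfree g A) (sp : supported g A U).
Hypotheses (sM : s \in M) (tM : t \in M) (MU : M \subset U) (fe : feasible g A U M s t).
Hypothesis protM : forall e, e \in prot -> (g e).1 \in M.
Hypothesis undeletable : forall e, e \in A -> e \notin prot -> ~ feasible g (A :\ e) U M s t.
Hypothesis no_degree4 : forall v, v \in U -> v \notin M -> dg g A [set v] != 4.

Lemma cr_setD e X : e \in A -> cr g e (U :\: X) = cr g e X.
Proof. by move=> /sp /andP[a b]; rewrite /cr !inE a b !andbT addbN addNb negbK. Qed.

Lemma critical_cut e : e \in A -> e \notin prot -> exists X,
  [/\ X \subset U, X != set0, X != U, cr g e X & dg g A X = if four M s t X then 4 else 2].
Proof.
move=> eA ep; pose c (X : {set V}) :=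
  [&& X \subset U, X != set0, X != U, cr g e X & dg g A X == if four M s t X then 4 else 2].
have [/existsP[X /and5P[a b c' d /eqP h]]|/existsPn no] := boolP [exists X, c X]; first by exists X.
case: (undeletable eA ep) => X a b c'; have := fe a b c'; have := no X.
rewrite /c a b c' /= (dgD1 g X eA); case: (cr g e X) => //=; rewrite add1n => ne.
by rewrite leq_eqVlt eq_sym (negbTE ne).
Qed.

(** In a smallest counterexample all vertices have degree at least five, so some edge lies inside X;
    let Y be a critical cut of it. By minimality X \ Y has at least five crossing edges, and Y \ X,
    which carries the same marks as Y, has no fewer than Y: posimodularity fails. If Y \ X is empty,
    Y is a smaller counterexample. *)
Lemma unmarked_cut_neq4 X : X \subset U -> X != set0 -> [disjoint X & M] -> dg g A X != 4.
Proof.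
have [n] := ubnP #|X|; elim: n X => // n IH X ltn sX X0 dX; apply/negP => /eqP d4.
have XM z : z \in X -> z \notin M by move=> zX; rewrite (disjointFr dX zX).
have fourX Y : Y \subset X -> four M s t Y.
  by move=> sYX; rewrite /four; apply/orP; left; apply: disjointWl dX.
have ge5 z : z \in X -> 5 <= dg g A [set z].
  move=> zX; have := no_degree4 (subsetP sX _ zX) (XM _ zX).
  have := fe (_ : [set z] \subset U) (_ : _ != set0) (_ : _ != U).
  rewrite sub1set (subsetP sX) // fourX ?sub1set // => h; rewrite ltn_neqAle eq_sym => ->; apply: h => //.
    by apply/set0Pn; exists z; rewrite inE.
  by apply: contraTneq sM => q; apply: XM; move: (subsetP MU _ sM); rewrite -q inE => /eqP->.
have [e eA /and3P[e1 e2 _]] : exists2 e, e \in A & [&& (g e).1 \in X, (g e).2 \in X & (g e).1 != (g e).2].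
  apply/exists_inP; apply: contraT => /exists_inPn no.
  have := sum_dg1 g A X; rewrite [X in (X).*2]big1 => [|e /no/negbTE->//]; rewrite addn0 d4 => sm.
  have /set0Pn[z zX] := X0; move: sm; rewrite (bigD1 z) //=; have := ge5 _ zX; nlia.
have ep : e \notin prot by apply: contraL e1 => /protM eM; apply: contraTN eM; apply: XM.
have [Y [sY Y0 YU ce dY]] := critical_cut eA ep.
have ltXY : #|X :\: Y| < #|X|.
  apply: proper_card; rewrite properEneq subsetDl andbT; apply: contraTneq ce => q.
  move: e1 e2; rewrite -q !inE /cr => /andP[/negPf-> _] /andP[/negPf-> _]; by [].
have XY0 : X :\: Y != set0.
  apply/set0Pn; move: ce; rewrite /cr; case y1: (_ \in Y); case y2: (_ \in Y) => // _.
    by exists (g e).2; rewrite !inE y2.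
  by exists (g e).1; rewrite !inE y1.
have sXY : X :\: Y \subset U by apply: subset_trans (subsetDl _ _) sX.
have nXY : dg g A (X :\: Y) != 4.
  apply: IH => //; [exact: leq_trans ltXY _ | by apply: disjointWl dX; apply: subsetDl].
have XYU : X :\: Y != U.
  by apply: contraTneq sM => q; apply: XM; move: (subsetP MU _ sM); rewrite -q inE => /andP[].
have hXY := fe sXY XY0 XYU; rewrite fourX ?subsetDl // in hXY.
have pos := dg_posimod g A X Y; rewrite d4 dY in pos.
have [YX0|YX0] := eqVneq (Y :\: X) set0.
  have sYX : Y \subset X by rewrite -setD_eq0 YX0.
  rewrite fourX // in dY.
  have : dg g A Y != 4; last by rewrite dY.
  apply: IH => //; last by apply: disjointWl dX.
  apply: leq_trans (_ : #|X| <= _); last by rewrite -ltnS.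
  apply: proper_card; rewrite properEneq sYX andbT; apply: contraTneq ce => ->.
  by rewrite /cr e1 e2.
have sYX : Y :\: X \subset U by apply: subset_trans (subsetDl _ _) sY.
have YXU : Y :\: X != U.
  by apply: contraNneq X0 => q; apply/eqP/setP => z; rewrite inE; apply/negP => zX;
    move: (subsetP sX _ zX); rewrite -q inE zX.
have hYX := fe sYX YX0 YXU.
rewrite (four_setI (Y := Y)) // in hYX; last first.
  by apply/setP => z; rewrite !inE; case zX: (z \in X) => //=; rewrite (negbTE (XM _ zX)) andbF.
by move: nXY hXY; rewrite leq_eqVlt eq_sym => /negPf-> /=; nlia.
Qed.

(** A critical 4-cut with all marks on one side is excluded by [unmarked_cut_neq4], applied to the
    set or its complement. What remains is a cut separating s from t, or a 2-cut that can be
    complemented away from s and t. *)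
Lemma critical_edge e : e \in A -> e \notin prot -> exists X, [/\ X \subset U, cr g e X &
  tight g A s t 4 X \/ [/\ dg g A X = 2, s \notin X & t \notin X]].
Proof.
move=> eA ep; have [X [sX X0 XU ce dX]] := critical_cut eA ep.
have sU := subsetP MU _ sM; have tU := subsetP MU _ tM.
have UX0 : U :\: X != set0.
  by rewrite setD_eq0; apply: contraNN XU => h; rewrite eqEsubset sX.
have n1 : ~~ (four M s t X && [disjoint X & M]).
  by apply/negP => /andP[f d]; have := unmarked_cut_neq4 sX X0 d; rewrite dX f.
have n2 : ~~ (four M s t X && (M \subset X)).
  apply/negP => /andP[f d]; have := unmarked_cut_neq4 (subsetDl U X) UX0.
  rewrite (dgCs _ sp) dX f => h; suff : 4 != 4 by []; apply: h; rewrite -setI_eq0.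
  by apply/eqP/setP => z; rewrite !inE; case: (boolP (z \in M)) => [/(subsetP d)->|]; rewrite ?andbF.
have [sinX|sX'] := boolP (s \in X); have [tinX|tX'] := boolP (t \in X).
- exists (U :\: X); rewrite subsetDl cr_setD // !inE sinX tinX; split=> //; right; split=> //.
  rewrite (dgCs _ sp) dX; case: ifP => // f; move: n1 n2; rewrite f /=; move: f; rewrite /four sinX tinX orbF /=.
  by case: [disjoint _ & _]; case: (M \subset X).
- exists X; split=> //; left; rewrite /tight sinX tX' dX /four sinX (negbTE tX') !orbT; exact: eqxx.
- exists (U :\: X); rewrite subsetDl cr_setD //; split=> //; left.
  by rewrite /tight !inE sX' sU tinX (dgCs _ sp) dX /four (negbTE sX') tinX !orbT eqxx.
- exists X; split=> //; right; split=> //.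
  rewrite dX; case: ifP => // f; move: n1 n2; rewrite f /=; move: f; rewrite /four (negbTE sX') (negbTE tX') orbF /=.
  by case: [disjoint _ & _]; case: (M \subset X).
Qed.
End Reduced.

(** * An s-t path whose removal leaves enough edges in every cut *)

Section Robust.
Variables (V E : finType).
Implicit Types (g : E -> V * V) (A B P : {set E}) (U M X Y Z : {set V}).

Lemma feasibleP g A U M s t : reflect (feasible g A U M s t)
  [forall X : {set V}, [&& X \subset U, X != set0 & X != U] ==>
     ((if four M s t X then 4 else 2) <= dg g A X)].
Proof.
apply: (iffP forallP) => h X; last by apply/implyP => /and3P[a b c]; apply: h.
by move=> a b c; have := h X; rewrite a b c.
Qed.

Lemma lift_dg g A g' A' L P X : lift_map g A g' A' L -> P \subset A' ->
  dg g' (A' :\: P) X <= dg g (A :\: L P) X.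
Proof.
case=> l1 l2 l3 _ sP; have sD : A' :\: P \subset A' by apply: subsetDl.
apply: leq_trans (proj1 (l3 _ X sD)) _; apply: dgS; rewrite subsetD (proj1 (l1 _ sD)).
by apply: l2 => //; rewrite -setI_eq0 setIDAC setDIl setDv setI0.
Qed.

(** With s and t as the only marks every cut counts as [four]. After deletions and splittings each
    edge crosses a tight s-t set, so [layer_parity] makes inner degrees even; but they could only be
    five. Hence just s and t are left, and a single edge serves as path. *)
Lemma robust_path g A U s t : loopfree g A -> supported g A U -> s \in U -> t \in U -> s != t ->
  feasible g A U [set s; t] s t ->
  (forall v, v \in U -> v != s -> v != t -> dg g A [set v] <= 5) ->
  exists p, [/\ is_path g s p t, eset p \subset A & forall X, X \subset U -> X != set0 -> X != U ->
     2 + ((s \in X) (+) (t \in X)) <= dg g (A :\: eset p) X].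
Proof.
have [n] := ubnP #|A|; elim: n g A U => // n IH g A U ltn lf sp sU tU st fe d5.
have sM : s \in [set s; t] by rewrite !inE eqxx.
have tM : t \in [set s; t] by rewrite !inE eqxx orbT.
have MU : [set s; t] \subset U by apply/subsetP => z; rewrite !inE => /orP[] /eqP->.
have r4 X : four [set s; t] s t X.
  rewrite /four -setI_eq0 subUset !sub1set; case sX: (s \in X); case tX: (t \in X); rewrite ?orbT //= orbF.
  apply/eqP/setP => z; rewrite !inE andbC; case: eqVneq => [->|_] //=.
  by case: eqVneq => [->|_].
have [/exists_inP[e eA /feasibleP fe']|/exists_inPn nodel] := boolP [exists e in A,
  [forall X : {set V}, [&& X \subset U, X != set0 & X != U] ==>
     ((if four [set s; t] s t X then 4 else 2) <= dg g (A :\ e) X)]].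
  have sA : A :\ e \subset A by apply: subsetDl.
  have [||||p [pp sp' hp]] := IH g (A :\ e) U _ _ _ sU tU st fe'.
  - by move: ltn; rewrite [#|A|](cardsD1 e) eA.
  - by move=> f /(subsetP sA)/lf.
  - by move=> f /(subsetP sA)/sp.
  - by move=> v vU vs vt; apply: leq_trans (dgS _ _ sA) (d5 v vU vs vt).
  exists p; split=> // [|X X1 X2 X3]; first exact: subset_trans sp' sA.
  apply: leq_trans (hp X X1 X2 X3) _; apply: dgS; exact: setSD.
have [/exists_inP[v vU /and3P[vs vt /eqP dv]]|/exists_inPn no4] := boolP [exists v in U,
  [&& v != s, v != t & dg g A [set v] == 4]].
  have vM : v \notin [set s; t] by rewrite !inE negb_or vs.
  have [g' [A' [[L lL] ltA [lf' sp'] [fe' le'] _]]] := split_off_four lf sp sM tM MU vU vM fe dv.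
  have sUv : s \in U :\ v by rewrite !inE eq_sym vs.
  have tUv : t \in U :\ v by rewrite !inE eq_sym vt.
  have [||q [pq sq hq]] := IH g' A' _ _ lf' sp' sUv tUv st fe'.
  - exact: leq_trans ltA _.
  - by move=> w; rewrite !inE => /andP[_ wU] ws wt; apply: leq_trans (le' _) (d5 w wU ws wt).
  (* The lifted edge set need not be a path; any s-t path inside it will do, since removing fewer
     edges only enlarges the remaining cuts. *)
  have cq : conn g (L (eset q)) s t.
    by apply: (lift_conn lL sq); apply: (walk_conn (proj1 (andP pq))).
  have [p [pp sp1]] := conn_path cq.
  have sLA : L (eset q) \subset A by case: lL => /(_ _ sq) [].
  exists p; split=> // [|X X1 X2 X3]; first exact: subset_trans sp1 sLA.
  have mono : dg g (A :\: L (eset q)) X <= dg g (A :\: eset p) X by apply: dgS; apply: setDS.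
  have lq := lift_dg X lL sq.
  have lp : dg g' (A' :\: eset q) X = dg g' (A' :\: eset q) (X :&: (U :\ v)).
    by apply: dgI_supp => e; rewrite inE => /andP[_ /sp'].
  have hs : (s \in X :&: (U :\ v)) (+) (t \in X :&: (U :\ v)) = (s \in X) (+) (t \in X).
    by rewrite !in_setI sUv tUv !andbT.
  (* The set containing only v and its complement are invisible in the split graph; here the path
     takes at most two of the four edges at v. *)
  have small : dg g A X = dg g A [set v] -> (forall B, B \subset A -> dg g B X = dg g B [set v]) ->
      (s \in X) (+) (t \in X) = false -> 2 + ((s \in X) (+) (t \in X)) <= dg g (A :\: eset p) X.
    move=> _ hB ->; have := dgDS g [set v] (subset_trans sp1 sLA).
    by rewrite dv hB ?subsetDl //; have := path_deg_le2 v pp; nlia.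
  have [q0|q0] := eqVneq (X :&: (U :\ v)) set0.
    have Xv : X = [set v].
      apply/eqP; rewrite eqEsubset; apply/andP; split; last first.
        have /set0Pn[z zX] := X2; have := congr1 (fun S : {set V} => z \in S) q0.
        by rewrite !inE zX (subsetP X1 _ zX) andbT sub1set; case: eqVneq => [<-|].
      apply/subsetP => z zX; have := congr1 (fun S : {set V} => z \in S) q0.
      by rewrite !inE zX (subsetP X1 _ zX) andbT => /= /negbFE.
    by apply: small; rewrite Xv // !inE ![_ == v]eq_sym (negbTE vs) (negbTE vt).
  have [q1|q1] := eqVneq (X :&: (U :\ v)) (U :\ v).
    have Xv : X = U :\ v.
      apply/eqP; rewrite eqEsubset; apply/andP; split; last by rewrite -q1 subsetIl.
      apply/subsetP => z zX; rewrite !inE (subsetP X1 _ zX) andbT.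
      apply: contraNneq X3 => zv; rewrite eqEsubset X1 /=; apply/subsetP => w wU.
      have [->|wv] := eqVneq w v; first by rewrite -zv.
      by have : w \in X :&: (U :\ v); [rewrite q1 !inE wv | rewrite inE => /andP[]].
    have hB B : B \subset A -> dg g B X = dg g B [set v].
      by move=> sB; rewrite Xv (dgCs (U := U)) // => e /(subsetP sB)/sp.
    by apply: small; rewrite ?hB // Xv sUv tUv.
  have := hq _ (subsetIr X _) q0 q1; rewrite hs -lp; move: lq mono; nlia.
have [/exists_inP[v vU /andP[vs vt]]|/exists_inPn allst] := boolP [exists v in U, (v != s) && (v != t)].
  have hk X : s \in X -> t \notin X -> 4 <= dg g A X by apply: (separates_ge4 sp sM tM MU fe).
  have d4 : 3 < dg g A [set v].
    have := fe [set v]; rewrite r4; apply.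
    - by rewrite sub1set.
    - by apply/set0Pn; exists v; rewrite inE.
    - by apply: contraNneq vs => q; move: sU; rewrite -q inE eq_sym.
  have ne4 w : w \in U -> w \notin [set s; t] -> dg g A [set w] != 4.
    rewrite !inE negb_or => wU /andP[ws wt]; have := no4 w wU; by rewrite ws wt.
  have und e : e \in A -> e \notin set0 -> ~ feasible g (A :\ e) U [set s; t] s t.
    by move=> eA _ /feasibleP; apply/negP; apply: nodel.
  have tat e : e \in A -> cr g e [set v] -> exists2 X, tight g A s t 4 X & cr g e X.
    move=> eA _; have [|X [sX ce [tX|[dX _ _]]]] := critical_edge sp sM tM MU fe _ und ne4 eA (negbT (in_set0 e)).
    - by move=> f; rewrite inE.
    - by exists X.
    exfalso; have := fe X sX; rewrite r4 dX => h; suff : 3 < 2 by []; apply: h.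
      by apply: contraTneq ce => ->; rewrite /cr !inE.
    by apply: contraTneq ce => ->; have /andP[a b] := sp e eA; rewrite /cr a b.
  have [] := layer_parity hk vs vt tat _; first exact: leq_trans d4.
  move=> P [Q [f1 [f2 [u [w [_ _ _ _]]]]]].
  have := ne4 v vU; rewrite !inE negb_or vs vt => /(_ isT).
  by have := d5 v vU vs vt; move: d4; case: (dg g A [set v]) => [|[|[|[|[|[|]]]]]].
have UE z : z \in U -> (z == s) || (z == t).
  by move=> /allst; rewrite negb_and !negbK.
have sT : [set s] != U by apply: contraTneq tU => <-; rewrite inE eq_sym.
have d4 : 4 <= dg g A [set s].
  by have := fe [set s]; rewrite r4; apply=> //; [rewrite sub1set | apply/set0Pn; exists s; rewrite inE].
have [e eA ce] : exists2 e, e \in A & cr g e [set s] by apply/dg_gt0P; nlia.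
have je : joins g e s t.
  have [y j ys] := cr1_joins ce; have := sp e eA.
  case/orP: (j) => /eqP q; rewrite q /= => /andP[a b].
    by have := UE _ b; rewrite (negbTE ys) => /= /eqP <-.
  by have := UE _ a; rewrite (negbTE ys) => /= /eqP <-.
exists [:: (e, t)]; rewrite /is_path /= je eqxx !inE st; split=> //.
  by apply/subsetP => f; rewrite !inE /= ?inE => /eqP->.
move=> X X1 X2 X3.
have -> : A :\: eset [:: (e, t)] = A :\ e by apply/setP => f; rewrite !inE /= ?inE.
have : 4 <= dg g A X by have := fe X X1 X2 X3; rewrite r4.
by rewrite (dgD1 _ _ eA); case: (cr g e X); case: (_ (+) _); nlia.
Qed.
End Robust.

(** ** Rerouting trails *)

Section Reroute.
Variables (V E : finType).
Implicit Types (g : E -> V * V) (A B C F R : {set E}) (U M X Y Z : {set V}).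

Definition touch g X : {set E} := [set e | ((g e).1 \in X) || ((g e).2 \in X)].

Lemma dg_ext g B C X : (forall e, cr g e X -> (e \in B) = (e \in C)) -> dg g B X = dg g C X.
Proof.
move=> h; rewrite /dg big_mkcond [RHS]big_mkcond; apply: eq_bigr => e _.
by case ce: (cr g e X); [rewrite h | rewrite !if_same].
Qed.

Lemma cr_eq g e X Y : ((g e).1 \in X) = ((g e).1 \in Y) -> ((g e).2 \in X) = ((g e).2 \in Y) ->
  cr g e X = cr g e Y.
Proof. by rewrite /cr => -> ->. Qed.

Lemma ord2 (i : 'I_2) : (if i == ord0 then ord0 else ord_max) = i.
Proof. by case: i => [[|[|//]] h]; apply: val_inj. Qed.

(** The trail uses both edges of the 2-cut at [X]. Two edge-disjoint paths from q out of [X] must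
    leave by the same two edges, so they can replace everything the trail does inside [X]. *)
Lemma reroute g A R x y X q : loopfree g A -> R \subset A -> trail_set g R x y ->
  x \notin X -> y \notin X -> dg g A X = 2 -> dg g R X = 2 -> q \in X ->
  (forall Y, q \in Y -> Y \subset X -> 2 <= dg g A Y) ->
  exists R', [/\ trail_set g R' x y, R' \subset R :|: (A :&: touch g X), q \in vts g R' &
    vts g R :\: X \subset vts g R'].
Proof.
move=> lf sRA [pR aR] xX yX dA dR qX hcut.
have qT : q \notin ~: X by rewrite inE qX.
have T0 : ~: X != set0 by apply/set0Pn; exists x; rewrite inE.
have [Y qY dY|ye [p [pp sp dp vp]]] := @menger_set V E g A q (~: X) 2 qT T0.
  by apply: hcut qY _; rewrite -[X]setCK -disjoints_subset.
pose P i := eset (p i); pose N := P ord0 :|: P ord_max.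
have sN : N \subset A by rewrite subUset !sp.
have yeT i : ye i \notin X by have /andP[_] := pp i; rewrite inE.
have tP i : trail_set g (P i) q (ye i) by apply: trail_trail_set; apply: path_trail; have /andP[] := pp i.
have touchN e i : e \in P i -> e \in touch g X.
  rewrite !inE => eP; apply: contraT; rewrite negb_or => /andP[a b].
  have /andP[/andP[wk _] _] := pp i; have /andP[c d] := walk_edge_vts wk eP.
  have q1 := vp i _ c; have q2 := vp i _ d; rewrite !inE in q1 q2.
  have := lf e (subsetP (sp i) e _); rewrite (q1 a) (q2 b) eqxx; apply; by rewrite in_eset.
have outP e i v : e \in P i -> cr g e X -> (v == (g e).1) || (v == (g e).2) -> v \notin X -> v = ye i.
  move=> eP ce ve vX; have /andP[/andP[wk _] _] := pp i.
  move: eP; rewrite in_eset => eP; have /andP[c d] := walk_edge_vts wk eP.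
  by apply: (vp i); [case/orP: ve => /eqP-> | rewrite inE].
have crN e : e \in A -> cr g e X -> e \in N.
  move=> eA ce; apply: contraT => eN.
  have d0 i : 0 < dg g (P i) X by rewrite odd_gt0 // (parity_cut _ (tP i).1) qX (negbTE (yeT i)).
  have := dgDS g X sN; rewrite dA dgU ?dp // => h.
  have h0 : dg g (A :\: N) X = 0 by have := d0 ord0; have := d0 ord_max; move: h; nlia.
  by have := dg_eq0 h0 (_ : e \in A :\: N); rewrite in_setD eA eN ce => /(_ isT).
have crR e : e \in A -> cr g e X -> e \in R.
  move=> eA ce; apply: contraT => eN; have := dgDS g X sRA; rewrite dA dR => h.
  have h0 : dg g (A :\: R) X = 0 by move: h; nlia.
  by have := dg_eq0 h0 (_ : e \in A :\: R); rewrite in_setD eA eN ce => /(_ isT).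
pose R1 := R :\: touch g X; pose R' := R1 :|: N.
have memR' e : e \in R' = (e \in R) && (e \notin touch g X) || (e \in N).
  by rewrite in_setU in_setD andbC.
have touchN' e : e \in N -> e \in touch g X by rewrite in_setU => /orP[] /touchN.
have dgout v : v \notin X -> dg g R' [set v] = dg g R [set v].
  move=> vX; apply: dg_ext => e ce; rewrite memR'.
  have [te|te] := boolP (e \in touch g X); last first.
    by rewrite (contraNF (@touchN' e) te) orbF andbT.
  rewrite andbF /=.
  have cX : cr g e X.
    move: ce te; rewrite /cr !inE.
    case: eqVneq => [->|_]; first by rewrite (negbTE vX) /= => _ ->.
    by case: eqVneq => [->|_] // _; rewrite (negbTE vX) orbF => ->.
  by apply/idP/idP => [/(subsetP sN)|/(subsetP sRA)] eA; [apply: crR | apply: crN].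
have R1X v : v \in X -> dg g R1 [set v] = 0.
  move=> vX; apply/eqP; rewrite -leqn0 leqNgt; apply/negP => /dg_gt0P[e].
  by rewrite !inE negb_or => /andP[/andP[a b] _]; rewrite /cr !inE;
    case: eqVneq => [q1|_]; [move: a; rewrite q1 vX | case: eqVneq => [q1|_] //; move: b; rewrite q1 vX].
have dR1N : [disjoint R1 & N].
  by rewrite -setI_eq0; apply/eqP/setP => e; rewrite in_setI in_setD in_set0; case: (boolP (e \in N)) => [/touchN'->|]; rewrite ?andbF.
exists R'; split.
- split=> [v|Y xY d0].
    have [vX|vX] := boolP (v \in X); last by rewrite dgout.
    rewrite dgU // (R1X v vX) add0n dgU ?dp // oddD !((tP _).1) addbACA addbb /=.
    have ne z : z \notin X -> (v == z) = false by move=> zX; apply: contraNF zX => /eqP<-.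
    by rewrite !ne.
  have d0P i : dg g (P i) Y = 0.
    apply/eqP; rewrite -leqn0 -d0; apply: dgS; apply: subset_trans (subsetUr _ _).
    by rewrite -(ord2 i); case: ifP => _; [apply: subsetUl | apply: subsetUr].
  have yY i : (ye i \in Y) = (q \in Y) by rewrite (conn_cut (trail_set_conn (tP i)) (d0P i)).
  (* For anchoring, [Y] is altered inside [X] so that all of [X] lies on the side of q; then the old
     trail does not cross the altered set either. *)
  pose Y' := if q \in Y then Y :|: X else Y :\: X.
  have inY' z : z \in X -> (z \in Y') = (q \in Y).
    by rewrite /Y' => zX; case: ifP; rewrite !inE zX ?orbT.
  have outY' z : z \notin X -> (z \in Y') = (z \in Y).
    by rewrite /Y' => zX; case: ifP; rewrite !inE (negbTE zX) ?orbF.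
  have dY' : dg g R Y' = 0.
    apply/eqP; rewrite -leqn0 leqNgt; apply/negP => /dg_gt0P[f fR]; apply/negP.
    have [tf|tf] := boolP (f \in touch g X); last first.
      have fR' : f \in R' by rewrite memR' fR tf.
      move: tf; rewrite inE negb_or => /andP[a b].
      by rewrite (@cr_eq g f Y' Y) ?outY' // (dg_eq0 d0 fR').
    have [cf|cf] := boolP (cr g f X); last first.
      move: cf tf; rewrite /cr inE; case c1: (_ \in X); case c2: (_ \in X) => // _ _.
      by rewrite !inY' // addbb.
    have := crN f (subsetP sRA _ fR) cf; rewrite in_setU => fN.
    have [i fi] : exists i, f \in P i by case/orP: fN; [exists ord0 | exists ord_max].
    have o v := outP f i v fi cf.
    rewrite /cr; move: (cf); rewrite /cr; case c1: (_ \in X); case c2: (_ \in X) => //= _.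
      by rewrite inY' // outY' ?c2 // (o (g f).2) ?eqxx ?orbT ?c2 // yY addbb.
    by rewrite outY' ?c1 // inY' // (o (g f).1) ?eqxx ?c1 // yY addbb.
  have sR := aR Y' _ dY'; have {}sR : vts g R \subset Y' by apply: sR; rewrite outY'.
  have /dg_gt0P[e eR ce] : 0 < dg g R X by rewrite dR.
  have [z [_ [_ zX _ zR _]]] := cr_vts eR ce.
  have qY : q \in Y by rewrite -(inY' z zX) (subsetP sR).
  rewrite vtsU subUset; apply/andP; split; last first.
    by rewrite vtsU subUset !((tP _).2).
  apply/subsetP => v vR; have vX : v \notin X.
    by apply/negP => vX; move: vR; rewrite in_vts (R1X v vX).
  rewrite -(outY' v vX); apply: (subsetP sR); apply: (subsetP _ _ vR); apply: vtsS; exact: subsetDl.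
- apply/subsetP => e; rewrite memR' in_setU in_setI => /orP[/andP[-> //]|eN].
  by rewrite (subsetP sN e eN) (touchN' e eN) orbT.
- have : q \in vts g (P ord0).
    have := trail_set_conn (trail_set_sym (tP ord0)); move=> /conn_vts; apply.
    by apply: contraTneq qX => <-.
  by apply/subsetP/vtsS; apply: subset_trans (subsetUl (P ord0) (P ord_max)) (subsetUr R1 N).
- by apply/subsetP => v; rewrite inE => /andP[vX]; rewrite !in_vts dgout.
Qed.

Lemma trail_set_attach g R C x y w : [disjoint R & C] -> trail_set g R x y -> w \in vts g R ->
  trail_set g C w w -> trail_set g (R :|: C) x y.
Proof.
move=> dRC [pR aR] wR [pC aC]; split=> [v|Y xY]; first by rewrite dgU // oddD pR pC addbb addbF.
rewrite dgU // => /eqP; rewrite addn_eq0 => /andP[/eqP d1 /eqP d2].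
have sY := aR _ xY d1; rewrite vtsU subUset sY /=; apply: aC d2; exact: (subsetP sY).
Qed.

Lemma non_bridge_cycle g F e w z : e \in F -> joins g e w z -> conn g (F :\ e) z w ->
  exists C, [/\ e \in C, C \subset F & trail_set g C w w].
Proof.
move=> eF j cz; have [p [pp sp]] := conn_path cz.
have tp := trail_trail_set (path_trail pp).
exists ([set e] :|: eset p); split; first by rewrite !inE eqxx.
  by rewrite subUset sub1set eF; apply: subset_trans sp (subsetDl _ _).
apply: trail_set_cat (trail_set1 j) tp.
by rewrite disjoints1; apply/negP => /(subsetP sp); rewrite !inE eqxx.
Qed.

(* Deleting a bridge e at w cuts off a set inside X; by edge-connectivity it contains a vertex
   of Th other than w, and different bridges cut off disjoint sets. *)
Lemma branch g F Th X w : loopfree g F -> dg g F X = 0 -> w \in X ->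
  (forall Z, Z \subset X -> Z != set0 -> 2 <= dg g F Z + dg g Th Z) ->
  (forall e z, e \in F -> joins g e w z -> ~~ conn g (F :\ e) z w) ->
  w \in vts g Th -> dg g F [set w] < #|X :&: vts g Th|.
Proof.
move=> lf dX wX hc br wT.
pose oth e := if (g e).1 == w then (g e).2 else (g e).1.
pose D e := component g (F :\ e) (oth e).
pose S := [set e in F | cr g e [set w]].
have SP e : e \in S -> [/\ e \in F, joins g e w (oth e), oth e \in X & w \notin D e].
  rewrite inE => /andP[eF ce]; have j : joins g e w (oth e).
    move: ce; rewrite /cr !inE /oth /joins; case: (g e) => a b /=; rewrite !xpair_eqE.
    by case: eqVneq => [->|ne] /=; rewrite ?eqxx //= => /eqP->; rewrite eqxx orbT.
  split=> //; last by rewrite inE; apply: br.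
  have := dg_eq0 dX eF; rewrite (joins_cr _ j) wX.
  by case: (oth e \in X).
have oD e : oth e \in D e by rewrite inE conn_refl.
have DX e : e \in S -> D e \subset X.
  move=> eS; have [eF _ oX _] := SP e eS; apply/subsetP => z; rewrite inE => cz.
  rewrite -(conn_cut cz) //; apply/eqP; rewrite -leqn0 -dX; apply: dgS; exact: subsetDl.
have crD e f : e \in S -> f \in F -> cr g f (D e) -> f = e.
  move=> eS fF cf; apply/eqP; apply: contraTT cf => fe.
  by rewrite (dg_eq0 (component_cut g (F :\ e) (oth e))) // !inE fe.
have dD e : e \in S -> dg g F (D e) <= 1.
  move=> eS; have [eF _ _ _] := SP e eS; rewrite (dgD1 _ _ eF) component_cut addn0; by case: cr.
have hD e : exists z, e \in S -> z \in (X :&: vts g Th) :\ w /\ z \in D e.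
  have [eS|//] := boolP (e \in S); last by exists w.
  have [eF _ _ wD] := SP e eS.
  have /dg_gt0P[f fT cf] : 0 < dg g Th (D e).
    have := hc (D e) (DX e eS) _; have := dD e eS.
    have : D e != set0 by apply/set0Pn; exists (oth e); apply: oD.
    by move=> -> h /(_ isT); move: h; nlia.
  have [z [_ [_ zD _ zT _]]] := cr_vts fT cf.
  exists z; split=> //; rewrite in_setD1 in_setI zT (subsetP (DX e eS)) // !andbT.
  by apply: contraNneq wD => <-.
have [h hP] := fin_all_exists hD.
have inj : {in S &, injective h}.
  move=> e e' eS e'S hh; apply/eqP; apply: contraT => ne.
  have [_ ze] := hP e eS; have [_ ze'] := hP e' e'S; rewrite -hh in ze'.
  have [eF j oX wD] := SP e eS; have [e'F j' oX' wD'] := SP e' e'S.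
  have o1 : oth e' \notin D e.
    apply: contraNN ne => o1; have := crD e e' eS e'F; rewrite (joins_cr _ j') (negbTE wD) o1 => /(_ isT) ->; exact: eqxx.
  have o2 : oth e \notin D e'.
    apply: contraNN ne => o2; have := crD e' e e'S eF; rewrite (joins_cr _ j) (negbTE wD') o2 => /(_ isT) ->; exact: eqxx.
  (* The intersection contains the shared vertex [h e] but not [oth e], although these two are
     joined in [F] without e and no such edge crosses it. *)
  have d0 : dg g (F :\ e) (D e :&: D e') = 0.
    apply/eqP; rewrite -leqn0 leqNgt; apply/negP => /dg_gt0P[f]; rewrite !inE => /andP[fe fF] cf.
    have fe' : f != e'.
      apply: contraTneq cf => ->; by rewrite (joins_cr _ j') !in_setI (negbTE o1) (negbTE wD).
    have n1 : cr g f (D e) = false by apply: contraNF fe => /(crD _ _ eS fF)->.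
    have n2 : cr g f (D e') = false by apply: contraNF fe' => /(crD _ _ e'S fF)->.
    move: cf n1 n2; rewrite /cr !in_setI.
    by case: ((g f).1 \in D e); case: ((g f).2 \in D e); case: ((g f).1 \in D e'); case: ((g f).2 \in D e').
  have cz : conn g (F :\ e) (oth e) (h e) by move: ze; rewrite inE.
  by have := conn_cut cz d0; rewrite !in_setI ze ze' (negbTE o2) andbF.
have -> : dg g F [set w] = #|S|.
  rewrite /dg -sum1_card big_mkcond [RHS]big_mkcond /=.
  by apply: eq_bigr => e _; rewrite inE; case: (e \in F); case: cr.
rewrite -(card_in_imset inj) (cardsD1 w (X :&: vts g Th)) inE wX wT add1n ltnS.
apply: subset_leq_card; apply/subsetP => z /imsetP[e eS ->]; by have [] := hP e eS.
Qed.

(* With c vertices of Th in X, the degree count yields one that has at least c edges of F. *)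
Lemma branch_count g F Th X : loopfree g F -> loopfree g Th -> dg g F X = 0 -> X != set0 ->
  (forall Z, Z \subset X -> Z != set0 -> 2 <= dg g F Z + dg g Th Z) ->
  (forall w, w \in X :&: vts g Th -> ~~ odd (dg g Th [set w]) /\ dg g F [set w] + dg g Th [set w] = 5) ->
  (forall w e z, w \in X :&: vts g Th -> e \in F -> joins g e w z -> ~~ conn g (F :\ e) z w) ->
  \sum_(x in X) dg g Th [set x] <= 6 -> False.
Proof.
move=> lf lfT dX X0 hc h5 br s6; pose W := X :&: vts g Th.
have Wn : 0 < #|W|.
  have /dg_gt0P[e eT ce] : 0 < dg g Th X by have := hc X (subxx _) X0; rewrite dX; nlia.
  by have [z [_ [_ zX _ zT _]]] := cr_vts eT ce; apply/card_gt0P; exists z; rewrite inE zX.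
have bd w : w \in W -> dg g F [set w] < #|W|.
  by move=> wW; move: (wW); rewrite inE => /andP[wX wT]; apply: branch => // e z; apply: br.
have ge w : w \in W -> 2 <= dg g Th [set w] /\ dg g Th [set w] <= 4.
  move=> wW; have [ev s5] := h5 w wW; move: wW; rewrite inE in_vts => /andP[_].
  by move: ev s5; case: (dg g Th [set w]) => [|[|[|[|[|[|]]]]]] //=; nlia.
have sW : \sum_(x in W) dg g Th [set x] <= 6.
  by apply: leq_trans s6; rewrite [X in _ <= X](big_setID (vts g Th)) /= leq_addr.
have low : \sum_(x in W) 2 <= 6.
  by apply: leq_trans sW; apply: leq_sum => w /ge[].
rewrite sum_nat_const in low.
have sF : \sum_(x in W) dg g F [set x] + \sum_(x in W) dg g Th [set x] = #|W| * 5.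
  by rewrite -big_split /= -sum_nat_const; apply: eq_bigr => w /h5[_ ->].
have up : \sum_(x in W) dg g F [set x] <= #|W| * #|W|.-1.
  by rewrite -sum_nat_const; apply: leq_sum => w /bd; case: #|W|.
have up4 : \sum_(x in W) dg g Th [set x] <= #|W| * 4.
  by rewrite -sum_nat_const; apply: leq_sum => w /ge[].
(* There are at most three vertices, each taking at least two of the six trail degrees. For c = 1,
   2, 3 the degree sum 5c exceeds c(c - 1), the bound for [F], plus min(4c, 6), the bound for
   [Th]. *)
move: Wn low sF up up4 sW; case: #|W| => [|[|[|[|n]]]] //=; nlia.
Qed.
End Reroute.

(** ** Maximal systems of trails *)

Lemma setI_eq_mem (T : finType) (X Y C : {set T}) z : X :&: C = Y :&: C -> z \in C ->
  (z \in X) = (z \in Y).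
Proof. by move=> /setP/(_ z); rewrite !in_setI => h zC; rewrite zC !andbT in h. Qed.

Lemma card_bigcup_bound (S T : finType) (P : {set S}) (F : S -> {set T}) k :
  (forall x, x \in P -> #|F x| <= k) -> #|\bigcup_(x in P) F x| <= #|P| * k.
Proof.
move=> h; rewrite -sum_nat_const; elim/big_rec2: _ => [|x a B xP le]; first by rewrite cards0.
by apply: leq_trans (leq_card_setU _ _) _; apply: leq_add => //; apply: h.
Qed.

Section System.
Variables (V E : finType) (g : E -> V * V) (A : {set E}) (U M : {set V}) (s t : V) (eps : E).
Implicit Types (B C F O S : {set E}) (X Y Z D : {set V}).

Lemma trail_setP B x y : reflect (trail_set g B x y)
  ([forall v, odd (dg g B [set v]) == (v == x) (+) (v == y)] &&
   [forall X : {set V}, (x \in X) ==> (dg g B X == 0) ==> (vts g B \subset X)]).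
Proof.
apply: (iffP andP) => [[/forallP p /forallP a]|[p a]]; split.
- by move=> v; apply/eqP; apply: p.
- by move=> X xX d0; have := a X; rewrite xX d0.
- by apply/forallP => v; apply/eqP; apply: p.
- by apply/forallP => X; apply/implyP => xX; apply/implyP => /eqP; apply: a.
Qed.

Lemma card_cr B X : #|[set e in B | cr g e X]| = dg g B X.
Proof.
rewrite /dg -sum1_card big_mkcond [RHS]big_mkcond /=.
by apply: eq_bigr => e _; rewrite inE; case: (e \in B); case: cr.
Qed.

Lemma dg_bigcup m (R : 'I_m -> {set E}) X : (forall i j, i != j -> [disjoint R i & R j]) ->
  dg g (\bigcup_i R i) X = \sum_i dg g (R i) X.
Proof.
move=> dR; rewrite /dg big_mkcond /= (eq_bigr (fun i => \sum_e if e \in R i then (cr g e X : nat) else 0)); last first.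
  by move=> i _; rewrite big_mkcond.
rewrite exchange_big /=; apply: eq_bigr => e _; case: bigcupP => [[i _ ei]|no].
  rewrite (bigD1 i) //= ei big1 ?addn0 // => j ji; case: ifP => // ej.
  by have := disjointFr (dR _ _ ji) ej; rewrite ei.
by rewrite big1 // => i _; case: ifP => // ei; case: no; exists i.
Qed.

Lemma vts_bigcup m (R : 'I_m -> {set E}) v : v \in vts g (\bigcup_i R i) -> exists i, v \in vts g (R i).
Proof.
rewrite in_vts => /dg_gt0P[e /bigcupP[i _ ei] ce]; exists i; rewrite in_vts.
by apply/dg_gt0P; exists e.
Qed.

Hypotheses (lf : loopfree g A) (sp : supported g A U).
Hypotheses (sM : s \in M) (tM : t \in M) (MU : M \subset U) (fe : feasible g A U M s t).
(* The edge eps stands for an s-t path through all marks whose edges have been set aside. *)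
Hypotheses (epsA : eps \in A) (eps_st : joins g eps s t).
Hypothesis no_degree4 : forall v, v \in U -> v \notin M -> dg g A [set v] != 4.
Hypothesis degree_le5 : forall v, v \in U -> v \notin M -> dg g A [set v] <= 5.

Lemma cut_ge2 X : X \subset U -> X != set0 -> s \notin X -> 2 <= dg g A X.
Proof.
move=> sX X0 sX'; have := fe sX X0 _; rewrite (_ : X != U); last first.
  by apply: contraNneq sX' => ->; apply: (subsetP MU).
by move=> /(_ isT); case: ifP => // _; apply: leq_trans.
Qed.

Lemma unmarked_degree v : v \in U -> v \notin M -> dg g A [set v] = 5.
Proof.
move=> vU vM; apply/eqP; rewrite eqn_leq degree_le5 //= ltn_neqAle eq_sym no_degree4 //=.
have := fe (_ : [set v] \subset U) (_ : _ != set0) (_ : _ != U).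
rewrite sub1set /four disjoints1 vM /=; apply=> //.
  by apply/set0Pn; exists v; rewrite inE.
by apply: contraNneq vM => q; have := subsetP MU _ sM; rewrite -q inE => /eqP <-.
Qed.

Lemma anchored_avoids B X e : B \subset A -> anchored g B s -> s \notin X -> dg g B X = 0 ->
  e \in B -> e \notin touch g X.
Proof.
move=> sB aB sX d0 eB; have dis := dg_anchored aB sX d0.
have /andP[a b] := vts_edge eB (lf (subsetP sB _ eB)).
by rewrite inE (disjointFr dis a) (disjointFr dis b).
Qed.

Section Family.
Variables (O : {set E}) (m : nat) (y0 : V) (Mp D : {set V}).
Hypotheses (sO : O \subset A :\ eps) (aO : anchored g O s) (MMp : M \subset Mp) (DMp : D \subset Mp).
Hypothesis y0E : y0 \in [set s; t].
Implicit Types (R : {ffun 'I_m -> {set E}}).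

Definition Theta R : {set E} := \bigcup_i R i.
(** Used twice: for three s-t trails without further constraint, and for one closed trail at s that
    avoids a spared strand [O] and has to visit a far vertex, the element of [D]. *)
Definition valid R := [/\ forall i, trail_set g (R i) s y0, forall i, R i \subset A :\ eps :\: O,
  forall i j, i != j -> [disjoint R i & R j] & D \subset vts g (Theta R)].
(* Lexicographic: visited marks first, then edges. *)
Definition mu R := #|Mp :&: vts g (Theta R)| * #|E|.+1 + #|Theta R|.
Definition maximal R := valid R /\ forall R', valid R' -> mu R' <= mu R.

Lemma maximal_exists R : valid R -> exists R', maximal R'.
Proof.
pose vb (R : {ffun 'I_m -> {set E}}) := [&& [forall i, ([forall v, odd (dg g (R i) [set v]) == (v == s) (+) (v == y0)] &&
   [forall X : {set V}, (s \in X) ==> (dg g (R i) X == 0) ==> (vts g (R i) \subset X)])],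
   [forall i, R i \subset A :\ eps :\: O],
   [forall i, forall j, (i != j) ==> [disjoint R i & R j]] & D \subset vts g (Theta R)].
have vbP R0 : reflect (valid R0) (vb R0).
  apply: (iffP and4P) => -[a b c d]; split=> //.
  - by move=> i; apply/trail_setP; apply: (forallP a).
  - exact: forallP b.
  - by move=> i j; apply: implyP; have /forallP := forallP c i; apply.
  - by apply/forallP => i; apply/trail_setP.
  - exact/forallP.
  - by apply/forallP => i; apply/forallP => j; apply/implyP; apply: c.
move=> /vbP vR; case: (@arg_maxnP _ R vb mu vR) => R' /vbP vR' mx.
by exists R'; split=> // R2 /vbP; apply: mx.
Qed.

Lemma Theta_trail_vts R i : vts g (R i) \subset vts g (Theta R).
Proof. by apply: vtsS; apply: bigcup_sup. Qed.

Section Maximal.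
Variable R : {ffun 'I_m -> {set E}}.
Hypothesis maxR : maximal R.
Notation Th := (Theta R).
Notation F := (A :\ eps :\: O :\: Th).

Lemma Theta_sub : Th \subset A :\ eps :\: O.
Proof. by case: maxR => -[_ h _ _] _; apply/bigcupsP => i _. Qed.

Lemma trail_subA i : R i \subset A.
Proof.
by case: maxR => -[_ /(_ i) h _ _] _; apply: subset_trans h _; apply: subset_trans (subsetDl _ _) (subsetDl _ _).
Qed.

Lemma dg_parts X : dg g A X = cr g eps X + dg g O X + dg g Th X + dg g F X.
Proof. by rewrite (dgD1 _ _ epsA) (dgDS _ _ sO) (dgDS _ _ Theta_sub) !addnA. Qed.

Lemma dg_Theta X : dg g Th X = \sum_i dg g (R i) X.
Proof. by case: maxR => -[_ _ h _] _; apply: dg_bigcup. Qed.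

Lemma Theta_parity X : s \notin X -> t \notin X -> ~~ odd (dg g Th X).
Proof.
move=> sX tX; rewrite dg_Theta; elim/big_ind: _ => // [a b|i _]; first by rewrite oddD => /negPf-> /negPf->.
case: maxR => -[/(_ i) [p _] _ _ _] _; rewrite (parity_cut _ p) (negbTE sX) /=.
by move: y0E; rewrite !inE => /orP[] /eqP->.
Qed.

Definition subst_trail i S : {ffun 'I_m -> {set E}} := [ffun j => if j == i then S else R j].

Lemma subst_trail_sub i S j : subst_trail i S j \subset Theta (subst_trail i S).
Proof. exact: bigcup_sup. Qed.

Lemma subst_valid i S : trail_set g S s y0 -> S \subset A :\ eps :\: O ->
  (forall j, j != i -> [disjoint S & R j]) -> D \subset vts g (Theta (subst_trail i S)) ->
  valid (subst_trail i S).
Proof.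
case: maxR => -[h1 h2 h3 _] _ tS sS dS DS; split=> //.
- by move=> j; rewrite ffunE; case: eqP.
- by move=> j; rewrite ffunE; case: eqP.
move=> j k jk; rewrite !ffunE; case: (eqVneq j i) => [ji|ji]; case: (eqVneq k i) => [ki|ki].
- by move: jk; rewrite ji ki eqxx.
- exact: dS.
- by rewrite disjoint_sym; apply: dS.
- exact: h3.
Qed.

(* Otherwise the trail crossing X could be rerouted through a mark inside X. *)
Lemma cut_marked X e : X \subset U -> s \notin X -> t \notin X -> dg g A X = 2 ->
  e \in Th -> cr g e X -> exists2 z, z \in X & z \in Mp :&: vts g Th.
Proof.
move=> sX sX' tX' dX eT ce; apply/exists_inP; apply: contraT => /exists_inPn no.
have /bigcupP[i _ ei] := eT; case: (maxR) => -[h1 h2 h3 h4] hmax.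
have y0X : y0 \notin X by move: y0E; rewrite !inE => /orP[] /eqP->.
have X0 : X != set0 by apply: contraTneq ce => ->; rewrite /cr !inE.
have XU : X != U by apply: contraNneq sX' => ->; apply: (subsetP MU).
have di : dg g (R i) X = 2.
  have := dgS g X (trail_subA i); rewrite dX.
  have : 0 < dg g (R i) X by apply/dg_gt0P; exists e.
  have := parity_cut X (h1 i).1; rewrite (negbTE sX') (negbTE y0X).
  by case: (dg g (R i) X) => [|[|[|]]].
(* With only two crossing edges, [X] cannot be subject to the threshold four, so it contains a
   mark. *)
have [q qX qM] : exists2 q, q \in X & q \in M.
  have := fe sX X0 XU; rewrite dX; case: ifP => // nf _.
  have : ~~ [disjoint X & M] by move: nf; rewrite /four; case: [disjoint X & M].
  by rewrite -setI_eq0 => /set0Pn[q]; rewrite inE => /andP[]; exists q.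
have other S : S \subset A -> [disjoint S & R i] -> dg g S X = 0.
  move=> sS dS; have : dg g (S :|: R i) X <= dg g A X by apply: dgS; rewrite subUset sS trail_subA.
  by rewrite dgU // di dX; nlia.
have hc Y : q \in Y -> Y \subset X -> 2 <= dg g A Y.
  move=> qY sY; apply: cut_ge2; first exact: subset_trans sY sX.
    by apply/set0Pn; exists q.
  by apply: contraNN sX' => /(subsetP sY).
have [R' [t1 t2 t3 t4]] := reroute lf (trail_subA i) (h1 i) sX' y0X dX di qX hc.
have avoid S f : S \subset A -> anchored g S s -> [disjoint S & R i] -> f \in S -> f \in R' -> False.
  move=> sS aS dS fS /(subsetP t2); rewrite in_setU (disjointFr dS fS) /= in_setI => /andP[_].
  by apply/negP; apply: (anchored_avoids sS aS sX' (other S sS dS) fS).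
have OA : O \subset A by apply: subset_trans sO (subsetDl _ _).
have dO j : [disjoint O & R j].
  by have := h2 j; rewrite subsetD => /andP[_]; rewrite disjoint_sym.
have sR' : R' \subset A :\ eps :\: O.
  apply/subsetP => f fR'; rewrite in_setD in_setD1; apply/and3P; split.
  - by apply/negP => fO; apply: (avoid O f).
  - apply/eqP => fe'; move: fR' => /(subsetP t2); rewrite in_setU fe' => /orP[h|].
      by have := subsetP (h2 i) _ h; rewrite !inE eqxx /= andbF.
    by case/orP: eps_st => /eqP q0; rewrite !inE q0 /= (negbTE sX') (negbTE tX') andbF.
  - by have := subsetP t2 f fR'; rewrite in_setU in_setI => /orP[/(subsetP (trail_subA i))|/andP[]].
have dR' j : j != i -> [disjoint R' & R j].
  move=> ji; rewrite -setI_eq0; apply/eqP/setP => f; rewrite in_setI in_set0; apply/negP => /andP[fR' fj].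
  by apply: (avoid (R j) f (trail_subA j) (h1 j).2 (h3 _ _ ji)).
have keep v : v \in vts g Th -> v \notin X -> v \in vts g (Theta (subst_trail i R')).
  move=> /vts_bigcup[j vj] vX; apply: (subsetP (Theta_trail_vts _ j)); rewrite ffunE.
  by case: eqP vj => [->|//] vj; apply: (subsetP t4); rewrite inE vX.
have val : valid (subst_trail i R').
  apply: subst_valid => //; apply/subsetP => v vD; apply: keep; first exact: (subsetP h4).
  by apply/negP => vX; have := no v vX; rewrite inE (subsetP DMp) ?(subsetP h4).
have := hmax _ val; rewrite /mu.
have : #|Mp :&: vts g Th| < #|Mp :&: vts g (Theta (subst_trail i R'))|.
  apply: proper_card; apply/properP; split.
    apply/subsetP => v vv; apply/setIP; move: (vv); rewrite inE => /andP[v1 v2]; split=> //.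
    by apply: keep => //; apply: contraL vv; apply: no.
  exists q; last exact: no.
  rewrite inE (subsetP MMp) //=; apply: (subsetP (Theta_trail_vts _ i)); by rewrite ffunE eqxx.
have : #|Th| <= #|E| by apply: max_card.
(* One more visited mark outweighs any loss of edges. *)
move: #|Th| #|E| #|Mp :&: _| #|Mp :&: _| #|Theta _| => a b c d k; clear; nia.
Qed.

Lemma bridge w e z : w \in vts g Th -> e \in F -> joins g e w z -> ~~ conn g (F :\ e) z w.
Proof.
move=> /vts_bigcup[i wi] eF j; apply/negP => cz.
case: (maxR) => -[h1 h2 h3 h4] hmax.
have [C [eC sC tC]] := non_bridge_cycle eF j cz.
have dC k : [disjoint C & R k].
  have := sC; rewrite subsetD => /andP[_]; apply: disjointWr; exact: bigcup_sup.
have sCO : C \subset A :\ eps :\: O by apply: subset_trans sC (subsetDl _ _).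
have sTh : Th \subset Theta (subst_trail i (R i :|: C)).
  apply/bigcupsP => k _; apply: subset_trans (subst_trail_sub i _ k); rewrite ffunE.
  by case: eqP => [->|//]; apply: subsetUl.
have val : valid (subst_trail i (R i :|: C)).
  apply: subst_valid.
  - by apply: trail_set_attach wi tC => //; rewrite disjoint_sym.
  - by rewrite subUset h2.
  - move=> k ki; rewrite -setI_eq0 setIUl setU_eq0 !setI_eq0 dC andbT; apply: h3; by rewrite eq_sym.
  - by apply: subset_trans h4 _; apply: vtsS.
have := hmax _ val; rewrite /mu.
have : #|Mp :&: vts g Th| <= #|Mp :&: vts g (Theta (subst_trail i (R i :|: C)))|.
  by apply: subset_leq_card; apply: setIS; apply: vtsS.
have : #|Th| < #|Theta (subst_trail i (R i :|: C))|.
  apply: proper_card; apply/properP; split=> //; exists e; last by move: eF; rewrite in_setD => /andP[].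
  by apply: (subsetP (subst_trail_sub i _ i)); rewrite ffunE eqxx in_setU eC orbT.
move: #|Th| #|E| #|Mp :&: _| #|Mp :&: _| #|Theta _| => a b c d k; clear; nia.
Qed.

Lemma no_thin_layer X : X \subset U -> X != set0 -> s \notin X -> t \notin X ->
  (forall z, z \in X -> z \notin Mp :&: vts g Th) -> dg g F X = 0 ->
  (forall e, e \in O -> e \notin touch g X) ->
  (forall e, e \in Th -> ~~ (((g e).1 \in X) && ((g e).2 \in X))) -> dg g Th X <= 6 -> False.
Proof.
move=> sX X0 sX' tX' noc dF Oo ins d6.
have sFA : F \subset A by do ?[apply: subset_trans (subsetDl _ _) _].
have sTA : Th \subset A by apply: subset_trans Theta_sub _; do ?[apply: subset_trans (subsetDl _ _) _].
have dZ Z : Z \subset X -> dg g A Z = dg g F Z + dg g Th Z.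
  move=> sZ; rewrite dg_parts addnC; congr (_ + _).
  suff [-> ->] : cr g eps Z = false /\ dg g O Z = 0 by [].
  have nZ z : z \notin X -> z \in Z = false by move=> h; apply: contraNF h => /(subsetP sZ).
  split; first by rewrite (joins_cr _ eps_st) !nZ.
  apply/eqP; rewrite -leqn0 leqNgt; apply/negP => /dg_gt0P[e eO]; apply/negP.
  by have := Oo e eO; rewrite inE negb_or => /andP[a b]; rewrite /cr !nZ.
apply: (@branch_count _ _ g F Th X) => //.
- by move=> e /(subsetP sFA)/lf.
- by move=> e /(subsetP sTA)/lf.
- move=> Z sZ Z0; rewrite -dZ //; apply: cut_ge2 => //; first exact: subset_trans sZ sX.
  by apply: contraNN sX' => /(subsetP sZ).
- move=> w; rewrite inE => /andP[wX wT]; split.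
    by apply: Theta_parity; rewrite inE; [apply: contraNneq sX' | apply: contraNneq tX'] => ->.
  rewrite -dZ ?sub1set //; apply: unmarked_degree; first exact: (subsetP sX).
  apply: contraNN (noc w wX) => wM; rewrite inE wT andbT; exact: (subsetP MMp).
- by move=> w e z; rewrite inE => /andP[_ wT]; apply: bridge.
- rewrite sum_dg1 big1 ?addn0 // => e eT; have := ins e eT; by case: (_ \in X); case: (_ \in X).
Qed.

End Maximal.
End Family.
Hypothesis undeletable : forall e, e \in A -> e \notin [set eps] -> ~ feasible g (A :\ e) U M s t.

Lemma eps_ends : (g eps).1 \in M /\ (g eps).2 \in M.
Proof. by case/orP: eps_st => /eqP ->. Qed.

Lemma edge_in_small_cut e : e \in A -> e != eps -> exists X, [/\ X \subset U, cr g e X &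
  tight g A s t 4 X \/ [/\ dg g A X = 2, s \notin X & t \notin X]].
Proof.
move=> eA ne; apply: (critical_edge sp sM tM MU fe (prot := [set eps])) => //; last by rewrite inE.
by move=> f; rewrite inE => /eqP->; case: eps_ends.
Qed.

Lemma separating_ge4 X : s \in X -> t \notin X -> 4 <= dg g A X.
Proof. exact: (separates_ge4 sp sM tM MU fe). Qed.

(** * Three s-t trails and the tight cuts they determine *)

Section Strands.
Variable R : {ffun 'I_3 -> {set E}}.
Hypothesis maxR : maximal set0 t M set0 R.
Notation Th := (Theta R).
Notation C := (M :&: vts g (Theta R)).

Let sO : set0 \subset A :\ eps. Proof. exact: sub0set. Qed.
Let aO : anchored g set0 s. Proof. by case: (trail_set0 g s). Qed.
Let MMp0 : M \subset M. Proof. exact: subxx. Qed.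
Let y0E : t \in [set s; t]. Proof. by rewrite !inE eqxx orbT. Qed.

(** [eps] and each of the three trails need an edge of the cut, which accounts for all four. *)
Lemma strands_tight X : tight g A s t 4 X ->
  dg g (A :\ eps :\: set0 :\: Th) X = 0 /\ dg g Th X <= 3.
Proof.
case/and3P=> sX tX /eqP dX; have := dg_parts sO maxR X.
have : 3 <= dg g Th X.
  rewrite (dg_Theta maxR) -[X in X <= _](card_ord 3) -sum1_card; apply: leq_sum => i _.
  case: maxR => -[h _ _ _] _; rewrite odd_gt0 // (parity_cut X (h i).1) sX (negbTE tX) //.
by rewrite (joins_cr _ eps_st) sX (negbTE tX) dX; nlia.
Qed.

(* Otherwise take nested tight sets I, J with the same visited marks and J minus I smallest.
   Uncrossing shows that no trail edge lies inside J minus I, against [no_thin_layer]. *)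
Lemma tight_trace_inj X Y : X \subset U -> Y \subset U -> tight g A s t 4 X -> tight g A s t 4 Y ->
  X :&: C = Y :&: C -> X = Y.
Proof.
move=> sX sY tX tY hC; have [//|ne] := eqVneq X Y; exfalso.
pose P (p : {set V} * {set V}) := [&& p.2 \subset U, p.1 \proper p.2, tight g A s t 4 p.1,
  tight g A s t 4 p.2 & p.1 :&: C == p.2 :&: C].
have P0 : P (X :&: Y, X :|: Y).
  rewrite /P /= subUset sX sY (tightI separating_ge4) // (tightU separating_ge4) //= andbC.
  apply/andP; split.
    apply/eqP/setP => z; have := congr1 (fun S : {set V} => z \in S) hC; rewrite !in_setI !in_setU.
    by case: (z \in X); case: (z \in Y) => //= <-.
  rewrite properEneq; apply/andP; split; last by apply: subset_trans (subsetIl _ _) (subsetUl _ _).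
  apply: contraNneq ne => q; rewrite eqEsubset; apply/andP; split.
    by apply: subset_trans (subsetUl X Y) _; rewrite -q subsetIr.
  by apply: subset_trans (subsetUr X Y) _; rewrite -q subsetIl.
case: (@arg_minnP _ _ P (fun p => #|p.2 :\: p.1|) P0) => [[I J] /and5P[/= sJ pIJ tI tJ /eqP hIJ] mn].
have sIJ := proper_sub pIJ; have [fI dI] := strands_tight tI; have [fJ dJ] := strands_tight tJ.
case/and3P: (tI) => sI tnI _; case/and3P: (tJ) => sJ' tnJ _.
have noc z : z \in J :\: I -> z \notin C.
  by rewrite in_setD => /andP[zI zJ]; apply: contraNN zI => zC; rewrite (setI_eq_mem hIJ zC).
have sJI : J :\: I \subset U by apply: subset_trans (subsetDl _ _) sJ.
apply: (no_thin_layer sO MMp0 y0E maxR sJI) => //.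
- by rewrite setD_eq0; case/properP: pIJ => _ [z zJ zI]; apply/negP => /subsetP /(_ _ zJ); apply/negP.
- by rewrite in_setD sI.
- by rewrite in_setD (negbTE tnJ) andbF.
- by have := dg_posimod g (A :\ eps :\: set0 :\: Th) J I; rewrite fI fJ; nlia.
- by move=> e; rewrite inE.
- move=> e eT; apply/negP => /andP[e1 e2].
  have := subsetP (Theta_sub maxR) e eT; rewrite !inE => /and3P[_ ne' eA].
  have [Z [sZ ce [tZ|[dZ sZ' tZ']]]] := edge_in_small_cut eA ne'.
    (* Uncrossing makes this a tight set strictly between I and J with the same visited marks,
       against the minimality of the layer. *)
    pose Z' := (Z :|: I) :&: J.
    have tZ' : tight g A s t 4 Z' by apply: (tightI separating_ge4) => //; apply: (tightU separating_ge4).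
    have sIZ : I \subset Z' by rewrite subsetI subsetUr.
    have sZJ : Z' \subset J by apply: subsetIr.
    have cZ : cr g e Z'.
      rewrite (@cr_eq V E g e Z' Z) // in_setI in_setU; [move: e1 | move: e2];
        by rewrite in_setD => /andP[/negPf-> ->]; rewrite orbF andbT.
    have hZ : I :&: C = Z' :&: C.
      apply/eqP; rewrite eqEsubset setSI //= hIJ setSI //.
    have PZ : P (I, Z').
      rewrite /P /= (subset_trans sZJ sJ) tI tZ' hZ eqxx !andbT properEneq sIZ andbT.
      apply: contraTneq cZ => <-; move: e1 e2; rewrite /cr !in_setD => /andP[/negPf-> _] /andP[/negPf-> _]; by [].
    have := mn _ PZ; rewrite leqNgt /=; apply/negP/negPn; apply: proper_card; apply/properP; split.
      exact: setSD.
    move: cZ; rewrite /cr; case z1: (_ \in Z'); case z2: (_ \in Z') => // _.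
      by exists (g e).2 => //; rewrite in_setD z2 andbF.
    by exists (g e).1 => //; rewrite in_setD z1 andbF.
  (* Uncrossing first with J and then with I trims the 2-cut to a 2-cut inside the layer, where
     [cut_marked] finds a visited mark. *)
  pose Z1 := Z :&: J; pose Z2 := Z1 :\: I.
  have cZ : cr g e Z2.
    rewrite (@cr_eq V E g e Z2 Z) // in_setD in_setI; [move: e1 | move: e2];
      by rewrite in_setD => /andP[-> ->]; rewrite andbT.
  have sZ2 : Z2 \subset J :\: I by apply: setSD; apply: subsetIr.
  have Z20 : Z2 != set0 by apply: contraTneq cZ => ->; rewrite /cr !inE.
  have sZ2' : s \notin Z2 by rewrite in_setD sI.
  have tZ2' : t \notin Z2 by rewrite in_setD in_setI (negbTE tZ') andbF.
  have ge2 : 2 <= dg g A Z2 by apply: cut_ge2 => //; apply: subset_trans sZ2 sJI.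
  have dZ2 : dg g A Z2 = 2.
    case/and3P: (tI) => _ _ /eqP d1; case/and3P: (tJ) => _ _ /eqP d2.
    have := dg_submod g A Z J; have := dg_posimod g A Z1 I.
    have := @separating_ge4 (Z :|: J); rewrite !in_setU sJ' (negbTE tZ') (negbTE tnJ) orbT => /(_ isT isT).
    have := @separating_ge4 (I :\: Z1); rewrite !in_setD !in_setI sI (negbTE sZ') (negbTE tnI) andbF => /(_ isT isT).
    by rewrite -/Z1 -/Z2 d1 d2 dZ; move: ge2; nlia.
  have [z zZ zC] := cut_marked sO aO MMp0 (sub0set _) y0E maxR (subset_trans sZ2 sJI) sZ2' tZ2' dZ2 eT cZ.
  by have := noc z (subsetP sZ2 _ zZ); rewrite zC.
- have := dg_posimod g Th J I; move: dI dJ; nlia.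
Qed.

(** The edges other than [eps] in tight s-t cuts. Their number is bounded by the marks visited, so
    their ends can be counted as additional marks in the search for a closed trail. *)
Definition small_sep : {set E} :=
  [set e in A :\ eps | [exists X : {set V}, [&& X \subset U, tight g A s t 4 X & cr g e X]]].

Lemma card_small_sep : #|small_sep| <= 2 ^ #|C| * 4.
Proof.
pose T := [set X : {set V} | (X \subset U) && tight g A s t 4 X].
have cT : #|T| <= 2 ^ #|C|.
  rewrite -card_powerset -(card_in_imset (f := fun X => X :&: C)).
    by apply: subset_leq_card; apply/subsetP => Y /imsetP[X _ ->]; rewrite powersetE subsetIr.
  by move=> X Y; rewrite !inE => /andP[a b] /andP[c d]; apply: tight_trace_inj.
apply: leq_trans (_ : #|\bigcup_(X in T) [set e in A | cr g e X]| <= _).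
  apply: subset_leq_card; apply/subsetP => e; rewrite !inE => /andP[/andP[_ eA] /existsP[X /and3P[a b c]]].
  by apply/bigcupP; exists X; rewrite !inE ?a ?eA.
apply: leq_trans (_ : #|T| * 4 <= _); last by rewrite leq_mul2r cT orbT.
apply: card_bigcup_bound => X; rewrite inE => /andP[_ /and3P[_ _ /eqP <-]].
by rewrite card_cr.
Qed.
End Strands.

(** * A closed trail through a prescribed vertex, disjoint from one strand *)

Section SecondTrail.
Variables (R : {ffun 'I_3 -> {set E}}) (d0 : V).
Hypotheses (valR : valid set0 t set0 R) (d0U : d0 \in U) (d0s : d0 != s).
Notation F := (A :\ eps :\: Theta R).

Let ThA : Theta R \subset A :\ eps.
Proof. by case: valR => _ h _ _; apply/bigcupsP => i _; apply: subset_trans (h i) (subsetDl _ _). Qed.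

(** If [X] contained t, the two other strands would both cross it. So t is outside, every strand
    crosses [X] an even number of times, and one crossing at most once does not meet [X] at all. *)
Lemma cut_through_strand k X : d0 \in X -> s \notin X -> dg g (A :\ eps :\: R k) X <= 1 ->
  [/\ t \notin X, dg g F X <= 1 & forall j, j != k -> [disjoint vts g (R j) & X]].
Proof.
case: valR => h1 h2 h3 _ dX sX d1.
have RkA : R k \subset A :\ eps by apply: subset_trans (h2 k) (subsetDl _ _).
have e1 := dgDS g X RkA; have e2 := dgDS g X ThA.
rewrite dg_bigcup // (bigD1 k) //= in e2.
have {e1 e2} e3 : dg g (A :\ eps :\: R k) X = \sum_(i < 3 | i != k) dg g (R i) X + dg g F X.
  exact: addnI (etrans (esym e1) (etrans e2 (esym (addnA _ _ _)))).
have [tX|tX] := boolP (t \in X).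
  have : 2 <= \sum_(i < 3 | i != k) dg g (R i) X.
    apply: leq_trans (_ : \sum_(i < 3 | i != k) 1 <= _).
      by apply: eq_leq; have := cardC1 k; rewrite card_ord -sum1_card /= => /esym.
    apply: leq_sum => i _; by rewrite odd_gt0 // (parity_cut X (h1 i).1) tX (negbTE sX).
  by move=> h; exfalso; move: h d1 e3; nlia.
split=> // [|j jk]; first by move: d1 e3; nlia.
apply: (dg_anchored (h1 j).2 sX).
have : dg g (R j) X <= 1.
  by apply: leq_trans d1; rewrite e3 (bigD1 j) //= -addnA leq_addr.
by have := parity_cut X (h1 j).1; rewrite (negbTE sX) (negbTE tX); case: (dg g (R j) X) => [|[|]].
Qed.

(* Given a violating set X k for every k, the intersection of any two avoids all strands, so
   an F-edge crossing one of them lies inside the other two. Hence the part of X 0 and X 1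
   outside X 2 is crossed by a single edge. *)
Lemma strand_to_spare : exists k, forall X, d0 \in X -> s \notin X -> 2 <= dg g (A :\ eps :\: R k) X.
Proof.
case: (valR) => h1 h2 h3 _.
have [/existsP[k /forallP hk]|/existsPn no] := boolP [exists k, [forall X : {set V},
   [&& d0 \in X & s \notin X] ==> (2 <= dg g (A :\ eps :\: R k) X)]].
  by exists k => X a b; have := hk X; rewrite a b.
have /fin_all_exists[X hX] : forall k, exists X : {set V}, [/\ d0 \in X, s \notin X & dg g (A :\ eps :\: R k) X <= 1].
  move=> k; have := no k; rewrite negb_forall => /existsP[X]; rewrite negb_imply -ltnNge => /andP[/andP[a b] c].
  by exists X.
exfalso.
have d0X k : d0 \in X k by case: (hX k).
have cX k : [/\ t \notin X k, dg g F (X k) <= 1 & forall j, j != k -> [disjoint vts g (R j) & X k]].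
  by case: (hX k); apply: cut_through_strand.
have sX k : s \notin X k by case: (hX k).
have tX k : t \notin X k by case: (cX k).
have dF k : dg g F (X k) <= 1 by case: (cX k).
have dis k j : j != k -> [disjoint vts g (R j) & X k] by case: (cX k) => _ _; apply.
have FA : F \subset A by apply: subset_trans (subsetDl _ _) (subsetDl _ _).
have only i j Z : i != j -> Z \subset X i -> Z \subset X j -> dg g A Z = dg g F Z.
  move=> ij si sj; rewrite (dgD1 _ _ epsA) (dgDS _ _ ThA) dg_bigcup //.
  have nZ z : z \notin X i -> z \in Z = false by move=> h; apply: contraNF h => /(subsetP si).
  rewrite (joins_cr _ eps_st) !nZ // big1 // => l _.
  have dl : [disjoint vts g (R l) & Z].
    have [li|li] := eqVneq l i; last by apply: disjointWr (dis _ _ li).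
    by apply: disjointWr sj _; apply: dis; rewrite li.
  apply/eqP; rewrite -leqn0 leqNgt; apply/negP => /dg_gt0P[e el ce].
  have [z [_ [_ zZ _ zl _]]] := cr_vts el ce; by rewrite (disjointFr dl zl) in zZ.
have ge2 Z z : z \in Z -> z \in U -> s \notin Z -> 2 <= dg g A Z.
  move=> zZ zU sZ; rewrite (dgI_supp Z sp); apply: cut_ge2; first exact: subsetIr.
    by apply/set0Pn; exists z; rewrite inE zZ.
  by rewrite inE (negbTE sZ).
have uniqF i e f : e \in F -> f \in F -> cr g e (X i) -> cr g f (X i) -> e = f.
  move=> eF fF ce cf; apply/eqP; apply: contraTT cf => ef.
  have := dF i; rewrite (dgD1 _ _ eF) ce => h.
  have h0 : dg g (F :\ e) (X i) = 0 by move: h; nlia.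
  by rewrite (dg_eq0 h0) // in_setD1 eq_sym ef.
have dI i j : i != j -> 2 <= dg g F (X i :&: X j).
  move=> ij; rewrite -(only i j) ?subsetIl ?subsetIr //; apply: (ge2 _ d0); rewrite // inE ?d0X //.
  by rewrite (negbTE (sX i)).
have crI i j e : cr g e (X i :&: X j) -> cr g e (X i) || cr g e (X j).
  by rewrite /cr !in_setI; do 4 case: (_ \in X _).
have le1 i W : (forall e, e \in F -> cr g e W -> cr g e (X i)) -> dg g F W <= 1.
  by move=> h; apply: leq_trans (dF i); apply: leq_sum => e eF; have := h e eF; case: cr => // ->.
have both i j f : i != j -> f \in F -> cr g f (X i) -> ((g f).1 \in X j) && ((g f).2 \in X j).
  move=> ij fF cf; have [cj|cj] := boolP (cr g f (X j)).
    have : dg g F (X i :&: X j) <= 1; last by move=> h; have := leq_trans (dI _ _ ij) h.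
    apply: (le1 i) => e eF /crI /orP[//|ce]; by rewrite (uniqF j e f).
  move: cj; rewrite /cr; case c1: (_ \in X j); case c2: (_ \in X j) => // _.
  have : dg g F (X i :&: X j) <= 1; last by move=> h; have := leq_trans (dI _ _ ij) h.
  apply: (le1 j) => e eF ce; have := crI _ _ _ ce; case/orP=> // ci.
  by move: ce; rewrite (uniqF i e f) // /cr !in_setI c1 c2 !andbF.
pose i0 : 'I_3 := inord 0; pose i1 : 'I_3 := inord 1; pose i2 : 'I_3 := inord 2.
have n01 : i0 != i1 by rewrite -val_eqE /= !inordK.
have n02 : i0 != i2 by rewrite -val_eqE /= !inordK.
have n12 : i1 != i2 by rewrite -val_eqE /= !inordK.
pose W := X i0 :&: X i1 :\: X i2.
have dW : dg g F W <= 1.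
  apply: (le1 i2) => e eF ce.
  have : [|| cr g e (X i0), cr g e (X i1) | cr g e (X i2)].
    move: ce; rewrite /cr !in_setD !in_setI; do 6 case: (_ \in X _); by [].
  case/or3P=> // c.
    have /andP[a b] := both _ _ _ n02 eF c; by move: ce; rewrite /cr !in_setD a b.
  have /andP[a b] := both _ _ _ n12 eF c; by move: ce; rewrite /cr !in_setD a b.
(* Both ends of this edge lie in the other two sets, so its end outside [X i2] is a vertex of
   [W]. *)
have /dg_gt0P[f fF cf] : 0 < dg g F (X i2).
  rewrite lt0n; apply/eqP => q.
  have : dg g F (X i0 :&: X i2) <= 1; last by move=> h; have := leq_trans (dI _ _ n02) h.
  apply: (le1 i0) => e eF /crI /orP[//|]; by rewrite (dg_eq0 q eF).
have n20 : i2 != i0 by rewrite eq_sym.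
have n21 : i2 != i1 by rewrite eq_sym.
have /andP[a0 b0] := both _ _ _ n20 fF cf; have /andP[a1 b1] := both _ _ _ n21 fF cf.
have /andP[aU bU] := sp (subsetP FA _ fF).
have [z zW zU] : exists2 z, z \in W & z \in U.
  move: cf; rewrite /cr; case c1: (_ \in X i2); case c2: (_ \in X i2) => // _.
    by exists (g f).2 => //; rewrite in_setD in_setI c2 b0 b1.
  by exists (g f).1 => //; rewrite in_setD in_setI c1 a0 a1.
have sW : s \notin W by rewrite in_setD in_setI (negbTE (sX i0)) andbF.
have := ge2 W z zW zU sW; rewrite (only i0 i1) // ?(subset_trans (subsetDl _ _)) ?subsetIl ?subsetIr //.
by move=> h; have := leq_trans h dW.
Qed.

(** Menger gives two edge-disjoint paths between [d0] and s outside the spared strand; together they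
    form the closed trail. *)
Lemma second_trail : exists k (K : {set E}), [/\ K \subset A :\ eps :\: R k, trail_set g K s s & d0 \in vts g K].
Proof.
have [k hk] := strand_to_spare; have [f [fs fd fc]] := menger d0s hk.
have /fin_all_exists[p hp] : forall i, exists p, is_path g d0 p s /\ eset p \subset f i.
  by move=> i; apply: conn_path.
have tp i := trail_trail_set (path_trail (hp i).1).
exists k, (eset (p ord0) :|: eset (p ord_max)); split.
- by rewrite subUset !(subset_trans (hp _).2).
- apply: trail_set_cat (trail_set_sym (tp _)) (tp _).
  by apply: disjointWl (hp _).2 _; apply: disjointWr (hp _).2 _; apply: fd.
- rewrite vtsU in_setU; apply/orP; left.
  by apply: conn_vts (trail_set_conn (trail_set_sym (tp _))) _; rewrite eq_sym.
Qed.
End SecondTrail.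

(** * The 2-cuts crossed by a maximal closed trail *)

Section Closed.
Variables (O : {set E}) (d0 : V) (Mp : {set V}) (R : {ffun 'I_1 -> {set E}}).
Hypotheses (sO : O \subset A :\ eps) (aO : anchored g O s) (MMp : M \subset Mp) (d0Mp : d0 \in Mp).
Hypothesis sepMp : forall e, e \in small_sep -> (g e).1 \in Mp.
Hypothesis maxR : maximal O s Mp [set d0] R.
Notation Th := (Theta R).
Notation C := (Mp :&: vts g (Theta R)).

Let DMp : [set d0] \subset Mp. Proof. by rewrite sub1set. Qed.
Let y0E : s \in [set s; t]. Proof. by rewrite !inE eqxx. Qed.

Definition two_cut X := [&& X \subset U, s \notin X, t \notin X & dg g A X == 2].
Definition crossed X := two_cut X && (0 < dg g Th X).

(** The trail starts at s outside [X] and can reach z only through the cut. Thus uncrossed sets that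
    still contain a visited mark are crossed again. *)
Lemma crossed_if X z : two_cut X -> z \in X -> z \in C -> crossed X.
Proof.
move=> tX zX; rewrite inE => /andP[_ /vts_bigcup[i zi]]; rewrite /crossed tX lt0n.
apply/eqP => d0X; case: maxR => -[/(_ i) [_ ai] _ _ _] _; case/and4P: tX => _ sX _ _.
have : dg g (R i) X <= dg g Th X by apply: dgS; apply: bigcup_sup.
rewrite d0X leqn0 => /eqP dRi.
by have := disjointFr (dg_anchored ai sX dRi) zi; rewrite zX.
Qed.

(** Intersection and union are nonempty and avoid s, so each needs two edges, and submodularity
    leaves no more. *)
Lemma two_cutIU X Y z : two_cut X -> two_cut Y -> z \in X -> z \in Y ->
  two_cut (X :&: Y) /\ two_cut (X :|: Y).
Proof.
move=> /and4P[sX nX tX /eqP dX] /and4P[sY nY tY /eqP dY] zX zY.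
have sI : X :&: Y \subset U by apply: subset_trans (subsetIl _ _) sX.
have sU : X :|: Y \subset U by rewrite subUset sX.
have nI : s \notin X :&: Y by rewrite inE (negbTE nX).
have nU : s \notin X :|: Y by rewrite inE (negbTE nX).
have I0 : X :&: Y != set0 by apply/set0Pn; exists z; rewrite inE zX.
have U0 : X :|: Y != set0 by apply/set0Pn; exists z; rewrite inE zX.
have := cut_ge2 sI I0 nI; have := cut_ge2 sU U0 nU; have := dg_submod g A X Y.
rewrite dX dY => h1 h2 h3; rewrite /two_cut sI sU nI nU !inE (negbTE tX) (negbTE tY) /=.
by split; apply/eqP; move: h1 h2 h3; nlia.
Qed.

Lemma crossed_marked X : crossed X -> exists2 z, z \in X & z \in C.
Proof.
case/andP=> /and4P[sX nX tX /eqP dX] /dg_gt0P[e eT ce].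
exact: (cut_marked sO aO MMp DMp y0E maxR sX nX tX dX eT ce).
Qed.

(** By parity the trail crosses [X] twice and so uses up the 2-cut. *)
Lemma crossed_only X : crossed X ->
  [/\ dg g (A :\ eps :\: O :\: Th) X = 0, dg g O X = 0 & dg g Th X <= 2].
Proof.
case/andP=> /and4P[sX nX tX /eqP dX] d0'.
have := dg_parts sO maxR X; have := Theta_parity y0E maxR nX tX.
move: d0'; rewrite dX; case: (dg g Th X) => [|[|n]] //= _ _ h.
by split; move: h; nlia.
Qed.

(** The layer argument again, between nested crossed 2-cuts with the same visited marks and smallest
    difference. A trail edge inside the layer that belongs to a tight s-t cut would have a visited
    end in [Mp]; this is why such ends were added to the marks. *)
Lemma crossed_trace_inj X Y : crossed X -> crossed Y -> X :&: C = Y :&: C -> X = Y.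
Proof.
move=> kX kY hC; have [//|ne] := eqVneq X Y; exfalso.
pose P (p : {set V} * {set V}) := [&& p.1 \proper p.2, crossed p.1, crossed p.2 & p.1 :&: C == p.2 :&: C].
have P0 : P (X :&: Y, X :|: Y).
  have [z zX zC] := crossed_marked kX; have zY : z \in Y by rewrite -(setI_eq_mem hC zC).
  have [cI cU] := two_cutIU (proj1 (andP kX)) (proj1 (andP kY)) zX zY.
  rewrite /P /= (crossed_if (z := z) cI) ?(crossed_if (z := z) cU) ?in_setI ?in_setU ?zX ?zY -?in_setI //=.
  apply/andP; split; last first.
    by rewrite setIUl -hC setUid setIAC hC setIAC setIid -hC.
  rewrite properEneq; apply/andP; split; last by apply: subset_trans (subsetIl _ _) (subsetUl _ _).
  apply: contraNneq ne => q; rewrite eqEsubset; apply/andP; split.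
    by apply: subset_trans (subsetUl X Y) _; rewrite -q subsetIr.
  by apply: subset_trans (subsetUr X Y) _; rewrite -q subsetIl.
case: (@arg_minnP _ _ P (fun p => #|p.2 :\: p.1|) P0) => [[I J] /and4P[/= pIJ kI kJ /eqP hIJ] mn].
have sIJ := proper_sub pIJ; have [fI oI dI] := crossed_only kI; have [fJ oJ dJ] := crossed_only kJ.
case/andP: (kI) => tcI _; case/andP: (kJ) => tcJ _.
case/and4P: (tcI) => sI nI tI /eqP dAI; case/and4P: (tcJ) => sJ nJ tJ /eqP dAJ.
have noc z : z \in J :\: I -> z \notin C.
  by rewrite in_setD => /andP[zI zJ]; apply: contraNN zI => zC; rewrite (setI_eq_mem hIJ zC).
have sJI : J :\: I \subset U by apply: subset_trans (subsetDl _ _) sJ.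
have [c cI cC] := crossed_marked kI.
have OA : O \subset A by apply: subset_trans sO (subsetDl _ _).
apply: (no_thin_layer sO MMp y0E maxR sJI) => //.
- by rewrite setD_eq0; case/properP: pIJ => _ [z zJ zI]; apply/negP => /subsetP /(_ _ zJ); apply/negP.
- by rewrite in_setD (negbTE nJ) andbF.
- by rewrite in_setD (negbTE tJ) andbF.
- by have := dg_posimod g (A :\ eps :\: O :\: Th) J I; rewrite fI fJ; nlia.
- move=> e eO; have := anchored_avoids OA aO nJ oJ eO; rewrite !in_set !negb_or.
  by case/andP=> /negPf-> /negPf->; rewrite !andbF.
- move=> e eT; apply/negP => /andP[e1 e2].
  have := subsetP (Theta_sub maxR) e eT; rewrite 2!in_setD in_set1 => /andP[_ /andP[ne' eA]].
  have [e1I e1J] : (g e).1 \notin I /\ (g e).1 \in J by move: e1; rewrite in_setD => /andP[].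
  have [e2I e2J] : (g e).2 \notin I /\ (g e).2 \in J by move: e2; rewrite in_setD => /andP[].
  have [Z [sZ ce [tZ|[dZ sZ' tZ']]]] := edge_in_small_cut eA ne'.
    have := noc _ e1; rewrite inE sepMp /=; last first.
      by rewrite inE in_setD1 ne' eA /=; apply/existsP; exists Z; rewrite sZ tZ.
    by have /andP[-> _] := vts_edge eT (lf eA).
  have tcZ : two_cut Z by rewrite /two_cut sZ sZ' tZ' dZ.
  (* If Z meets I, uncrossing gives a crossed 2-cut strictly between I and J. If not, Z within J is
     a 2-cut crossed by e, so it holds a visited mark in J outside I. *)
  have [/set0Pn[w]|/negbNE/eqP disj] := boolP (Z :&: I != set0).
    rewrite inE => /andP[wZ wI]; have [_ tcU] := two_cutIU tcZ tcI wZ wI.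
    have cU : c \in Z :|: I by rewrite in_setU cI orbT.
    have [tcZ' _] := two_cutIU tcU tcJ cU (subsetP sIJ _ cI).
    pose Z' := (Z :|: I) :&: J.
    have sIZ : I \subset Z' by rewrite subsetI subsetUr.
    have sZJ : Z' \subset J by apply: subsetIr.
    have cZ : cr g e Z'.
      by rewrite (@cr_eq V E g e Z' Z) // in_setI in_setU (negbTE e1I, negbTE e2I) ?e1J ?e2J ?orbF ?andbT //
        (negbTE e2I) orbF.
    have hZ : I :&: C = Z' :&: C.
      apply/eqP; rewrite eqEsubset setSI //= hIJ setSI //.
    have PZ : P (I, Z').
      rewrite /P /= kI (crossed_if tcZ' (subsetP sIZ _ cI) cC) hZ eqxx !andbT properEneq sIZ andbT.
      by apply: contraTneq cZ => <-; rewrite /cr (negbTE e1I) (negbTE e2I).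
    have := mn _ PZ; rewrite leqNgt /=; apply/negP/negPn; apply: proper_card; apply/properP; split.
      exact: setSD.
    move: cZ; rewrite /cr; case z1: (_ \in Z'); case z2: (_ \in Z') => // _.
      by exists (g e).2 => //; rewrite in_setD z2 andbF.
    by exists (g e).1 => //; rewrite in_setD z1 andbF.
  have cZJ : cr g e (Z :&: J).
    by rewrite (@cr_eq V E g e _ Z) // in_setI ?e1J ?e2J andbT.
  have [w wZ wJ] : exists2 w, w \in Z & w \in J.
    have : Z :&: J != set0 by apply: contraTneq cZJ => ->; rewrite /cr !inE.
    by case/set0Pn=> w; rewrite inE => /andP[]; exists w.
  have [/and4P[a1 a2 a3 /eqP a4] _] := two_cutIU tcZ tcJ wZ wJ.
  have [z] := cut_marked sO aO MMp DMp y0E maxR a1 a2 a3 a4 eT cZJ.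
  rewrite in_setI => /andP[zZ zJ] zC; have := noc z; rewrite zC in_setD zJ andbT => h.
  have zI : z \in I by apply: contraT => /h.
  by have : z \in Z :&: I; [rewrite in_setI zZ | rewrite disj inE].
- have := dg_posimod g Th J I; move: dI dJ; nlia.
Qed.

(** Each trail edge lies in a tight s-t cut or in a crossed 2-cut, and a crossed 2-cut is determined
    by the visited marks it contains. *)
Lemma card_closed_trail : #|Th| <= #|small_sep| + 2 ^ #|C| * 2.
Proof.
pose T := [set X : {set V} | crossed X].
have cT : #|T| <= 2 ^ #|C|.
  rewrite -card_powerset -(card_in_imset (f := fun X => X :&: C)).
    by apply: subset_leq_card; apply/subsetP => Y /imsetP[X _ ->]; rewrite powersetE subsetIr.
  by move=> X Y; rewrite !inE; apply: crossed_trace_inj.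
apply: leq_trans (_ : #|small_sep :|: \bigcup_(X in T) [set e in A | cr g e X]| <= _).
  apply: subset_leq_card; apply/subsetP => e eT.
  have := subsetP (Theta_sub maxR) e eT; rewrite 2!in_setD in_set1 => /andP[_ /andP[ne' eA]].
  have [Z [sZ ce [tZ|[dZ sZ' tZ']]]] := edge_in_small_cut eA ne'; rewrite in_setU; apply/orP; [left|right].
    by rewrite inE in_setD1 ne' eA /=; apply/existsP; exists Z; rewrite sZ tZ.
  apply/bigcupP; exists Z; last by rewrite inE eA.
  rewrite inE /crossed /two_cut sZ sZ' tZ' dZ /=; by apply/dg_gt0P; exists e.
apply: leq_trans (leq_card_setU _ _) _; rewrite leq_add2l.
apply: leq_trans (_ : #|T| * 2 <= _); last by rewrite leq_mul2r cT orbT.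
apply: card_bigcup_bound => X; rewrite inE => /andP[/and4P[_ _ _ /eqP <-] _].
by rewrite card_cr.
Qed.
End Closed.
End System.

(** ** A trail and a disjoint closed trail through many marks *)

Section Balls.
Variables (V E : finType) (g : E -> V * V) (A : {set E}) (k : nat).
Hypotheses (lf : loopfree g A) (deg : forall v, dg g A [set v] <= k).

Fixpoint ball n (x : V) : {set V} :=
  if n is n'.+1 then x |: \bigcup_(y in [set y | adj g A x y]) ball n' y else [set x].

Lemma card_ball n x : #|ball n x| <= k.+1 ^ n.
Proof.
elim: n x => [|n IH] x /=; first by rewrite cards1.
have nb : #|[set y | adj g A x y]| <= k.
  apply: leq_trans (deg x); rewrite -card_cr.
  pose oth e := if (g e).1 == x then (g e).2 else (g e).1.
  apply: leq_trans (leq_imset_card oth _); apply: subset_leq_card; apply/subsetP => y; rewrite inE.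
  case/exists_inP=> e eA j; apply/imsetP; exists e.
    have := lf eA; rewrite inE eA (joins_cr1 _ j) eqxx /=.
    by case/orP: j => /eqP -> /=; rewrite // eq_sym.
  have := lf eA; rewrite /oth; case/orP: j => /eqP -> /=; first by rewrite eqxx.
  by case: eqP.
apply: leq_trans (leq_card_setU _ _) _; rewrite cards1 expnS mulSn; apply: leq_add.
  by rewrite expn_gt0.
by apply: leq_trans (card_bigcup_bound (k := k.+1 ^ n) _) _ => [y _|]; rewrite ?leq_mul2r ?nb ?orbT.
Qed.

Lemma walk_ball n x p y : is_walk g x p y -> eset p \subset A -> size p <= n -> y \in ball n x.
Proof.
elim: n x p => [|n IH] x [|[e z] p] //=; rewrite ?inE; first by move=> /eqP ->.
  by move=> /eqP ->; rewrite eqxx.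
case/andP=> j w; rewrite eset_cons subUset sub1set => /andP[eA sp] sz.
apply/orP; right; apply/bigcupP; exists z; last exact: IH w sp sz.
by rewrite inE; apply/exists_inP; exists e.
Qed.
End Balls.

Section ClosedTrail.
Variables (V E : finType).
Implicit Types (g : E -> V * V) (A B K Q : {set E}) (U M X Y Z : {set V}).

Lemma card_vts g B : #|vts g B| <= #|B| * 2.
Proof.
apply: leq_trans (card_bigcup_bound (P := B) (F := fun e => [set (g e).1; (g e).2]) (k := 2) _); last first.
  by move=> e _; rewrite cards2; case: eqP.
apply: subset_leq_card; apply/subsetP => v; rewrite in_vts => /dg_gt0P[e eB ce].
by apply/bigcupP; exists e => //; move: ce; rewrite /cr !inE ![_ == v]eq_sym; case: eqP; case: eqP.
Qed.

Lemma size_path g x p y : is_path g x p y -> size p = #|eset p|.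
Proof.
by move=> /path_uniq_edges u; rewrite cardsE (card_uniqP u) size_map.
Qed.

(** With at most 3N marks on the strands, [sep_bound] limits the edges of tight cuts. A closed trail
    with fewer than N marks then sees at most these, the far vertex and two ends of every such edge,
    which gives [trail_bound] for its length. [mark_bound] is the size of a ball of that radius at
    degrees up to six. *)
Definition sep_bound N := 2 ^ (3 * N) * 4.
Definition trail_bound N := sep_bound N + 2 ^ (N + 1 + sep_bound N * 2) * 2.
Definition mark_bound N := 7 ^ trail_bound N.

(** * The two trails in a reduced graph *)

Section ReducedCase.
Variables (g : E -> V * V) (A : {set E}) (U M : {set V}) (s t : V) (eps : E) (N : nat).
Hypotheses (lf : loopfree g A) (sp : supported g A U).
Hypotheses (sM : s \in M) (tM : t \in M) (MU : M \subset U) (fe : feasible g A U M s t) (st : s != t).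
Hypotheses (epsA : eps \in A) (eps_st : joins g eps s t).
Hypothesis degree_le5 : forall v, v \in U -> v \notin M -> dg g A [set v] <= 5.
Hypothesis degree_le6 : forall v, dg g A [set v] <= 6.
Hypothesis no_degree4 : forall v, v \in U -> v \notin M -> dg g A [set v] != 4.
Hypothesis undeletable : forall e, e \in A -> e \notin [set eps] -> ~ feasible g (A :\ e) U M s t.
Hypothesis largeM : mark_bound N < #|M|.

Lemma three_strands : exists R : {ffun 'I_3 -> {set E}}, maximal g A s eps set0 t M set0 R.
Proof.
have h3 X : s \in X -> t \notin X -> 3 <= dg g (A :\ eps) X.
  move=> sX tX; have := separates_ge4 sp sM tM MU fe sX tX.
  by rewrite (dgD1 _ _ epsA) (joins_cr _ eps_st) sX (negbTE tX).
have [f [fs fd fc]] := menger st h3.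
have /fin_all_exists[p hp] : forall i, exists p, is_path g s p t /\ eset p \subset f i.
  by move=> i; apply: conn_path.
have : valid g A s eps set0 t set0 [ffun i => eset (p i)].
  split=> [i|i|i j ij|]; rewrite ?ffunE ?sub0set //.
  - exact: trail_trail_set (path_trail (hp i).1).
  - by rewrite setD0; apply: subset_trans (hp i).2 (fs i).
  - by apply: disjointWl (hp i).2 _; apply: disjointWr (hp j).2 _; apply: fd.
by move=> /(maximal_exists M).
Qed.

(** Either one strand is rich in marks: it closes up with a second, and the third is [Q]. Or tight
    cuts are few, and [K] is taken through a vertex outside the ball of radius [trail_bound]; with
    fewer than N marks it would have too few edges to get there. *)
Lemma closed_trail_reduced : exists Q K, [/\ Q \subset A :\ eps, K \subset A :\ eps,
  [disjoint Q & K], trail_set g Q s t /\ trail_set g K s s & N <= #|M :&: vts g K|].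
Proof.
have [R maxR] := three_strands; have [[h1 h2 h3 _] _] := maxR.
have {}h2 i : R i \subset A :\ eps by apply: subset_trans (h2 i) (subsetDl _ _).
have [big|small] := ltnP (3 * N) #|M :&: vts g (Theta R)|.
  have [j hj] : exists j, N < #|M :&: vts g (R j)|.
    apply/existsP; apply: contraLR big => /existsPn no; rewrite -leqNgt.
    apply: leq_trans (_ : #|\bigcup_(j in setT) (M :&: vts g (R j))| <= _); last first.
      have := @card_bigcup_bound _ _ setT (fun j => M :&: vts g (R j)) N.
      by rewrite cardsT card_ord; apply=> j _; rewrite leqNgt.
    apply: subset_leq_card; apply/subsetP => v; rewrite inE => /andP[vM /vts_bigcup[j vj]].
    by apply/bigcupP; exists j; rewrite ?in_setT // in_setI vM.
  have [k [l /and3P[kj lj lk]]] : exists k l : 'I_3, [&& k != j, l != j & l != k].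
    case: (j) => [[|[|[|//]]] lt3]; [exists (inord 1), (inord 2) | exists (inord 0), (inord 2) | exists (inord 0), (inord 1)];
      by rewrite -!val_eqE /= !inordK.
  exists (R l), (R j :|: R k); split=> //.
  - by rewrite subUset !h2.
  - by rewrite -setI_eq0 setIUr setU_eq0 !setI_eq0 !h3.
  - split=> //; apply: trail_set_cat (h1 j) (trail_set_sym (h1 k)); by rewrite h3 // eq_sym.
  - apply: leq_trans (ltnW hj) _; apply: subset_leq_card; apply: setIS; apply: vtsS; exact: subsetUl.
have cS : #|small_sep g A U s t eps| <= sep_bound N.
  apply: leq_trans (card_small_sep lf sp sM tM MU fe epsA eps_st no_degree4 degree_le5 undeletable maxR) _.
  by rewrite leq_mul2r leq_exp2l // small orbT.
(* The ball is smaller than the set of marks, so it does not exhaust [U]. *)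
have [d0 d0U far] : exists2 d0, d0 \in U & d0 \notin ball g A (trail_bound N) s.
  apply/subsetPn; apply: contraTN largeM => /(subset_trans MU) /subset_leq_card le.
  by rewrite -leqNgt; apply: leq_trans le _; apply: card_ball.
have d0s : d0 != s.
  by apply: contraNneq far => ->; apply: (walk_ball (p := [::])) => //=; apply/subsetP => e; rewrite inE.
have [k [K0 [sK0 tK0 dK0]]] := second_trail sp sM MU fe epsA eps_st (proj1 maxR) d0U d0s.
pose O := R k; pose Mp := M :|: [set d0] :|: vts g (small_sep g A U s t eps).
have aO : anchored g O s by case: (h1 k).
have TE (R1 : {ffun 'I_1 -> {set E}}) : Theta R1 = R1 ord0 by rewrite /Theta big_ord1.
have val : @valid V E g A s eps O 1 s [set d0] [ffun=> K0 : {set E}].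
  split=> [i|i|i j|]; rewrite ?ffunE //; first by rewrite (ord1 i) (ord1 j) eqxx.
  by rewrite TE ffunE sub1set.
have [R1 maxR1] := maximal_exists Mp val.
have MMp : M \subset Mp by rewrite /Mp -setUA subsetUl.
have dMp : d0 \in Mp by rewrite !in_setU in_set1 eqxx orbT.
have sepMp e : e \in small_sep g A U s t eps -> (g e).1 \in Mp.
  move=> eS; rewrite in_setU; have eA : e \in A by move: eS; rewrite inE in_setD1 => /andP[/andP[]].
  by have /andP[-> _] := vts_edge eS (lf eA); rewrite orbT.
have cT := card_closed_trail lf sp sM tM MU fe epsA eps_st no_degree4 degree_le5 undeletable (h2 k) aO MMp dMp sepMp maxR1.
have [[k1 k2 _ k4] _] := maxR1; rewrite TE in cT k4.
exists O, (R1 ord0); split.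
- exact: h2.
- exact: subset_trans (k2 _) (subsetDl _ _).
- by have := k2 ord0; rewrite subsetD => /andP[_]; rewrite disjoint_sym.
- by split; [apply: h1 | apply: k1].
rewrite leqNgt; apply/negP => few.
have cC : #|Mp :&: vts g (R1 ord0)| <= N + 1 + sep_bound N * 2.
  apply: leq_trans (_ : #|(M :&: vts g (R1 ord0)) :|: [set d0] :|: vts g (small_sep g A U s t eps)| <= _).
    apply: subset_leq_card; apply/subsetP => v; rewrite in_setI !in_setU in_setI => /andP[/orP[/orP[->|->]|->] ->];
      by rewrite ?orbT.
  apply: leq_trans (leq_card_setU _ _) _; apply: leq_add.
    apply: leq_trans (leq_card_setU _ _) _; rewrite cards1 leq_add2r; exact: ltnW.
  by apply: leq_trans (card_vts _ _) _; rewrite leq_mul2r cS.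
have cK : #|R1 ord0| <= trail_bound N.
  by apply: leq_trans cT _; apply: leq_add => //; rewrite leq_mul2r leq_exp2l ?cC ?orbT.
have [p [pp sp1]] := conn_path (anchored_conn (k1 ord0).2 (subsetP k4 _ (set11 d0))).
case/negP: far; apply: walk_ball (proj1 (andP pp)) _ _.
  apply: subset_trans sp1 (subset_trans (k2 _) (subset_trans (subsetDl _ _) (subsetDl _ _))).
by rewrite (size_path pp); apply: leq_trans (subset_leq_card sp1) cK.
Qed.
End ReducedCase.

(** Reduction by deleting edges and splitting off at degree four. Neither touches [eps] or a mark,
    so lifting back keeps the marks on [K]. *)
Lemma closed_trail_exists N g A U M s t eps : loopfree g A -> supported g A U ->
  s \in M -> t \in M -> M \subset U -> s != t -> feasible g A U M s t ->
  eps \in A -> joins g eps s t ->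
  (forall v, v \in U -> v \notin M -> dg g A [set v] <= 5) ->
  (forall v, dg g A [set v] <= 6) -> mark_bound N < #|M| ->
  exists Q K, [/\ Q \subset A :\ eps, K \subset A :\ eps,
    [disjoint Q & K], trail_set g Q s t /\ trail_set g K s s & N <= #|M :&: vts g K|].
Proof.
have [n] := ubnP #|A|; elim: n g A U => // n IH g A U ltn lf sp sM tM MU st fe eA je d5 d6 lM.
have [/exists_inP[e eA' /feasibleP fe']|/exists_inPn nodel] := boolP [exists e in A :\ eps,
  [forall X : {set V}, [&& X \subset U, X != set0 & X != U] ==>
     ((if four M s t X then 4 else 2) <= dg g (A :\ e) X)]].
  move: eA'; rewrite in_setD1 => /andP[ne eA'].
  have sA : A :\ e \subset A by apply: subsetDl.
  have [||||||Q [K [h1 h2 h3 h4 h5]]] := IH g (A :\ e) U _ _ _ sM tM MU st fe' _ je _ _ lM.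
  - by move: ltn; rewrite [#|A|](cardsD1 e) eA'.
  - by move=> f /(subsetP sA)/lf.
  - by move=> f /(subsetP sA)/sp.
  - by rewrite in_setD1 eq_sym ne.
  - by move=> v vU vM; apply: leq_trans (dgS _ _ sA) (d5 v vU vM).
  - by move=> v; apply: leq_trans (dgS _ _ sA) (d6 v).
  by exists Q, K; split=> //; [apply: subset_trans h1 _ | apply: subset_trans h2 _]; apply: setSD.
have [/exists_inP[v vU /andP[vM /eqP dv]]|/exists_inPn no4] := boolP [exists v in U,
  (v \notin M) && (dg g A [set v] == 4)].
  have [g' [A' [[L lL] ltA [lf' sp'] [fe' le'] keep]]] := split_off_four lf sp sM tM MU vU vM fe dv.
  have [eA' ge] : eps \in A' /\ g' eps = g eps.
    have vMF x : x \in M -> (v == x) = false by move=> xM; apply: contraNF vM => /eqP->.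
    by apply: keep => //; rewrite (joins_cr1 _ je) !vMF.
  have je' : joins g' eps s t by rewrite /joins ge.
  have MUv : M \subset U :\ v.
    by apply/subsetP => z zM; rewrite !inE (subsetP MU) // andbT; apply: contraNneq vM => <-.
  have [|||Q [K [h1 h2 h3 [h4 h4'] h5]]] := IH g' A' _ _ lf' sp' sM tM MUv st fe' eA' je' _ _ lM.
  - exact: leq_trans ltA _.
  - by move=> w; rewrite !inE => /andP[_ wU] wM; apply: leq_trans (le' _) (d5 w wU wM).
  - by move=> w; apply: leq_trans (le' _) (d6 w).
  have sA' B : B \subset A' :\ eps -> B \subset A' by move=> h; apply: subset_trans h (subsetDl _ _).
  case: (lL) => l1 l2 _ _.
  have sL B : B \subset A' :\ eps -> L B \subset A :\ eps.
    move=> sB; rewrite subsetD1 (l1 _ (sA' _ sB)).1 /=.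
    (* The lift of [eps] contains [eps] itself, so disjointness keeps it out of the other lifted
       sets. *)
    have s1 : [set eps] \subset A' by rewrite sub1set.
    have := l2 _ _ s1 (sA' _ sB) _; rewrite disjoints1 => h.
    have eL : eps \in L [set eps] by apply: (subsetP (l1 _ s1).2); rewrite inE.
    rewrite (disjointFr (h _) eL) //; by move: sB; rewrite subsetD1 => /andP[].
  exists (L Q), (L K); split; [exact: sL | exact: sL | | |].
  - by apply: l2; rewrite ?sA'.
  - by split; apply: (lift_trail_set lL) => //; apply: sA'.
  - by apply: leq_trans h5 _; apply: subset_leq_card; apply: setIS; apply: (lift_vts lL); apply: sA'.
apply: (@closed_trail_reduced g A U M s t eps N) => //.
- by move=> v vU vM; have := no4 v vU; rewrite vM.
- move=> e eA'; rewrite inE => ne /feasibleP; apply/negP; apply: nodel; by rewrite in_setD1 ne.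
Qed.
End ClosedTrail.

(** ** Eulerian trails and cyclic arrangements *)

Section Euler.
Variables (V E : finType).
Implicit Types (g : E -> V * V) (A B K : {set E}) (X Y : {set V}) (p q : seq (E * V)).

Lemma split_at_vertex x p w : w \in x :: map snd p ->
  exists p1 p2, p = p1 ++ p2 /\ last x (map snd p1) = w.
Proof.
elim: p x => [|[e z] p IH] x /=; rewrite inE; first by move=> /eqP->; exists [::], [::].
case/orP=> [/eqP->|]; first by exists [::], ((e, z) :: p).
by move=> /IH[p1 [p2 [-> h]]]; exists ((e, z) :: p1), p2.
Qed.

Lemma disjoint_fst p q : [disjoint eset p & eset q] -> ~~ has (mem (map fst p)) (map fst q).
Proof.
move=> d; apply/hasPn => e eq; apply/negP => ep.
by have := disjointFr d (_ : e \in eset p); rewrite !in_eset => /(_ ep); rewrite eq.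
Qed.

Lemma euler g K x : loopfree g K -> trail_set g K x x -> exists p, is_trail g x p x /\ eset p = K.
Proof.
move=> lf [pK aK].
suff H n p : #|K :\: eset p| < n -> is_trail g x p x -> eset p \subset K ->
    exists p, is_trail g x p x /\ eset p = K.
  apply: (H #|K :\: eset [::]|.+1 [::]) => //; first by rewrite /is_trail /= eqxx.
  by apply/subsetP => e; rewrite inE.
elim: n p => // n IH p ltn tp sp; have [w up] := andP tp.
have [K'0|K'0] := eqVneq (K :\: eset p) set0.
  by exists p; split=> //; apply/eqP; rewrite eqEsubset sp -setD_eq0 K'0 eqxx.
have [pp _] := trail_trail_set tp.
have ev v : ~~ odd (dg g (K :\: eset p) [set v]).
  by have := dgDS g [set v] sp => /(congr1 odd); rewrite oddD pK pp addbb /= => <-.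
pose Y := [set v in x :: map snd p].
have [/exists_inP[v vY /dg_gt0P[e eK ce]]|/exists_inPn no] :=
    boolP [exists v in Y, 0 < dg g (K :\: eset p) [set v]].
  have [z j zv] := cr1_joins ce.
  have cz : conn g (K :\: eset p :\ e) z v.
    apply: conn_cutP => X zX vX; rewrite odd_gt0 //.
    have : ~~ odd (dg g (K :\: eset p) X) by apply: dg_even_cut => u _; apply: ev.
    by rewrite (dgD1 _ _ eK) (joins_cr _ j) zX (negbTE vX) oddD /= negbK.
  have [q [pq sq]] := conn_path cz.
  rewrite inE in vY; have [p1 [p2 [pE vE]]] := split_at_vertex vY.
  have eq' : e \notin eset q by apply/negP => /(subsetP sq); rewrite !inE eqxx.
  have dq : [disjoint eset p & eset ((e, z) :: q)].
    rewrite eset_cons disjoint_sym disjoints_subset subUset sub1set inE.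
    have := eK; rewrite in_setD => /andP[-> _] /=; apply: subset_trans sq _.
    by apply/subsetP => f; rewrite !inE => /andP[_ /andP[]].
  have sK' : eset ((e, z) :: q) \subset K.
    rewrite eset_cons subUset sub1set; move: eK; rewrite inE => /andP[_ ->] /=.
    by apply: subset_trans sq (subset_trans (subsetDl _ _) (subsetDl _ _)).
  pose p' := p1 ++ ((e, z) :: q) ++ p2.
  have esetp' : eset p' = eset p :|: eset ((e, z) :: q).
    by rewrite /p' pE !eset_cat -!setUA; congr (_ :|: _); rewrite setUC.
  apply: (IH p').
  - apply: leq_trans (_ : #|K :\: eset p| <= _); last by rewrite -ltnS.
    apply: proper_card; apply/properP; split; first by apply: setDS; rewrite esetp' subsetUl.
    by exists e => //; rewrite in_setD esetp' in_setU eset_cons in_setU1 eqxx orbT.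
  - rewrite /is_trail; apply/andP; split.
      move: w; rewrite pE /p' !walk_cat => /andP[w1 w2]; rewrite w1 /= vE j /=.
      have /andP[wq _] := pq; rewrite -(walk_last wq) wq /=; by rewrite -vE.
    have u' : uniq (map fst p ++ map fst ((e, z) :: q)).
      rewrite cat_uniq up disjoint_fst //= (path_uniq_edges pq) andbT.
      by move: eq'; rewrite in_eset.
    move: u'; rewrite /p' pE !map_cat; congr (_ = true); apply: perm_uniq.
    by rewrite -catA perm_cat2l perm_catC.
  - by rewrite esetp' subUset sp.
exfalso; have dY : dg g K Y = 0.
  have z1 : dg g (eset p) Y = 0.
    apply/eqP; rewrite -leqn0 leqNgt; apply/negP => /dg_gt0P[e].
    rewrite in_eset => eK; have /andP[a b] := walk_edge_vts w eK.
    by rewrite /cr inE a inE b.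
  rewrite (dgDS _ _ sp) z1; apply/eqP; rewrite -leqn0 leqNgt; apply/negP => /dg_gt0P[e eK ce].
  have [v [_ [_ vY _ vK _]]] := cr_vts eK ce.
  by have := no v vY; rewrite -in_vts vK.
have sY := aK Y _ dY; have {}sY : vts g K \subset Y by apply: sY; rewrite !inE eqxx.
have /set0Pn[e eK] := K'0; have eK1 : e \in K by move: eK; rewrite inE => /andP[].
have /andP[v1 _] := vts_edge eK (lf e eK1); have /andP[v2 _] := vts_edge eK1 (lf e eK1).
by have := no _ (subsetP sY _ v2); rewrite -in_vts v1.
Qed.

Lemma closed_trail_mem g x p v : is_walk g x p x -> v \in vts g (eset p) -> uniq (map fst p) ->
  v \in map snd p.
Proof.
move=> w vp u; have tp : is_trail g x p x by rewrite /is_trail w.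
have := subsetP (trail_vts tp) v vp; rewrite inE => /orP[/eqP vx|//].
have := walk_last w; rewrite vx; case: p w vp u tp => [|[e z] p] _ vp _ _ /=.
  by move: vp; rewrite in_vts => /dg_gt0P[e]; rewrite inE.
by move=> {1}->; apply: mem_last.
Qed.

(** Segment 0 starts at x; the default value y of [nth] is the end of the last segment, number
    [size vs]. *)
Lemma trail_segments g x p y (vs : seq V) : is_walk g x p y -> uniq (map fst p) ->
  subseq vs (map snd p) -> exists F : nat -> {set E}, [/\ forall i, F i \subset eset p,
    forall i j, i != j -> [disjoint F i & F j] &
    forall i, i <= size vs -> conn g (F i) (nth y (x :: vs) i) (nth y vs i)].
Proof.
elim: p x vs => [|[e z] p IH] x vs.
  move=> /= /eqP -> _ /eqP ->; exists (fun=> set0); split=> [i|i j _|[|i] //= _].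
  - exact: sub0set.
  - by rewrite -setI_eq0 set0I.
  - exact: conn_refl.
move=> w /= /andP[ep up]; have /= /andP[j w'] := w.
case: vs => [_|v vs].
  exists (fun i => if i == 0 then eset ((e, z) :: p) else set0); split=> [i|i k|i].
  - by case: ifP; rewrite ?sub0set.
  - move=> ik; case: (eqVneq i 0) => [i0|_]; last by rewrite -setI_eq0 set0I.
    by move: ik; rewrite i0 eq_sym => /negPf->; rewrite -setI_eq0 setI0.
  - by rewrite leqn0 => /eqP -> /=; apply: (walk_conn w).
have dis (S : {set E}) : S \subset eset p -> [disjoint [set e] & S].
  by move=> sS; rewrite disjoints1; apply: contra ep => /(subsetP sS); rewrite in_eset.
case: eqP => [->|_] sv.
  have [F [h1 h2 h3]] := IH z vs w' up sv.
  exists (fun i => if i is i'.+1 then F i' else [set e]); split=> [[|i]|[|i] [|k]|[|i]] //=.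
  - by rewrite eset_cons subsetUl.
  - by rewrite eset_cons; apply: subset_trans (h1 i) (subsetUr _ _).
  - by move=> _; apply: dis.
  - by move=> _; rewrite disjoint_sym; apply: dis.
  - by rewrite eqSS; apply: h2.
  - by move=> _; apply: conn_edge j; rewrite inE.
  - by rewrite ltnS; apply: h3.
have [F [h1 h2 h3]] := IH z (v :: vs) w' up sv.
exists (fun i => if i == 0 then e |: F 0 else F i); split=> [i|i k ik|i le].
- by rewrite eset_cons; case: eqP => _; [apply: setUS | apply: subset_trans (h1 i) (subsetUr _ _)].
- have aux l : l != 0 -> [disjoint e |: F 0 & F l].
    by move=> l0; rewrite -setI_eq0 setIUl setU_eq0 !setI_eq0 dis //=; apply: h2; rewrite eq_sym.
  case: (eqVneq i 0) => [i0|i0]; case: (eqVneq k 0) => [k0|k0].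
  + by move: ik; rewrite i0 k0.
  + exact: aux.
  + by rewrite disjoint_sym; apply: aux.
  + exact: h2.
- case: eqP => [->|/eqP i0] /=.
    apply: (conn_trans (y := z)); first by apply: conn_edge j; rewrite !inE eqxx.
    by apply: conn_mono (h3 0 isT); apply: subsetUr.
  by have := h3 i le; case: i i0 {le}.
Qed.

(** Cyclic order recorded only through the pieces between consecutive entries: this is all that an
    immersed cycle needs, and it is insensitive to reversal. *)
Definition cyclic_in g B (vs : seq V) := exists F : nat -> {set E},
  [/\ forall i, i < size vs -> F i \subset B,
      forall i j, i < size vs -> j < size vs -> i != j -> [disjoint F i & F j] &
      forall v0 i, i < size vs -> conn g (F i) (nth v0 vs i) (nth v0 vs (i.+1 %% size vs))].

Lemma closed_trail_cyclic g x p vs : is_trail g x p x -> subseq vs (map snd p) ->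
  cyclic_in g (eset p) vs.
Proof.
case/andP=> w u sv; have [F [h1 h2 h3]] := trail_segments w u sv.
(* The closing piece passes through the base point x: it is the last segment of the walk together
   with the first. *)
exists (fun i => if i.+1 == size vs then F (size vs) :|: F 0 else F i.+1); split.
- by move=> i _; case: ifP; rewrite ?subUset ?h1.
- have aux i n : 0 < i -> i < n -> [disjoint F n :|: F 0 & F i].
    move=> i0 ltn; rewrite -setI_eq0 setIUl setU_eq0 !setI_eq0 !h2 //; first by rewrite eq_sym -lt0n.
    by rewrite neq_ltn ltn orbT.
  move=> i j li lj ij; case: (eqVneq i.+1 (size vs)) => [qi|ni]; case: (eqVneq j.+1 (size vs)) => [qj|nj].
  + by move: ij; rewrite -eqSS qi qj eqxx.
  + by apply: aux => //; rewrite ltn_neqAle nj.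
  + by rewrite disjoint_sym; apply: aux => //; rewrite ltn_neqAle ni.
  + by apply: h2; rewrite eqSS.
- move=> v0 i li; case: (eqVneq i.+1 (size vs)) => [qi|ni].
    rewrite qi modnn; apply: (conn_trans (y := x)).
      have := h3 (size vs) (leqnn _); rewrite [nth x vs _]nth_default //.
      have -> : nth x (x :: vs) (size vs) = nth v0 vs i by rewrite -qi /= (set_nth_default v0).
      by move=> h; apply: conn_mono h; apply: subsetUl.
    have := h3 0 isT; rewrite /= (set_nth_default v0); last by apply: leq_ltn_trans li.
    by move=> h; apply: conn_mono h; apply: subsetUr.
  have li' : i.+1 < size vs by rewrite ltn_neqAle ni.
  rewrite modn_small //; have := h3 i.+1 (ltnW li'); rewrite /=.
  by rewrite (set_nth_default v0) // (set_nth_default v0 x) // (set_nth_default v0).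
Qed.

Lemma cyclic_in_rev g B vs : cyclic_in g B (rev vs) -> cyclic_in g B vs.
Proof.
case=> F [h1 h2 h3]; rewrite size_rev in h1 h2 h3; set n := size vs in h1 h2 h3 *.
(* Piece i of [vs] is piece n - 2 - i of the reversed list; the closing piece is its own mirror
   image. *)
exists (fun i => F (if i.+1 == n then i else n - i.+2)).
have lt i : i < n -> (if i.+1 == n then i else n - i.+2) < n by case: ifP => //; lia.
split=> [i li|i j li lj ij|v0 i li].
- by apply: h1; apply: lt.
- apply: h2; [exact: lt | exact: lt |]; move: ij li lj; clear.
  by case: (eqVneq i.+1 n); case: (eqVneq j.+1 n); lia.
- have := h3 v0 _ (lt i li); case: (eqVneq i.+1 n) => [q|ne].
    rewrite q modnn !nth_rev -/n ?q; try by move: li; clear; lia.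
    have -> : n - 1 = i by move: q; clear; lia.
    by rewrite subnn conn_sym.
  have li' : i.+1 < n by rewrite ltn_neqAle ne.
  rewrite modn_small ?(modn_small li') ?nth_rev -/n; try by move: li'; clear; lia.
  rewrite conn_sym; congr conn; congr nth; move: li'; clear; lia.
Qed.
End Euler.

(** A halving induction with a crude bound: the rest of [l] is divided into the entries occurring
    after its head x in [l'] and those occurring before. In a large enough first part x extends a
    common subsequence, in the second a reversed one. *)
Lemma erdos_szekeres (T : eqType) a b (l l' : seq T) : uniq l -> {subset l <= l'} -> 2 ^ (a + b) <= size l ->
  (exists vs, [/\ subseq vs l, subseq vs l' & size vs = a]) \/
  (exists vs, [/\ subseq vs l, subseq (rev vs) l' & size vs = b]).
Proof.
have [n] := ubnP (a + b); elim: n a b l l' => // n IH [|a] b l l' ltn.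
  by move=> *; left; exists [::]; rewrite !sub0seq.
case: b ltn => [|b] ltn; first by move=> *; right; exists [::]; rewrite !sub0seq.
case: l => [|x l] /=; first by move=> _ _; rewrite leqNgt expn_gt0.
case/andP=> xl ul sl sz; have xl' : x \in l' by apply: sl; rewrite inE eqxx.
case/splitPr: xl' sl => l1 l2 sl.
pose hi := [seq y <- l | y \in l2]; pose lo := [seq y <- l | y \in l1].
have szl : size l <= size hi + size lo.
  rewrite !size_filter -[count _ _ + _]count_predUI; apply: leq_trans (leq_addr _ _).
  rewrite -size_filter (_ : filter _ l = l) //; apply/all_filterP/allP => y yl /=.
  have := sl y; rewrite inE yl orbT mem_cat inE => /(_ isT).
  by case: (eqVneq y x) => [yx|_] /=; [rewrite -yx yl in xl | rewrite orbC].
have pw : 2 ^ (a.+1 + b.+1) = 2 ^ (a + b.+1) + 2 ^ (a + b.+1) by rewrite addSn expnS mul2n addnn.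
have [big|small] := leqP (2 ^ (a + b.+1)) (size hi).
  have [|||[vs [v1 v2 v3]]|[vs [v1 v2 v3]]] := IH a b.+1 hi l2 _ _ _ big.
  - by move: ltn; clear; lia.
  - exact: filter_uniq.
  - by move=> y; rewrite mem_filter => /andP[].
  - left; exists (x :: vs); split; last by rewrite /= v3.
      by rewrite /= eqxx; apply: subseq_trans v1 (filter_subseq _ _).
    by apply: subseq_trans (suffix_subseq l1 _); rewrite /= eqxx.
  - right; exists vs; split=> //.
      by apply: subseq_trans v1 (subseq_trans (filter_subseq _ _) (subseq_cons _ _)).
    by apply: subseq_trans v2 (subseq_trans (subseq_cons _ x) (suffix_subseq _ _)).
have big : 2 ^ (a.+1 + b) <= size lo.
  rewrite addSnnS; move: sz szl small; rewrite pw; clear; lia.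
have [|||[vs [v1 v2 v3]]|[vs [v1 v2 v3]]] := IH a.+1 b lo l1 _ _ _ big.
- by move: ltn; clear; lia.
- exact: filter_uniq.
- by move=> y; rewrite mem_filter => /andP[].
- left; exists vs; split=> //.
    by apply: subseq_trans v1 (subseq_trans (filter_subseq _ _) (subseq_cons _ _)).
  by apply: subseq_trans v2 (prefix_subseq _ _).
- right; exists (x :: vs); split; last by rewrite /= v3.
    by rewrite /= eqxx; apply: subseq_trans v1 (filter_subseq _ _).
  by rewrite rev_cons -cats1; apply: cat_subseq => //; rewrite /= eqxx sub0seq.
Qed.

(** ** Assembling the immersion *)

Section Assembly.
Variables (V E : finType).
Implicit Types (g : E -> V * V) (A B C K : {set E}) (X Y : {set V}).

Lemma bounded_degree g A : loopfree g A -> (forall X, X != set0 -> X != setT -> 4 <= dg g A X) ->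
  exists g' A', [/\ lifts g A g' A', loopfree g' A',
    forall X, X != set0 -> X != setT -> 4 <= dg g' A' X & forall v, dg g' A' [set v] <= 5].
Proof.
have [n] := ubnP #|A|; elim: n g A => // n IH g A ltn lf h4.
have [/existsP[v dv]|/existsPn small] := boolP [exists v, 5 < dg g A [set v]]; last first.
  by exists g, A; split=> // [|v]; [apply: lifts_sub | rewrite leqNgt].
have [f1 [f2 [u [w [[a1 a2 n12] j1 j2 h4']]]]] := split_off_large lf h4 dv.
have lf' : loopfree (splitg g f1 u w) (splitA A f1 f2 u w) by apply: split_loopless lf.
have ltA : #|splitA A f1 f2 u w| < n by apply: leq_trans (splitA_card f1 u w a2) _.
have [g' [A' [h1 h2 h3 h5]]] := IH _ _ ltA lf' h4'.
exists g', A'; split=> //; apply: lifts_trans h1.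
exact: ex_intro _ _ (split_liftP a1 a2 n12 j1 j2).
Qed.

Lemma vts_eq g g' B : (forall e, e \in B -> g e = g' e) -> vts g B = vts g' B.
Proof.
by move=> h; apply/setP => v; rewrite !in_vts; congr (_ < _); apply: dg_eq_cr => e /h; rewrite /cr => ->.
Qed.

Lemma trail_set_eq g g' B x y : (forall e, e \in B -> g e = g' e) ->
  trail_set g B x y -> trail_set g' B x y.
Proof.
move=> h [p a]; have D X : dg g' B X = dg g B X.
  by apply: dg_eq_cr => e /h; rewrite /cr => ->.
split=> [v|X xX]; first by rewrite D p.
by rewrite D -(vts_eq h); apply: a.
Qed.

Lemma path_vts g x p y v : is_path g x p y -> x != y -> v \in x :: map snd p -> v \in vts g (eset p).
Proof.
move=> pp xy vp; have /andP[w _] := pp; have [tp _] := trail_trail_set (path_trail pp).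
have [->|vx] := eqVneq v x.
  by rewrite in_vts odd_gt0 // tp eqxx (negbTE xy).
have [p1 [p2 [pE vE]]] := split_at_vertex vp.
apply: (conn_vts (x := x)); last by rewrite eq_sym.
rewrite pE walk_cat vE in w; have /andP[w1 _] := w.
by apply: conn_mono (walk_conn w1 (subxx _)); rewrite pE eset_cat subsetUl.
Qed.

(** At degrees up to five a ball of radius n has at most 6^n vertices, so some t lies beyond
    distance [mark_bound N] from s. The path P then has enough vertices as marks, and all of them
    lie on [C], which contains P. *)
Lemma two_closed_trails N g A : loopfree g A ->
  (forall X, X != set0 -> X != setT -> 4 <= dg g A X) -> (forall v, dg g A [set v] <= 5) ->
  6 ^ mark_bound N < #|V| ->
  exists C K s, [/\ C \subset A, K \subset A, [disjoint C & K],
    trail_set g C s s /\ trail_set g K s s & N <= #|vts g C :&: vts g K|].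
Proof.
move=> lf h4 d5 big; have /card_gt0P[s _] : 0 < #|V| by apply: leq_trans big.
have [t far] : exists t, t \notin ball g A (mark_bound N) s.
  apply/existsP; apply: contraTT big => /existsPn al; rewrite -leqNgt.
  apply: leq_trans (card_ball lf d5 (mark_bound N) s); apply: subset_leq_card.
  by apply/subsetP => v _; have := al v; rewrite negbK.
have st : s != t.
  by apply: contraNneq far => <-; apply: (walk_ball (p := [::])) => //=; apply/subsetP => e; rewrite inE.
have supT g' B : supported g' B setT by move=> e _; rewrite !inE.
have fe : feasible g A setT [set s; t] s t.
  by move=> X _ X0 XT; apply: leq_trans (h4 X X0 XT); case: ifP.
have [p [pp sp hp]] := robust_path lf (supT g A) (in_setT s) (in_setT t) st fe (fun v _ _ _ => d5 v).
have /andP[w up] := pp; pose M := [set v in s :: map snd p].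
have sM : s \in M by rewrite inE mem_head.
have tM : t \in M by rewrite inE (walk_last w) mem_last.
have cM : mark_bound N < #|M|.
  rewrite cardsE (card_uniqP up) /= size_map ltnS leqNgt; apply: contraNN far => lt.
  by apply: walk_ball w sp _; apply: ltnW.
have /card_gt0P[eps epsP] : 0 < #|eset p|.
  rewrite -(size_path pp); case: (p) w => //= /eqP q; by rewrite q eqxx in st.
pose g1 e := if e == eps then (s, t) else g e; pose A1 := eps |: (A :\: eset p).
have A1E : A1 :\ eps = A :\: eset p.
  apply/setP => e; rewrite !inE; case: eqVneq => [->|] //=.
  by move: epsP; rewrite inE => ->.
have eA1 : eps \in A1 by rewrite in_setU1 eqxx.
have j1 : joins g1 eps s t by rewrite /joins /g1 eqxx eqxx.
have g1E e : e \in A :\: eset p -> g1 e = g e.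
  by rewrite -A1E in_setD1 /g1 => /andP[/negPf->].
have D X : dg g1 A1 X = (s \in X) (+) (t \in X) + dg g (A :\: eset p) X.
  rewrite (dgD1 _ _ eA1) (joins_cr _ j1) A1E; congr (_ + _).
  by apply: dg_eq_cr => e /g1E; rewrite /cr => ->.
have offM X : (forall v, v \in M -> v \in X = false) \/ (forall v, v \in M -> v \in X) ->
    dg g (A :\: eset p) X = dg g A X.
  move=> h; rewrite (dgDS _ _ sp) (_ : dg g (eset p) X = 0) //.
  apply/eqP; rewrite -leqn0 leqNgt; apply/negP => /dg_gt0P[e]; rewrite in_eset => eP.
  have /andP[a b] := walk_edge_vts w eP.
  have aM : (g e).1 \in M by rewrite inE.
  have bM : (g e).2 \in M by rewrite inE.
  by rewrite /cr; case: h => h; rewrite !h.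
(* An s-t cut keeps three edges by [robust_path] and gains [eps]; a set with all marks on one side
   is not crossed by the path and keeps its four. This is the origin of [four]. *)
have fe1 : feasible g1 A1 setT M s t.
  move=> X _ X0 XT; have := hp X (subsetT X) X0 XT; rewrite D.
  case: ifP => [/or3P[d|d|->]|_]; last 1 first.
  - by case: (_ (+) _); move: (dg g _ X) => k; clear; lia.
  - move=> _; apply: leq_trans (leq_addl _ _); rewrite offM; first exact: h4.
    by left=> v; apply: disjointFl.
  - move=> _; apply: leq_trans (leq_addl _ _); rewrite offM; first exact: h4.
    by right=> v; apply: (subsetP d).
  - by move: (dg g _ X) => k; clear; lia.
have lf1 : loopfree g1 A1.
  move=> e; rewrite in_setU1 /g1; case: eqP => [//|_] /=; rewrite in_setD => /andP[_]; exact: lf.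
have le5 v : dg g (A :\: eset p) [set v] <= 5 by apply: leq_trans (d5 v); apply: dgS; apply: subsetDl.
have d51 v : v \in setT -> v \notin M -> dg g1 A1 [set v] <= 5.
  move=> _ vM; rewrite D !inE.
  have /negPf-> : s != v by apply: contraNneq vM => <-.
  have /negPf-> : t != v by apply: contraNneq vM => <-.
  exact: le5.
(* At s and t the edge [eps] may add one to the bound five. *)
have d6 v : dg g1 A1 [set v] <= 6.
  by rewrite D; apply: leq_trans (leq_add (leq_b1 _) (le5 v)) _.
have [Q [K [sQ sK dQK [tQ tK] cK]]] :=
  closed_trail_exists lf1 (supT g1 A1) sM tM (subsetT M) st fe1 eA1 j1 d51 d6 cM.
rewrite A1E in sQ sK.
have eQ e : e \in Q -> g1 e = g e by move=> /(subsetP sQ); apply: g1E.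
have eK e : e \in K -> g1 e = g e by move=> /(subsetP sK); apply: g1E.
move: sQ sK; rewrite !subsetD => /andP[sQ dQ] /andP[sK dK].
exists (eset p :|: Q), K, s; split=> //.
- by rewrite subUset sp.
- by rewrite -setI_eq0 setIUl setU_eq0 !setI_eq0 dQK andbT disjoint_sym.
- split; last exact: trail_set_eq eK tK.
  apply: trail_set_cat (trail_trail_set (path_trail pp)) (trail_set_sym (trail_set_eq eQ tQ)).
  by rewrite disjoint_sym.
- apply: leq_trans cK _; rewrite (vts_eq eK); apply: subset_leq_card; apply: setSI.
  apply/subsetP => v; rewrite inE vtsU in_setU => vM; by rewrite (path_vts pp st vM).
Qed.

Lemma two_cyclic r g A : loopfree g A ->
  (forall X, X != set0 -> X != setT -> 4 <= dg g A X) -> (forall v, dg g A [set v] <= 5) ->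
  6 ^ mark_bound (2 ^ (r + r)) < #|V| ->
  exists C K vs, [/\ C \subset A, K \subset A, [disjoint C & K], uniq vs /\ size vs = r &
    cyclic_in g C vs /\ cyclic_in g K vs].
Proof.
move=> lf h4 d5 big; have [C [K [s [sC sK dCK [tC tK] cW]]]] := two_closed_trails lf h4 d5 big.
have lfS B : B \subset A -> loopfree g B by move=> sB e /(subsetP sB)/lf.
have [pC [trC eC]] := euler (lfS _ sC) tC; have [pK [trK eK]] := euler (lfS _ sK) tK.
set W := vts g C :&: vts g K in cW.
have memC v : v \in W -> v \in map snd pC.
  by rewrite in_setI -eC => /andP[vC _]; have /andP[w u] := trC; exact: closed_trail_mem w vC u.
have memK v : v \in W -> v \in map snd pK.
  by rewrite in_setI -eK => /andP[_ vK]; have /andP[w u] := trK; exact: closed_trail_mem w vK u.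
pose l := [seq v <- undup (map snd pC) | v \in W].
have ul : uniq l by rewrite filter_uniq ?undup_uniq.
have sl : subseq l (map snd pC) by apply: subseq_trans (filter_subseq _ _) (undup_subseq _).
have szl : 2 ^ (r + r) <= size l.
  apply: leq_trans cW _; rewrite cardE; apply: uniq_leq_size; first exact: enum_uniq.
  by move=> v; rewrite mem_enum mem_filter mem_undup => vW; rewrite vW memC.
have lK : {subset l <= map snd pK} by move=> v; rewrite mem_filter => /andP[/memK].
have cycC vs : subseq vs l -> cyclic_in g C vs.
  by move=> h; rewrite -eC; apply: (closed_trail_cyclic trC); apply: subseq_trans h sl.
have cycK vs : subseq vs (map snd pK) -> cyclic_in g K vs.
  by rewrite -eK; apply: closed_trail_cyclic trK.
have [[vs [v1 v2 v3]]|[vs [v1 v2 v3]]] := erdos_szekeres ul lK szl; exists C, K, vs.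
  split=> //; first by split=> //; apply: subseq_uniq v1 ul.
  by split; [apply: cycC | apply: cycK].
split=> //; first by split=> //; apply: subseq_uniq v1 ul.
by split; [apply: cycC | apply: cyclic_in_rev; apply: cycK].
Qed.

(** The two copies of the i-th cycle edge take the i-th pieces of [C] and of [K]. Pieces lift to
    disjoint edge sets of the original graph, and any path inside a lifted piece joins the required
    terminals. *)
Lemma immersion_of_cyclic r g0 g A C K (vs : seq V) : lifts g0 setT g A ->
  C \subset A -> K \subset A -> [disjoint C & K] -> uniq vs -> size vs = r ->
  cyclic_in g C vs -> cyclic_in g K vs -> 0 < r -> immersion g0 (Cends 2 r).
Proof.
move=> [L lL] sC sK dCK uv sz [F [F1 F2 F3]] [G [G1 G2 G3]] r0; rewrite sz in F1 F2 F3 G1 G2 G3.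
have [v0 _] : exists v0, v0 \in vs by case: vs sz {uv F3 G3} => [|v vs] sz; [rewrite -sz in r0 | exists v; rewrite inE eqxx].
pose H (f : 'I_r * 'I_2) := if f.2 == ord0 then F f.1 else G f.1.
have HA f : H f \subset A.
  by rewrite /H; case: ifP => _; [apply: subset_trans (F1 _ _) sC | apply: subset_trans (G1 _ _) sK].
have Hd f f' : f != f' -> [disjoint H f & H f'].
  have FG i j : i < r -> j < r -> [disjoint F i & G j].
    by move=> li lj; apply: disjointWl (F1 i li) _; apply: disjointWr (G1 j lj) _.
  case: f f' => i a [j b]; rewrite /H /= xpair_eqE negb_and => ne.
  case: (eqVneq a ord0) => [a0|a0]; case: (eqVneq b ord0) => [b0|b0].
  - by apply: F2 => //; move: ne; rewrite a0 b0 eqxx orbF.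
  - exact: FG.
  - by rewrite disjoint_sym; apply: FG.
  - apply: G2 => //; move: ne; rewrite -(ord2 a) -(ord2 b) (negbTE a0) (negbTE b0) eqxx orbF //.
case: (lL) => l1 l2 _ _.
have /fin_all_exists[P hP] : forall f : 'I_r * 'I_2, exists p,
    is_path g0 (nth v0 vs f.1) p (nth v0 vs (ordS f.1)) /\ eset p \subset L (H f).
  move=> f; apply: conn_path; apply: (lift_conn lL (HA f)).
  by rewrite /H; case: ifP => _; [apply: F3 | apply: G3].
exists (fun i : 'I_r => nth v0 vs i), P; split.
- move=> i j /eqP; rewrite nth_uniq ?sz // => /eqP; exact: val_inj.
- by move=> f; case: (hP f).
- move=> f f' ne; have dL := l2 _ _ (HA f) (HA f') (Hd f f' ne).
  have d : [disjoint eset (P f) & eset (P f')].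
    by apply: disjointWl (hP f).2 _; apply: disjointWr (hP f').2 _.
  apply/pred0P => e /=; apply/negP => /andP[e1 e2].
  by have := disjointFr d (_ : e \in eset (P f)); rewrite !in_eset => /(_ e1); rewrite e2.
Qed.
End Assembly.

Unset Implicit Arguments.
Theorem theorem1p3 :
  forall r : nat, 4 <= r ->
  exists fr : nat,
    forall (V E : finType) (ends : E -> V * V),
      loopless ends ->
      k_edge_connected ends 4 ->
      fr <= #|V| ->
      immersion ends (Cends 2 r).
Proof.
(* The closed trails need 2^(r + r) common vertices, so that [erdos_szekeres] yields r of them in
   either orientation. *)
move=> r r4; exists (6 ^ mark_bound (2 ^ (r + r))).+1 => V E ends lp kc big.
have lf : loopfree ends setT by move=> e _; apply: lp.
have h4 (X : {set V}) : X != set0 -> X != setT -> 4 <= dg ends setT X.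
  by move=> X0 XT; rewrite -edge_cutE; apply: kc.
have [g [A [lA lfA cA dA]]] := bounded_degree lf h4.
have [C [K [vs [sC sK dCK [uv sz] [cC cK]]]]] := two_cyclic lfA cA dA big.
apply: immersion_of_cyclic lA sC sK dCK uv sz cC cK _.
exact: leq_trans r4.
Qed.
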